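(* Let the delay problem $$u'(t)+Au(t)=g(t,u(t),u^\tau(t)),\ t>0,\qquad u(t)=\phi(t),\ t\le 0,$$ satisfy the assumptions listed in the context, let $u$ be its exact solution and $f(t)=g(t,u(t),u^\tau(t))$. Fix collocation parameters $c_1,\dots,c_s$ and a constant $\varrho>1$. Assume that $f:\mathcal I^\mu\to X$ is $s$ times differentiable for $\mu=1,2,\dots,m+1$, with $f^{(s)}\in L^\infty(0,T;X)$. Then there exist constants $h_0>0$, $R_0>0$ and $C>0$, where $C$ depends on $T$ but $h_0,R_0,C$ are independent of the step size sequence, such that for every admissible mesh $0=t_0<\dots<t_N=T$ with $h_j\le\varrho h_{j+1}$ for all $j$ and $h=\max_{1\le j\le N}h_j\le h_0$, the following holds. The numerical solution $W$ of the ERKC-C method is determined uniquely (i.e. the ERKC-C scheme has exactly one solution whose stages satisfy $\|W_{n,i}-u(t_{n,i})\|_V\le R_0$ for all $n,i$), and $$\max_{0\le t\le T}\|W(t)-u(t)\|_V\le Ch^s\sup_{\sigma\in[0,T]}\|f^{(s)}(\sigma)\|_X.$$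
   Context: Setting. $(X,\|\cdot\|)$ is a Banach space, $T>0$. $A:D(A)\to X$ is a sectorial operator with $\overline{D(A)}=X$ and $\mathrm{Re}\,\sigma(A)>0$; thus $-A$ generates an analytic semigroup $\{\mathrm e^{-tA}\}_{t\ge0}$ and the fractional powers of $A$ are defined. For a fixed $0\le\alpha<1$, $V=\{v\in X:A^\alpha v\in X\}$ (i.e. $V=D(A^\alpha)$) with $\|v\|_V=\|A^\alpha v\|$. Delay. $\tau:[0,\infty)\to\mathbb R^+$ is continuous, there is $\tau_0>0$ with $\tau(t)\ge\tau_0$ for all $t\ge0$, and $t-\tau(t)$ is strictly increasing for $t\ge 0$. For a function $v$ of time, $v^\tau(t)=v(t-\tau(t))$. The initial function $\phi$ is $V$-valued. Exact solution. The problem has a solution $u$ with values in $V$ on $[0,T]$, $u=\phi$ for $t\le0$, satisfying the variation-of-constants formula $u(t)=\mathrm e^{-(t-r)A}u(r)+\int_r^t\mathrm e^{-(t-\sigma)A}g(\sigma,u(\sigma),u^\tau(\sigma))\,\mathrm d\sigma$ for $0\le r\le t\le T$. Nonlinearity. $g:[0,T]\times V\times V\to X$ is locally Lipschitz in a strip along $u$: there are $R>0$ and $L=L(R,T)$ with $\|g(t,v_1,w_1)-g(t,v_2,w_2)\|\le L(\|v_1-v_2\|_V+\|w_1-w_2\|_V)$ for all $t\in[0,T]$ and all $v_1,v_2,w_1,w_2\in V$ with $\max(\|v_1-u(t)\|_V,\|v_2-u(t)\|_V,\|w_1-u^\tau(t)\|_V,\|w_2-u^\tau(t)\|_V)\le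 R$. Discontinuity points. $\xi_0=0$, and $\xi_{\mu+1}-\tau(\xi_{\mu+1})=\xi_\mu$; $J=\{\xi_\mu:\xi_\mu<T\}=\{\xi_0,\dots,\xi_m\}$ and $\mathcal I^\mu=[\xi_{\mu-1},\min\{\xi_\mu,T\}]$ for $\mu=1,\dots,m+1$. Derivatives of functions that are only piecewise smooth are understood separately on each $\mathcal I^\mu$ (one-sided at endpoints), and suprema over $[0,T]$ of such derivatives are taken over all segments $\mathcal I^\mu$. Mesh. An admissible mesh is $0=t_0<t_1<\dots<t_N=T$ containing $J$. Put $I_{n+1}=[t_n,t_{n+1}]$, $h_{n+1}=t_{n+1}-t_n$, $h=\max_n h_n$. Collocation parameters: distinct $c_1,\dots,c_s\in[0,1]$ ($s\ge1$); $t_{n,i}=t_n+c_ih_{n+1}$. Coefficients. $\ell_j(\rho)=\prod_{m\ne j}\frac{\rho-c_m}{c_j-c_m}$, $b_i(\theta;-hA)=\int_0^\theta\mathrm e^{-(\theta-\xi)hA}\ell_i(\xi)\,\mathrm d\xi$, $b_i(-hA)=b_i(1;-hA)$, $a_{ij}(-hA)=b_j(c_i;-hA)$. ERKC-C method. $W_0=\phi(0)$ and, for $n=0,\dots,N-1$, $$W_{n+1}=\mathrm e^{-h_{n+1}A}W_n+h_{n+1}\sum_{i=1}^sb_i(-h_{n+1}A)G_{n,i},\qquad W_{n,i}=\mathrm e^{-c_ih_{n+1}A}W_n+h_{n+1}\sum_{j=1}^sa_{ij}(-h_{n+1}A)G_{n,j},$$ $$G_{n,j}=g(t_{n,j},W_{n,j},W^\tau(t_{n,j})),\qquad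 1\le i,j\le s,$$ where $W(t)=\phi(t)$ for $t\le0$ and, for $t=t_k+\theta h_{k+1}$ with $0\le k\le N-1$, $\theta\in(0,1]$, $$W(t_k+\theta h_{k+1})=\mathrm e^{-\theta h_{k+1}A}W_k+h_{k+1}\sum_{i=1}^sb_i(\theta;-h_{k+1}A)G_{k,i}.$$ For $h\le\tau_0$ the delayed arguments only involve previously computed intervals. *)

(* Defs.v *)
From Stdlib Require Import Reals Lra Lia List.
From Coquelicot Require Import Coquelicot.

Set Implicit Arguments.
Unset Strict Implicit.
Unset Printing Implicit Defensive.

Open Scope R_scope.

(* Banach spaces are real.  A complex Banach space is covered by restriction of
   scalars; resolvents and spectra live on the complexification X * X, where
   (x, y) stands for x + i y.  For a complex-linear operator regarded as a
   real-linear one this only replaces the spectrum by its union with its complex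
   conjugate, which affects neither the sectors below nor Re sigma(A) > 0. *)

Section Operators.

Variable X : CompleteNormedModule R_AbsRing.

(* Unbounded operator: the values of [app] outside [dom] are irrelevant. *)
Record operator := Operator { dom : X -> Prop; app : X -> X }.

Definition linear_operator (A : operator) : Prop :=
  dom A zero /\
  (forall x y, dom A x -> dom A y ->
     dom A (plus x y) /\ app A (plus x y) = plus (app A x) (app A y)) /\
  (forall (k : R) x, dom A x ->
     dom A (scal k x) /\ app A (scal k x) = scal k (app A x)).

Definition closed_operator (A : operator) : Prop :=
  closed (fun p : X * X => dom A (fst p) /\ app A (fst p) = snd p).

Definition densely_defined (A : operator) : Prop :=
  forall (x : X) (eps : R), 0 < eps ->
    exists y, dom A y /\ norm (minus y x) < eps.

Definition cscal (lam : C) (z : X * X) : X * X :=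
  (minus (scal (Re lam) (fst z)) (scal (Im lam) (snd z)),
   plus (scal (Re lam) (snd z)) (scal (Im lam) (fst z))).

Definition cdom (A : operator) (z : X * X) : Prop :=
  dom A (fst z) /\ dom A (snd z).

Definition capp (A : operator) (z : X * X) : X * X :=
  (app A (fst z), app A (snd z)).

(* [Res] is (lam - A)^{-1}.  The norm of the complexification is the Euclidean
   product norm, which is equivalent to any of the usual complex norms. *)
Definition is_resolvent (A : operator) (lam : C) (Res : X * X -> X * X) : Prop :=
  (forall z, cdom A (Res z) /\ minus (cscal lam (Res z)) (capp A (Res z)) = z) /\
  (forall z, cdom A z -> Res (minus (cscal lam z) (capp A z)) = z) /\
  (exists K, forall z, norm (Res z) <= K * norm z).

Definition spectrum (A : operator) (lam : C) : Prop :=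
  ~ exists Res, is_resolvent A lam Res.

(* The resolvent set contains the sector
   { lam <> a : phi <= |arg (lam - a)| <= pi }, written in polar coordinates
   around a, and |(lam - A)^{-1}| <= M / |lam - a| there. *)
Definition sectorial (A : operator) : Prop :=
  linear_operator A /\ closed_operator A /\
  exists a phi M : R, 0 < phi < PI / 2 /\ 1 <= M /\
    forall r theta, 0 < r -> phi <= Rabs theta <= PI ->
      exists Res,
        is_resolvent A (a + r * cos theta, r * sin theta) Res /\
        forall z, norm (Res z) <= M / r * norm z.

(* E t = e^{-tA}: the strongly continuous semigroup with generator -A (domains
   included).  It is determined by A, and analytic when A is sectorial. *)
Definition semigroup_generated_by_opp (A : operator) (E : R -> X -> X) : Prop :=
  (forall t, 0 <= t -> is_linear (E t)) /\
  (forall x, E 0 x = x) /\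
  (forall s t x, 0 <= s -> 0 <= t -> E (s + t) x = E s (E t x)) /\
  (forall x, filterlim (fun t => E t x) (at_right 0) (locally x)) /\
  (forall x y,
     filterlim (fun t => scal (/ t) (minus (E t x) x)) (at_right 0) (locally y)
     <-> dom A x /\ y = opp (app A x)).

Definition Gamma (a : R) : R :=
  RInt_gen (V := R_CompleteNormedModule)
    (fun t => Rpower t (a - 1) * exp (- t)) (at_right 0) (Rbar_locally p_infty).

(* A^{-a} = 1 / Gamma(a) int_0^oo t^{a-1} e^{-tA} dt, for a > 0. *)
Definition frac_inv (E : R -> X -> X) (a : R) (x : X) : X :=
  scal (/ Gamma a)
    (RInt_gen (fun t => scal (Rpower t (a - 1)) (E t x))
       (at_right 0) (Rbar_locally p_infty)).

(* A^a is the inverse of A^{-a} on its range for a > 0, and A^0 = I. *)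
Definition frac_power (E : R -> X -> X) (a : R) : operator :=
  if Req_EM_T a 0 then Operator (fun _ => True) (fun x => x)
  else Operator (fun v => exists w, frac_inv E a w = v)
                (fun v => iota (fun w => frac_inv E a w = v)).

Definition inV (E : R -> X -> X) (alpha : R) (v : X) : Prop :=
  dom (frac_power E alpha) v.

Definition normV (E : R -> X -> X) (alpha : R) (v : X) : R :=
  norm (app (frac_power E alpha) v).

End Operators.

Section Delay.

Definition admissible_delay (tau : R -> R) (tau0 : R) : Prop :=
  (forall t, 0 <= t ->
     filterlim tau (within (fun r => 0 <= r) (locally t)) (locally (tau t))) /\
  0 < tau0 /\
  (forall t, 0 <= t -> tau0 <= tau t) /\
  (forall r t, 0 <= r -> r < t -> r - tau r < t - tau t).

(* xi 0, ..., xi m are the discontinuity points smaller than T.  The last clause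
   says that xi_{m+1} is either not smaller than T or does not exist, which
   happens when t - tau(t) stays below xi_m; hence min {xi_{m+1}, T} = T. *)
Definition discontinuity_points (tau : R -> R) (T : R) (m : nat) (xi : nat -> R)
    : Prop :=
  xi 0%nat = 0 /\
  (forall mu, (mu < m)%nat ->
     0 <= xi (S mu) /\ xi (S mu) - tau (xi (S mu)) = xi mu) /\
  xi m < T /\
  (forall t, 0 <= t < T -> t - tau t <> xi m).

(* The interval I^mu, for 1 <= mu <= m + 1. *)
Definition segment (T : R) (m : nat) (xi : nat -> R) (mu : nat) (t : R) : Prop :=
  xi (pred mu) <= t <= (if Nat.leb mu m then xi mu else T).

End Delay.

Section Regularity.

Variable X : CompleteNormedModule R_AbsRing.

Definition is_derive_on (D : R -> Prop) (f : R -> X) (t : R) (l : X) : Prop :=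
  filterlim (fun r => scal (/ (r - t)) (minus (f r) (f t)))
    (within (fun r => D r /\ r <> t) (locally t)) (locally l).

Fixpoint is_derive_n_on (D : R -> Prop) (f : R -> X) (k : nat) (fk : R -> X)
    : Prop :=
  match k with
  | O => forall t, D t -> fk t = f t
  | S j => exists fj, is_derive_n_on D f j fj /\
             forall t, D t -> is_derive_on D fj t (fk t)
  end.

Definition lebesgue_null (P : R -> Prop) : Prop :=
  forall eps, 0 < eps ->
    exists a b : nat -> R,
      (forall n, a n <= b n) /\
      (forall t, P t -> exists n, a n < t < b n) /\
      exists l, is_series (fun n => b n - a n) l /\ l <= eps.

(* fs mu is the function on I^mu.  Membership in L^oo only asks for an essential
   bound: an everywhere existing derivative is strongly measurable. *)
Definition ess_bounded (T : R) (m : nat) (xi : nat -> R) (fs : nat -> R -> X)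
    : Prop :=
  exists M, lebesgue_null (fun t =>
    exists mu, (1 <= mu <= m + 1)%nat /\ segment T m xi mu t /\
      M < norm (fs mu t)).

Definition sup_norm (T : R) (m : nat) (xi : nat -> R) (fs : nat -> R -> X)
    : Rbar :=
  Lub_Rbar (fun y =>
    exists mu t, (1 <= mu <= m + 1)%nat /\ segment T m xi mu t /\
      y = norm (fs mu t)).

End Regularity.

Section Mesh.

(* step t n is h_{n+1}. *)
Definition step (t : nat -> R) (n : nat) : R := t (S n) - t n.

Fixpoint mesh_size (t : nat -> R) (N : nat) : R :=
  match N with
  | O => 0
  | S n => Rmax (mesh_size t n) (step t n)
  end.

Definition admissible_mesh (T : R) (m : nat) (xi : nat -> R)
    (N : nat) (t : nat -> R) : Prop :=
  t 0%nat = 0 /\ t N = T /\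
  (forall n, (n < N)%nat -> t n < t (S n)) /\
  (forall mu, (mu <= m)%nat -> exists n, (n <= N)%nat /\ t n = xi mu).

(* Collocation parameters are numbered from 0 to s - 1. *)
Definition collocation_parameters (s : nat) (c : nat -> R) : Prop :=
  (1 <= s)%nat /\
  (forall i, (i < s)%nat -> 0 <= c i <= 1) /\
  (forall i j, (i < s)%nat -> (j < s)%nat -> i <> j -> c i <> c j).

Definition lagrange (s : nat) (c : nat -> R) (j : nat) (rho : R) : R :=
  fold_right Rmult 1
    (map (fun k => if Nat.eqb k j then 1 else (rho - c k) / (c j - c k))
       (seq 0 s)).

Definition stage_time (c : nat -> R) (t : nat -> R) (n i : nat) : R :=
  t n + c i * step t n.

End Mesh.

Section Method.

Variable X : CompleteNormedModule R_AbsRing.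
Variable E : R -> X -> X.

(* b_i(theta; -hA) x. *)
Definition b_coef (s : nat) (c : nat -> R) (h : R) (i : nat) (theta : R) (x : X)
    : X :=
  RInt (fun rho => scal (lagrange s c i rho) (E ((theta - rho) * h) x)) 0 theta.

(* e^{-theta h A} w + h sum_i b_i(theta; -hA) G_i.  Since b_i(-hA) is
   b_i(1; -hA) and a_ij(-hA) is b_j(c_i; -hA), the cases theta = 1 and
   theta = c_i give the new node and the stages. *)
Definition erkc_update (s : nat) (c : nat -> R) (h theta : R) (w : X)
    (G : nat -> X) : X :=
  plus (E (theta * h) w)
    (scal h (sum_n (fun i => b_coef s c h i theta (G i)) (pred s))).

End Method.

Record numerical_solution (X : CompleteNormedModule R_AbsRing) :=
  NumericalSolution {
    node : nat -> X;
    stage : nat -> nat -> X;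
    dense : R -> X
  }.

Section Scheme.

Variable X : CompleteNormedModule R_AbsRing.
Variables (E : R -> X -> X) (alpha : R).
Variables (g : R -> X -> X -> X) (tau : R -> R) (phi : R -> X).
Variables (s : nat) (c : nat -> R).
Variables (N : nat) (t : nat -> R).

(* G_{n,j}. *)
Definition stage_value (W : numerical_solution X) (n j : nat) : X :=
  let r := stage_time c t n j in g r (stage W n j) (dense W (r - tau r)).

(* As g is only given on [0,T] x V x V, its arguments are required to be
   in V. *)
Definition erkc_solution (W : numerical_solution X) : Prop :=
  (forall n i, (n < N)%nat -> (i < s)%nat ->
     inV E alpha (stage W n i) /\
     inV E alpha (dense W (stage_time c t n i - tau (stage_time c t n i)))) /\
  node W 0 = phi 0 /\
  (forall n, (n < N)%nat ->
     node W (S n) = erkc_update E s c (step t n) 1 (node W n) (stage_value W n)) /\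
  (forall n i, (n < N)%nat -> (i < s)%nat ->
     stage W n i =
       erkc_update E s c (step t n) (c i) (node W n) (stage_value W n)) /\
  (forall r, r <= 0 -> dense W r = phi r) /\
  (forall k theta, (k < N)%nat -> 0 < theta <= 1 ->
     dense W (t k + theta * step t k) =
       erkc_update E s c (step t k) theta (node W k) (stage_value W k)).

Definition stages_within (u : R -> X) (R0 : R) (W : numerical_solution X) : Prop :=
  forall n i, (n < N)%nat -> (i < s)%nat ->
    inV E alpha (stage W n i) /\
    normV E alpha (minus (stage W n i) (u (stage_time c t n i))) <= R0.

(* Equality up to the values that the scheme does not involve. *)
Definition same_solution (T : R) (W W' : numerical_solution X) : Prop :=
  (forall n, (n <= N)%nat -> node W n = node W' n) /\
  (forall n i, (n < N)%nat -> (i < s)%nat -> stage W n i = stage W' n i) /\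
  (forall r, r <= T -> dense W r = dense W' r).

End Scheme.

Section Problem.

Variable X : CompleteNormedModule R_AbsRing.
Variables (E : R -> X -> X) (alpha : R).
Variables (g : R -> X -> X -> X) (tau : R -> R) (phi : R -> X).
Variables (T : R) (u : R -> X).

Definition rhs_along (t : R) : X := g t (u t) (u (t - tau t)).

(* The integrand is continuous in the situations considered, so the Riemann
   integral is the Bochner integral. *)
Definition exact_solution : Prop :=
  (forall t, 0 <= t <= T -> inV E alpha (u t)) /\
  (forall t, t <= 0 -> u t = phi t) /\
  (forall r t, 0 <= r -> r <= t -> t <= T ->
     let F := fun sigma => E (t - sigma) (rhs_along sigma) in
     ex_RInt F r t /\ u t = plus (E (t - r) (u r)) (RInt F r t)).

Definition lipschitz_in_strip (Rs L : R) : Prop :=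
  forall t v1 w1 v2 w2, 0 <= t <= T ->
    inV E alpha v1 -> inV E alpha v2 -> inV E alpha w1 -> inV E alpha w2 ->
    normV E alpha (minus v1 (u t)) <= Rs ->
    normV E alpha (minus v2 (u t)) <= Rs ->
    normV E alpha (minus w1 (u (t - tau t))) <= Rs ->
    normV E alpha (minus w2 (u (t - tau t))) <= Rs ->
    norm (minus (g t v1 w1) (g t v2 w2)) <=
      L * (normV E alpha (minus v1 v2) + normV E alpha (minus w1 w2)).

End Problem.

(* Main.v *)
(** The semigroup.  Let K be the resolvent constant and B = A^{-1}.  For a bump
    q on a window [0, l] with q and q' vanishing at the ends, integration by
    parts turns the Fourier coefficients of q(s) e^{-w s} E(s) y at frequency eta
    into resolvents, twice, and bounds them by a constant times |B y| / (w + |eta|)^2.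
    They are summable, with a sum of order |B y| / w, and Fejer summation then
    recovers the value at s = t.  This gives t^2 |E(t) y| <= c e^{w t} / w |B y|
    for every w above the growth bound.  With w close to w0 it shows that a growth
    bound w0 >= 0 can be lowered by a fixed amount, so E is bounded; with
    w = 1 / t it gives |A E(t)| <= C / t.

    Fractional powers.  For I_a = int_0^oo t^{a-1} E(t) dt the product
    I_a I_{1-a} is a positive multiple of B.  Hence A^{-a} is injective with
    |A^a E(t)| <= C t^{-a}.

    Convergence.  The numerical solution is a mild solution whose right hand side
    is the interpolant of the stage values.  Its defect along the exact solution
    is the interpolation error of f, which is at most (Lambda + 1) h^s sup |f^(s)|
    with the Lebesgue constant Lambda.  A Gronwall argument with the kernel
    C t^{-alpha} in an exponentially weighted norm bounds the error by the defect.
    The stages exist by a contraction argument, for which the defect has to be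
    small compared with the radius of the strip; as f^(s) is only essentially
    bounded, this smallness is taken from the uniform continuity of f. *)

(* The semigroup is given only through its generator, so no contour integral for it is at hand and
   every estimate has to be extracted from the orbits. The decisive point is that the constant of
   the bound on t^2 |E(t) y| contains neither the growth constant [M] nor the exponent [w0]. Both
   enter only through the far end of the window and through the last derivative of the bump, and a
   window longer than a multiple of M / (w - w0) makes these contributions smaller than the fixed
   boundary term at 0. Without this uniformity the lowering of the growth bound could not be
   repeated. A finite window replaces Fourier inversion on the line by Fourier series, and Fejer
   means ask for no more than continuity of the orbit.

   The norm of the fractional space is defined through the inverse of an injective operator, so
   estimates in it exhibit a preimage of bounded norm. The singularity of A^alpha E(r) at r = 0 is
   met in one lemma on convolutions only; afterwards it survives as increments of its primitive,
   which telescope along a mesh with arbitrary steps. *)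
From Stdlib Require Import Reals Lra Lia List Arith ClassicalEpsilon.
From Coquelicot Require Import Coquelicot.
Require Import Defs.

Set Implicit Arguments.
Unset Strict Implicit.
Unset Printing Implicit Defensive.

Open Scope R_scope.

(** * Linear identities by reflection *)

Section VectorExpressions.

Variable X : NormedModule R_AbsRing.

(** Atoms are vectors, while scalars remain real terms. Two expressions agree once the coefficients
    of each atom agree, which leaves goals for [ring] or [field] over the reals. *)
Inductive vexp :=
| VAtom (n : nat)
| VZero
| VPlus (a b : vexp)
| VMinus (a b : vexp)
| VOpp (a : vexp)
| VScal (k : R) (a : vexp).

Fixpoint vdenote (env : list X) (e : vexp) : X :=
  match e with
  | VAtom n => nth n env zero
  | VZero => zero
  | VPlus a b => plus (vdenote env a) (vdenote env b)
  | VMinus a b => minus (vdenote env a) (vdenote env b)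
  | VOpp a => opp (vdenote env a)
  | VScal k a => scal k (vdenote env a)
  end.

Fixpoint vcoef (e : vexp) (i : nat) : R :=
  match e with
  | VAtom n => if Nat.eqb n i then 1 else 0
  | VZero => 0
  | VPlus a b => vcoef a i + vcoef b i
  | VMinus a b => vcoef a i - vcoef b i
  | VOpp a => - vcoef a i
  | VScal k a => k * vcoef a i
  end.

Fixpoint vcomb (cf : nat -> R) (i : nat) (env : list X) : X :=
  match env with
  | nil => zero
  | cons x l => plus (scal (cf i) x) (vcomb cf (S i) l)
  end.

Lemma vcomb_ext cf1 cf2 env i :
  (forall j, (i <= j < i + length env)%nat -> cf1 j = cf2 j) ->
  vcomb cf1 i env = vcomb cf2 i env.
Proof.
revert i; induction env as [|x l IH]; intros i H; simpl; auto.
rewrite (H i), (IH (S i)); auto; intros; try apply H; simpl in *; lia.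
Qed.

Lemma vcomb_zero env i : vcomb (fun _ => 0) i env = zero.
Proof.
revert i; induction env as [|x l IH]; intros i; simpl; auto.
rewrite IH, plus_zero_r. apply (scal_zero_l x).
Qed.

Lemma vcomb_plus cf1 cf2 env i :
  vcomb (fun j => cf1 j + cf2 j) i env = plus (vcomb cf1 i env) (vcomb cf2 i env).
Proof.
revert i; induction env as [|x l IH]; intros i; simpl.
- now rewrite plus_zero_r.
- rewrite IH. replace (scal (cf1 i + cf2 i) x) with (plus (scal (cf1 i) x) (scal (cf2 i) x))
    by (symmetry; apply (scal_distr_r (cf1 i) (cf2 i) x)).
  rewrite <- !plus_assoc. f_equal. rewrite !plus_assoc. f_equal. apply plus_comm.
Qed.

Lemma vcomb_scal k cf env i :
  vcomb (fun j => k * cf j) i env = scal k (vcomb cf i env).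
Proof.
revert i; induction env as [|x l IH]; intros i; simpl.
- symmetry. apply (scal_zero_r (V := X) k).
- rewrite IH. rewrite (scal_distr_l (V := X) k).
  f_equal. symmetry. apply (scal_assoc k (cf i) x).
Qed.

Lemma vcomb_atom n env i :
  (i <= n)%nat ->
  vcomb (fun j => if Nat.eqb n j then 1 else 0) i env = nth (n - i) env zero.
Proof.
revert i; induction env as [|x l IH]; intros i H; simpl.
- now destruct (n - i)%nat.
- destruct (Nat.eqb_spec n i) as [->|Hn].
  + replace (vcomb _ _ _) with (vcomb (fun _ => 0) (S i) l).
    * rewrite vcomb_zero, plus_zero_r, Nat.sub_diag. apply (scal_one x).
    * apply vcomb_ext; intros j Hj.
      destruct (Nat.eqb_spec i j); auto; lia.
  + replace (scal 0 x) with (@zero X) by (symmetry; apply (scal_zero_l x)).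
    rewrite plus_zero_l, IH by lia.
    now replace (n - i)%nat with (S (n - S i)) by lia.
Qed.

Lemma vdenote_comb env e : vdenote env e = vcomb (vcoef e) 0 env.
Proof.
induction e; simpl.
- rewrite vcomb_atom by lia. now rewrite Nat.sub_0_r.
- now rewrite vcomb_zero.
- now rewrite vcomb_plus, IHe1, IHe2.
- rewrite (vcomb_ext (cf1 := fun i => vcoef e1 i - vcoef e2 i)
    (cf2 := fun i => vcoef e1 i + (-1) * vcoef e2 i)) by (intros; ring).
  rewrite vcomb_plus, vcomb_scal, IHe1, IHe2. unfold minus. f_equal.
  symmetry. apply (scal_opp_one (vcomb (vcoef e2) 0 env)).
- rewrite (vcomb_ext (cf1 := fun i => - vcoef e i)
    (cf2 := fun i => (-1) * vcoef e i)) by (intros; ring).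
  rewrite vcomb_scal, IHe.
  symmetry. apply (scal_opp_one (vcomb (vcoef e) 0 env)).
- now rewrite vcomb_scal, IHe.
Qed.

(** A nested conjunction, so that for a concrete environment it computes to one scalar equation per
    atom. *)
Fixpoint vagree (e1 e2 : vexp) (n : nat) : Prop :=
  match n with
  | O => True
  | S n => vcoef e1 n = vcoef e2 n /\ vagree e1 e2 n
  end.

Lemma vdenote_eq env e1 e2 :
  vagree e1 e2 (length env) -> vdenote env e1 = vdenote env e2.
Proof.
intros H. rewrite !vdenote_comb. apply vcomb_ext.
intros j [_ Hj]. simpl in Hj. revert Hj H. generalize (length env) as n.
induction n; simpl; [lia|]. intros Hj [H1 H2].
destruct (Nat.eq_dec j n) as [->|]; auto. apply IHn; auto; lia.
Qed.

End VectorExpressions.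

Ltac v_index x env :=
  lazymatch env with
  | cons x _ => constr:(O)
  | cons _ ?l => let n := v_index x l in constr:(S n)
  end.

Ltac v_atoms X e env :=
  lazymatch e with
  | zero => env
  | plus ?a ?b => let env := v_atoms X a env in v_atoms X b env
  | minus ?a ?b => let env := v_atoms X a env in v_atoms X b env
  | opp ?a => v_atoms X a env
  | scal _ ?a => v_atoms X a env
  | _ => lazymatch env with
         | context [cons e _] => env
         | _ => constr:(@cons X e env)
         end
  end.

Ltac v_reify e env :=
  lazymatch e with
  | zero => constr:(VZero)
  | plus ?a ?b =>
      let a := v_reify a env in let b := v_reify b env in constr:(VPlus a b)
  | minus ?a ?b =>
      let a := v_reify a env in let b := v_reify b env in constr:(VMinus a b)
  | opp ?a => let a := v_reify a env in constr:(VOpp a)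
  | scal ?k ?a => let a := v_reify a env in constr:(VScal k a)
  | _ => let n := v_index e env in constr:(VAtom n)
  end.

Ltac vcoefs X :=
  lazymatch goal with
  | |- ?a = ?b =>
      let env := v_atoms X a (@nil X) in
      let env := v_atoms X b env in
      let ea := v_reify a env in
      let eb := v_reify b env in
      change (vdenote (X := X) env ea = vdenote (X := X) env eb);
      apply vdenote_eq; simpl;
      repeat match goal with
             | |- _ /\ _ => split
             | |- True => exact I
             end
  end.

Ltac vring X := vcoefs X; ring.
Ltac vfield X := vcoefs X; field.

(** * Calculus of vector valued functions *)

Section NormedCalculus.

Variable X : CompleteNormedModule R_AbsRing.
Implicit Types x y z : X.

Lemma norm_ge0 x : 0 <= norm x.
Proof. exact (norm_ge_0 (V := X) x). Qed.

Lemma norm0 : norm (@zero X) = 0.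
Proof. exact (norm_zero (V := X)). Qed.

Lemma norm_eq0 x : norm x = 0 -> x = zero.
Proof. exact (norm_eq_zero (V := X) x). Qed.

Lemma norm_oppE x : norm (opp x) = norm x.
Proof. exact (norm_opp (V := X) x). Qed.

Lemma norm_plus_le x y : norm (plus x y) <= norm x + norm y.
Proof. exact (norm_triangle (V := X) x y). Qed.

Lemma norm_minus_le x y : norm (minus x y) <= norm x + norm y.
Proof.
rewrite <- (norm_oppE y). exact (norm_triangle (V := X) x (opp y)).
Qed.

Lemma norm_minus_sym x y : norm (minus x y) = norm (minus y x).
Proof. rewrite <- norm_oppE. f_equal. vring X. Qed.

Lemma norm_le_minus x y : norm x <= norm y + norm (minus x y).
Proof.
replace x with (plus y (minus x y)) at 1 by vring X. apply norm_plus_le.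
Qed.

Lemma norm_minus_tri x y z : norm (minus x z) <= norm (minus x y) + norm (minus y z).
Proof.
replace (minus x z) with (plus (minus x y) (minus y z)) by vring X.
apply norm_plus_le.
Qed.

(** The norm axiom is only an inequality; applied to [/ k] and [scal k x] it gives the reverse
    one. *)
Lemma norm_scalR (k : R) x : norm (scal k x) = Rabs k * norm x.
Proof.
apply Rle_antisym; [exact (norm_scal (V := X) k x)|].
destruct (Req_dec k 0) as [->|Hk].
- rewrite Rabs_R0, Rmult_0_l. exact (norm_ge0 _).
- replace x with (scal (/ k) (scal k x)) at 1 by (vfield X; auto).
  apply Rle_trans with (Rabs k * (Rabs (/ k) * norm (scal k x))).
  + apply Rmult_le_compat_l; [apply Rabs_pos|].
    exact (norm_scal (V := X) (/ k) (scal k x)).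
  + rewrite <- Rmult_assoc, <- Rabs_mult, Rinv_r, Rabs_R1 by auto. lra.
Qed.

Lemma minus_zero_eq x y : minus x y = zero -> x = y.
Proof.
intros H. replace x with (plus (minus x y) y) by vring X. rewrite H. vring X.
Qed.

Lemma norm_small_eq x y :
  (forall e, 0 < e -> norm (minus x y) <= e) -> x = y.
Proof.
intros H. apply minus_zero_eq, norm_eq0.
destruct (Req_dec (norm (minus x y)) 0) as [|Hn]; auto.
pose proof (norm_ge0 (minus x y)).
specialize (H (norm (minus x y) / 2) ltac:(lra)). lra.
Qed.

Lemma norm_lt_ball x y (e : R) : norm (minus y x) < e -> @ball X x e y.
Proof. exact (norm_compat1 (V := X) x y e). Qed.

Lemma ball_norm_lt x y (e : posreal) :
  @ball X x e y -> norm (minus y x) < norm_factor (V := X) * e.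
Proof. exact (norm_compat2 (V := X) x y e). Qed.

(** Balls of the uniform structure and norm balls agree only up to [norm_factor], hence the rescaled
    radius in one direction. *)
Lemma continuous_eps (f : R -> X) (t : R) :
  continuous f t <->
  forall e, 0 < e -> exists d, 0 < d /\
    forall r, Rabs (r - t) < d -> norm (minus (f r) (f t)) < e.
Proof.
split.
- intros H e He.
  assert (Hf := @norm_factor_gt_0 R_AbsRing X).
  assert (He' : 0 < e / norm_factor (V := X)) by (apply Rdiv_lt_0_compat; auto).
  destruct (proj1 (filterlim_locally f (f t)) H (mkposreal _ He')) as [d Hd].
  exists d; split; [apply cond_pos|]. intros r Hr.
  specialize (Hd r Hr). apply ball_norm_lt in Hd. simpl in Hd.
  replace e with (norm_factor (V := X) * (e / norm_factor (V := X))) by (field; lra).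
  exact Hd.
- intros H. apply filterlim_locally. intros e.
  destruct (H e (cond_pos e)) as [d [Hd0 Hd]].
  exists (mkposreal d Hd0). intros r Hr. apply norm_lt_ball. now apply Hd.
Qed.

Lemma filterlim_eps (T : Type) (F : (T -> Prop) -> Prop) {FF : Filter F}
    (f : T -> X) (l : X) :
  filterlim f F (locally l) <->
  forall e, 0 < e -> F (fun a => norm (minus (f a) l) < e).
Proof.
rewrite (filterlim_locally f l). split.
- intros H e He.
  assert (Hf := @norm_factor_gt_0 R_AbsRing X).
  assert (He' : 0 < e / norm_factor (V := X)) by (apply Rdiv_lt_0_compat; auto).
  generalize (H (mkposreal _ He')). apply filter_imp. intros a Ha.
  apply ball_norm_lt in Ha. simpl in Ha.
  replace e with (norm_factor (V := X) * (e / norm_factor (V := X))) by (field; lra).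
  exact Ha.
- intros H e. generalize (H e (cond_pos e)). apply filter_imp. intros a Ha.
  now apply norm_lt_ball.
Qed.

Lemma is_derive_eps (f : R -> X) t l :
  (forall e, 0 < e -> exists d, 0 < d /\ forall r, Rabs (r - t) < d ->
     norm (minus (minus (f r) (f t)) (scal (r - t) l)) <= e * Rabs (r - t)) ->
  is_derive f t l.
Proof.
intros H. split; [apply (is_linear_scal_l (V := X))|].
intros t' Ht'. replace t' with t by
  exact (is_filter_lim_locally_unique (V := R_NormedModule) t t' Ht').
intros e. destruct (H e (cond_pos e)) as [d [Hd Hd']].
exists (mkposreal d Hd). intros r Hr. exact (Hd' r Hr).
Qed.

Lemma filter_cauchy_lim (T : Type) (F : (T -> Prop) -> Prop) {FF : ProperFilter F}
    (f : T -> X) :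
  (forall e, 0 < e -> exists P, F P /\
     forall a b, P a -> P b -> norm (minus (f a) (f b)) < e) ->
  exists l, forall e, 0 < e -> F (fun a => norm (minus (f a) l) < e).
Proof.
intros H.
destruct (proj1 (filterlim_locally_cauchy (F := F) f)) as [l Hl].
- intros e. destruct (H e (cond_pos e)) as [P [HP HP']].
  exists P; split; auto. intros a b Ha Hb. apply norm_lt_ball. now apply HP'.
- exists l. intros e He.
  assert (Hf := @norm_factor_gt_0 R_AbsRing X).
  assert (He' : 0 < e / norm_factor (V := X)) by (apply Rdiv_lt_0_compat; auto).
  generalize (proj1 (filterlim_locally f l) Hl (mkposreal _ He')).
  apply filter_imp. intros a Ha. apply ball_norm_lt in Ha. simpl in Ha.
  replace e with (norm_factor (V := X) * (e / norm_factor (V := X))) by (field; lra).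
  exact Ha.
Qed.

Lemma cauchy_seq_lim (v : nat -> X) :
  (forall e, 0 < e -> exists n0, forall n m, (n0 <= n)%nat -> (n0 <= m)%nat ->
     norm (minus (v n) (v m)) < e) ->
  exists l, forall e, 0 < e -> exists n0, forall n, (n0 <= n)%nat ->
     norm (minus (v n) l) < e.
Proof.
intros H. apply (filter_cauchy_lim (F := eventually)).
intros e He. destruct (H e He) as [n0 Hn].
exists (fun n => (n0 <= n)%nat); split; [now exists n0|].
intros a b; apply Hn.
Qed.

Lemma norm_lim_le (T : Type) (F : (T -> Prop) -> Prop) {FF : ProperFilter F}
    (f : T -> X) (l y : X) (b : R) :
  (forall e, 0 < e -> F (fun a => norm (minus (f a) l) < e)) ->
  F (fun a => norm (minus (f a) y) <= b) -> norm (minus l y) <= b.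
Proof.
intros H Hb. apply le_epsilon. intros e He.
destruct (filter_ex _ (filter_and _ _ (H e He) Hb)) as [a [Ha1 Ha2]].
eapply Rle_trans; [apply (norm_minus_tri _ (f a))|].
rewrite (norm_minus_sym l). lra.
Qed.

(** The explicit tail bound is needed besides the limit: the gliding hump compares it with the size
    of a single step. *)
Lemma geometric_seq_lim (v : nat -> X) (b q : R) :
  0 <= q < 1 -> (forall n, norm (minus (v (S n)) (v n)) <= b * q ^ n) ->
  exists l,
    (forall e, 0 < e -> exists n0, forall n, (n0 <= n)%nat ->
       norm (minus (v n) l) < e) /\
    (forall n, norm (minus l (v n)) <= b * q ^ n * / (1 - q)).
Proof.
intros Hq H.
assert (Hb : 0 <= b).
{ specialize (H O). pose proof (norm_ge0 (minus (v 1%nat) (v O))). simpl in H. lra. }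
assert (Hd : forall n k, norm (minus (v (n + k)%nat) (v n)) <= b * q ^ n * / (1 - q)).
{ intros n k.
  assert (norm (minus (v (n + k)%nat) (v n)) <= b * q ^ n * ((1 - q ^ k) / (1 - q))).
  { induction k.
    - rewrite Nat.add_0_r. replace (minus (v n) (v n)) with (@zero X) by vring X.
      rewrite norm0. simpl. right; field; lra.
    - rewrite Nat.add_succ_r.
      eapply Rle_trans; [apply (norm_minus_tri _ (v (n + k)%nat))|].
      specialize (H (n + k)%nat). rewrite pow_add in H.
      apply Rle_trans with (b * (q ^ n * q ^ k) + b * q ^ n * ((1 - q ^ k) / (1 - q)));
        [lra|]. simpl. right; field; lra. }
  eapply Rle_trans; [eassumption|]. apply Rmult_le_compat_l.
  - apply Rmult_le_pos; auto. apply pow_le; lra.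
  - unfold Rdiv. rewrite <- (Rmult_1_l (/ (1 - q))) at 2.
    apply Rmult_le_compat_r; [left; apply Rinv_0_lt_compat; lra|].
    pose proof (pow_le q k ltac:(lra)); lra. }
assert (Hl : exists l, forall e, 0 < e -> exists n0, forall n, (n0 <= n)%nat ->
  norm (minus (v n) l) < e).
2:{ destruct Hl as [l Hl]. exists l; split; auto. intros n.
  apply (norm_lim_le (F := eventually) (f := v)).
  - exact Hl.
  - exists n. intros k Hk. replace k with (n + (k - n))%nat by lia. apply Hd. }
apply cauchy_seq_lim. intros e He.
assert (He' : 0 < e * (1 - q) / (2 * (b + 1))).
{ apply Rdiv_lt_0_compat; nra. }
destruct (pow_lt_1_zero q ltac:(rewrite Rabs_pos_eq; lra) _ He') as [n0 Hn0].
exists n0. intros n m Hn Hm.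
assert (G : forall k, norm (minus (v (n0 + k)%nat) (v n0)) < e / 2).
{ intros k. eapply Rle_lt_trans; [apply Hd|].
  specialize (Hn0 n0 (le_n _)). rewrite Rabs_pos_eq in Hn0 by (apply pow_le; lra).
  apply (Rmult_lt_reg_r (1 - q)); [lra|].
  replace (b * q ^ n0 * / (1 - q) * (1 - q)) with (b * q ^ n0) by (field; lra).
  apply Rle_lt_trans with ((b + 1) * q ^ n0).
  { pose proof (pow_le q n0 ltac:(lra)). nra. }
  apply Rlt_le_trans with ((b + 1) * (e * (1 - q) / (2 * (b + 1)))).
  { apply Rmult_lt_compat_l; lra. }
  right; field; lra. }
replace n with (n0 + (n - n0))%nat by lia. replace m with (n0 + (m - n0))%nat by lia.
eapply Rle_lt_trans; [apply (norm_minus_tri _ (v n0))|].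
rewrite (norm_minus_sym (v n0)).
pose proof (G (n - n0)%nat). pose proof (G (m - n0)%nat). lra.
Qed.

(** Increments are controlled to the right only, because an orbit is at first differentiable only
    from the right. With slope [K + e], the supremum of the points where the bound holds is itself
    such a point by continuity from the left, and the estimate to the right would carry it further
    if it were below [b]. *)
Lemma mean_value_right (f : R -> X) (a b K : R) :
  a <= b ->
  (forall t, a < t <= b -> forall e, 0 < e -> exists d, 0 < d /\
     forall r, a <= r <= t -> t - r < d -> norm (minus (f t) (f r)) < e) ->
  (forall t, a <= t < b -> forall e, 0 < e -> exists d, 0 < d /\
     forall r, t < r <= b -> r - t < d ->
       norm (minus (f r) (f t)) <= (K + e) * (r - t)) ->
  norm (minus (f b) (f a)) <= K * (b - a).
Proof.
intros Hab Hc Hd.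
assert (G : forall e, 0 < e -> norm (minus (f b) (f a)) <= (K + e) * (b - a)).
{ intros e He.
  set (P := fun t => a <= t <= b /\ norm (minus (f t) (f a)) <= (K + e) * (t - a)).
  assert (Pa : P a).
  { split; [lra|]. replace (minus (f a) (f a)) with (@zero X) by vring X.
    rewrite norm0. lra. }
  destruct (completeness P) as [c [Hub Hlub]].
  { exists b. intros t [Ht _]. lra. }
  { now exists a. }
  assert (Hac : a <= c) by now apply Hub.
  assert (Hcb : c <= b) by (apply Hlub; intros t [Ht _]; lra).
  assert (Pc : P c).
  { split; [lra|]. destruct (Req_dec a c) as [Hac'|Hac'].
    { rewrite <- Hac'. apply Pa. }
    apply le_epsilon. intros e' He'.
    destruct (Hc c ltac:(lra) (e' / 2) ltac:(lra)) as [d [Hd0 Hd1]].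
    (* The second entry keeps the change of (K + e) t between [t] and [c] below e' / 2; the added 1
       avoids a division by zero. *)
    set (d' := Rmin d (e' / (2 * (Rabs (K + e) + 1)))).
    assert (Hd' : 0 < d').
    { apply Rmin_pos; auto. apply Rdiv_lt_0_compat; [lra|].
      pose proof (Rabs_pos (K + e)); lra. }
    destruct (classic (exists t, P t /\ c - d' < t)) as [[t [Pt Ht]]|Hn].
    - assert (t <= c) by now apply Hub.
      destruct Pt as [Ht1 Ht2].
      assert (d' <= d) by apply Rmin_l.
      specialize (Hd1 t ltac:(lra) ltac:(lra)).
      eapply Rle_trans; [apply (norm_minus_tri _ (f t))|].
      assert ((K + e) * (t - c) <= e' / 2).
      { apply Rle_trans with (Rabs (K + e) * (c - t)).
        - pose proof (Rle_abs (-(K + e))). rewrite Rabs_Ropp in *. nra.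
        - assert (c - t <= e' / (2 * (Rabs (K + e) + 1))).
          { apply Rle_trans with d'; [lra|apply Rmin_r]. }
          pose proof (Rabs_pos (K + e)).
          apply Rle_trans with ((Rabs (K + e) + 1) * (e' / (2 * (Rabs (K + e) + 1)))).
          + nra.
          + right; field; lra. }
      lra.
    - exfalso. assert (c <= c - d'); [|lra].
      apply Hlub. intros t Pt. destruct (Rle_or_lt t (c - d')); auto.
      exfalso; apply Hn; eauto. }
  destruct (Req_dec c b) as [->|Hcb']; [apply Pc|].
  exfalso. destruct (Hd c ltac:(lra) e He) as [d [Hd0 Hd1]].
  set (r := Rmin b (c + d / 2)).
  assert (c < r) by (apply Rmin_glb_lt; lra).
  assert (r <= b) by apply Rmin_l.
  assert (r <= c + d / 2) by apply Rmin_r.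
  assert (Pr : P r).
  { split; [lra|]. destruct Pc as [_ Pc].
    eapply Rle_trans; [apply (norm_minus_tri _ (f c))|].
    specialize (Hd1 r ltac:(lra) ltac:(lra)). nra. }
  specialize (Hub r Pr). lra. }
apply le_epsilon. intros e He.
specialize (G (e / (b - a + 1)) ltac:(apply Rdiv_lt_0_compat; lra)).
assert (e / (b - a + 1) * (b - a) <= e).
{ apply Rle_trans with (e / (b - a + 1) * (b - a + 1)); [|right; field; lra].
  apply Rmult_le_compat_l; [left; apply Rdiv_lt_0_compat; lra|lra]. }
lra.
Qed.

Definition bounded_linear (l : X -> X) (M : R) : Prop :=
  0 <= M /\
  (forall x y, l (plus x y) = plus (l x) (l y)) /\
  (forall (k : R) x, l (scal k x) = scal k (l x)) /\
  (forall x, norm (l x) <= M * norm x).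

Lemma bl_zero l M : bounded_linear l M -> l zero = zero.
Proof.
intros (_ & _ & H & _). replace (@zero X) with (scal 0 (@zero X)) at 1 by vring X.
rewrite H. vring X.
Qed.

Lemma bl_minus l M x y : bounded_linear l M -> l (minus x y) = minus (l x) (l y).
Proof.
intros (_ & H1 & H2 & _).
replace (minus x y) with (plus x (scal (-1) y)) by vring X.
rewrite H1, H2. vring X.
Qed.

Lemma bl_opp l M x : bounded_linear l M -> l (opp x) = opp (l x).
Proof.
intros (_ & H1 & H2 & _).
replace (opp x) with (scal (-1) x) by vring X. rewrite H2. vring X.
Qed.

Lemma bl_lim (T : Type) (F : (T -> Prop) -> Prop) {FF : Filter F} l M (f : T -> X) y :
  bounded_linear l M ->
  (forall e, 0 < e -> F (fun a => norm (minus (f a) y) < e)) ->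
  forall e, 0 < e -> F (fun a => norm (minus (l (f a)) (l y)) < e).
Proof.
intros Hl H e He. assert (HM := proj1 Hl).
generalize (H (e / (M + 1)) ltac:(apply Rdiv_lt_0_compat; lra)).
apply filter_imp. intros a Ha. rewrite <- (bl_minus _ _ Hl).
eapply Rle_lt_trans; [apply Hl|].
apply Rle_lt_trans with ((M + 1) * norm (minus (f a) y)).
- pose proof (norm_ge0 (minus (f a) y)). nra.
- apply Rlt_le_trans with ((M + 1) * (e / (M + 1))); [|right; field; lra].
  apply Rmult_lt_compat_l; lra.
Qed.

Lemma bl_continuous l M (f : R -> X) t :
  bounded_linear l M -> continuous f t -> continuous (fun r => l (f r)) t.
Proof.
intros Hl Hf. apply continuous_eps.
intros e He.
pose proof (proj1 (continuous_eps f t) Hf) as H.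
assert (HM := proj1 Hl).
destruct (H (e / (M + 1)) ltac:(apply Rdiv_lt_0_compat; lra)) as [d [Hd Hd']].
exists d; split; auto. intros r Hr. specialize (Hd' r Hr).
rewrite <- (bl_minus _ _ Hl).
eapply Rle_lt_trans; [apply Hl|].
apply Rle_lt_trans with ((M + 1) * norm (minus (f r) (f t))).
- pose proof (norm_ge0 (minus (f r) (f t))). nra.
- apply Rlt_le_trans with ((M + 1) * (e / (M + 1))); [|right; field; lra].
  apply Rmult_lt_compat_l; lra.
Qed.

Lemma is_linear_bl (l : X -> X) : is_linear l -> exists M, bounded_linear l M.
Proof.
intros [H1 H2 [M [HM H3]]]. exists M. repeat split; auto. lra.
Qed.

(** A linear map passes through every Riemann sum, and a bounded one through their limit. *)
Lemma bl_is_RInt l M (f : R -> X) a b v :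
  bounded_linear l M -> is_RInt f a b v -> is_RInt (fun t => l (f t)) a b (l v).
Proof.
intros Hl Hf. unfold is_RInt in *.
apply filterlim_ext with
  (fun ptd => l (scal (sign (b - a)) (Riemann_sum f ptd))).
- intros ptd. destruct Hl as (HM & H1 & H2 & H3). rewrite H2. f_equal.
  assert (Hl : bounded_linear l M) by (repeat split; auto).
  revert ptd. apply SF_cons_ind.
  + intros x. unfold Riemann_sum; simpl. apply (bl_zero Hl).
  + intros h ptd IH. rewrite !Riemann_sum_cons, H1, IH. f_equal. apply H2.
- apply filterlim_comp with (1 := Hf).
  apply filterlim_locally. intros e.
  assert (Hfac := @norm_factor_gt_0 R_AbsRing X).
  assert (HM := proj1 Hl).
  assert (He : 0 < e / (norm_factor (V := X) * (M + 1))).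
  { apply Rdiv_lt_0_compat; [apply cond_pos|]. apply Rmult_lt_0_compat; lra. }
  exists (mkposreal _ He). intros y Hy. apply norm_lt_ball.
  apply ball_norm_lt in Hy. simpl in Hy.
  rewrite <- (bl_minus _ _ Hl). eapply Rle_lt_trans; [apply Hl|].
  apply Rle_lt_trans with ((M + 1) * norm (minus y v)).
  { apply Rmult_le_compat_r; [apply norm_ge0|lra]. }
  apply Rlt_le_trans with ((M + 1) * (norm_factor (V := X) *
    (e / (norm_factor (V := X) * (M + 1))))); [apply Rmult_lt_compat_l; [lra|exact Hy]|].
  right; field; split; [lra|apply Rgt_not_eq; exact Hfac].
Qed.

Lemma is_RInt_scal_vec (g : R -> R) a b (I : R) x :
  is_RInt g a b I -> is_RInt (fun t => scal (g t) x) a b (scal I x).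
Proof.
intros Hg. unfold is_RInt in *.
apply filterlim_ext with
  (fun ptd => scal (scal (sign (b - a)) (Riemann_sum g ptd) : R) x).
- intros ptd. transitivity (scal (sign (b - a)) (scal (Riemann_sum g ptd : R) x)).
  + symmetry. apply (scal_assoc (V := X)).
  + f_equal. revert ptd. apply SF_cons_ind.
    * intros y. unfold Riemann_sum; simpl. apply (scal_zero_l (V := X)).
    * intros h ptd IH. rewrite !Riemann_sum_cons, <- IH.
      change (scal ((SF_h ptd - fst h) * g (snd h) + Riemann_sum g ptd) x =
        plus (scal (SF_h ptd - fst h) (scal (g (snd h)) x))
          (scal (Riemann_sum g ptd : R) x)).
      vring X.
- apply (filterlim_comp _ _ _ (fun ptd => scal (sign (b - a)) (Riemann_sum g ptd))
    (fun k : R => scal k x) _ _ _ Hg).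
  exact (@filterlim_scal_l R_AbsRing X I x).
Qed.

Lemma bl_RInt l M (f : R -> X) a b :
  bounded_linear l M -> ex_RInt f a b ->
  l (RInt f a b) = RInt (fun t => l (f t)) a b.
Proof.
intros Hl Hf. symmetry. apply is_RInt_unique. apply (bl_is_RInt Hl).
now apply (RInt_correct f).
Qed.

Lemma norm_RInt_const (f : R -> X) (a b M : R) :
  a <= b -> ex_RInt f a b -> (forall t, a <= t <= b -> norm (f t) <= M) ->
  norm (RInt f a b) <= (b - a) * M.
Proof.
intros Hab Hf H. apply (norm_RInt_le_const f a b _ M); auto.
now apply (RInt_correct f).
Qed.

Lemma norm_RInt_dom (f : R -> X) (g : R -> R) (a b : R) :
  a <= b -> ex_RInt f a b -> ex_RInt g a b ->
  (forall t, a <= t <= b -> norm (f t) <= g t) ->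
  norm (RInt f a b) <= RInt g a b.
Proof.
intros Hab Hf Hg H. apply (norm_RInt_le f g a b); auto;
 now apply (@RInt_correct).
Qed.

Lemma ex_RInt_cont (f : R -> X) a b : (forall t, continuous f t) -> ex_RInt f a b.
Proof. intros H. apply (@ex_RInt_continuous X). intros; apply H. Qed.

Lemma is_derive_RInt_cont (f : R -> X) a t :
  (forall s, continuous f s) -> is_derive (fun r => RInt f a r) t (f t).
Proof.
intros Hf. apply (@is_derive_RInt X f (fun r => RInt f a r) a t); auto.
apply filter_forall. intros b. apply (@RInt_correct X). now apply ex_RInt_cont.
Qed.

End NormedCalculus.

(** * Uniform boundedness *)

Section UniformBoundedness.

Variable X : CompleteNormedModule R_AbsRing.
Implicit Types x y z : X.

(** The supremum [sg] of |l x| over the unit ball exceeds [K], so some [e] beats both [K] and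
    [3 / 4 * sg]; the factor 4 / 3 leads back from [norm (l e)] to [sg]. *)
Lemma almost_norming (l : X -> X) (M K : R) :
  0 <= K -> bounded_linear l M -> (exists x, K * norm x < norm (l x)) ->
  exists e, norm e <= 1 /\ K <= norm (l e) /\
    forall x, norm (l x) <= 4 / 3 * norm (l e) * norm x.
Proof.
intros HK Hl [x0 Hx0].
assert (Hn : forall x, x <> zero -> norm (scal (/ norm x) x) = 1 /\
  norm (l (scal (/ norm x) x)) = / norm x * norm (l x)).
{ intros x Hx. assert (0 < norm x).
  { destruct (Req_dec (norm x) 0) as [H|H].
    - elim Hx. now apply norm_eq0.
    - pose proof (norm_ge0 x). lra. }
  assert (0 < / norm x) by now apply Rinv_0_lt_compat.
  rewrite (proj1 (proj2 (proj2 Hl))), !norm_scalR, Rabs_pos_eq by lra.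
  split; auto. field; lra. }
set (S := fun r => exists x, norm x <= 1 /\ r = norm (l x)).
destruct (completeness S) as [sg [Hub Hlub]].
{ exists M. intros r [x [Hx ->]]. eapply Rle_trans; [apply Hl|].
  rewrite <- (Rmult_1_r M) at 2. apply Rmult_le_compat_l; auto. apply Hl. }
{ exists (norm (l zero)). exists zero. rewrite norm0. split; auto; lra. }
assert (Hsg : forall x, norm (l x) <= sg * norm x).
{ intros x. destruct (classic (x = zero)) as [->|Hx].
  - rewrite (bl_zero Hl), norm0. lra.
  - destruct (Hn x Hx) as [H1 H2].
    assert (0 < norm x).
    { destruct (Req_dec (norm x) 0) as [H|H].
      - elim Hx. now apply norm_eq0.
      - pose proof (norm_ge0 x). lra. }
    assert (Hu : / norm x * norm (l x) <= sg).
    { apply Hub. exists (scal (/ norm x) x). rewrite H1, H2. split; auto; lra. }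
    apply (Rmult_le_reg_l (/ norm x)); [now apply Rinv_0_lt_compat|].
    replace (/ norm x * (sg * norm x)) with sg by (field; lra). auto. }
assert (HKs : K < sg).
{ assert (0 < norm x0).
  { destruct (Req_dec (norm x0) 0) as [H|H].
    - rewrite (norm_eq0 H), (bl_zero Hl), norm0 in Hx0. lra.
    - pose proof (norm_ge0 x0). lra. }
  specialize (Hsg x0). nra. }
destruct (classic (exists e, norm e <= 1 /\ Rmax K (3 / 4 * sg) < norm (l e)))
  as [[e [He1 He2]]|Hno].
- exists e. pose proof (Rmax_l K (3 / 4 * sg)). pose proof (Rmax_r K (3 / 4 * sg)).
  repeat split; auto; [lra|]. intros x. eapply Rle_trans; [apply Hsg|].
  apply Rmult_le_compat_r; [apply norm_ge0|lra].
- exfalso. assert (sg <= Rmax K (3 / 4 * sg)).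
  + apply Hlub. intros r [x [Hx ->]].
    destruct (Rle_or_lt (norm (l x)) (Rmax K (3 / 4 * sg))); auto.
    elim Hno. eauto.
  + revert H. apply Rmax_case; lra.
Qed.

(* Sokal's gliding hump: step [n] moves by [3^-n] along an almost norming vector
   of [T n], and the later steps, of total length [3^-n / 2], cannot undo it. *)
Lemma gliding_hump (T : nat -> X -> X) :
  (forall n, exists M, bounded_linear (T n) M) ->
  (forall n, exists x, 4 ^ n * norm x < norm (T n x)) ->
  exists y, forall K, exists n, K < norm (T n y).
Proof.
intros Hb Hu.
assert (H : forall n, exists e, norm e <= 1 /\ 4 ^ n <= norm (T n e) /\
  forall x, norm (T n x) <= 4 / 3 * norm (T n e) * norm x).
{ intros n. destruct (Hb n) as [M HM].
  apply (almost_norming (M := M)); auto. apply pow_le; lra. }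
pose (e := fun n => proj1_sig (constructive_indefinite_description _ (H n))).
assert (He : forall n, norm (e n) <= 1 /\ 4 ^ n <= norm (T n (e n)) /\
  forall x, norm (T n x) <= 4 / 3 * norm (T n (e n)) * norm x).
{ intros n. unfold e. now destruct (constructive_indefinite_description _ _). }
clearbody e.
pose (r := fun n => (1 / 3) ^ n).
assert (Hr : forall n, 0 < r n) by (intros; apply pow_lt; lra).
pose (v := fix v n := match n with
  | O => zero
  | S n => if Rle_dec (r n * norm (T n (e n))) (norm (T n (plus (v n) (scal (r n) (e n)))))
           then plus (v n) (scal (r n) (e n)) else minus (v n) (scal (r n) (e n))
  end).
assert (Hv1 : forall n, norm (minus (v (S n)) (v n)) <= 1 * (1 / 3) ^ n).
{ intros n. simpl. destruct (Rle_dec _ _).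
  - replace (minus _ _) with (scal (r n) (e n)) by vring X.
    rewrite norm_scalR, Rabs_pos_eq by (left; auto).
    fold (r n). pose proof (proj1 (He n)). specialize (Hr n). nra.
  - replace (minus _ _) with (opp (scal (r n) (e n))) by vring X.
    rewrite norm_oppE, norm_scalR, Rabs_pos_eq by (left; auto).
    fold (r n). pose proof (proj1 (He n)). specialize (Hr n). nra. }
assert (Hv2 : forall n, r n * norm (T n (e n)) <= norm (T n (v (S n)))).
{ intros n. destruct (Hb n) as [M HM]. simpl. destruct (Rle_dec _ _); auto.
  apply Rnot_le_lt in n0.
  (* The images of the two candidates differ by [2 * r n] times [T n (e n)], so one of them has at
     least norm [r n * norm (T n (e n))]. *)
  assert (Ha : scal (2 * r n) (T n (e n)) =
    minus (T n (plus (v n) (scal (r n) (e n)))) (T n (minus (v n) (scal (r n) (e n))))).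
  { rewrite (bl_minus _ _ HM). destruct HM as (_ & HM1 & HM2 & _).
    rewrite HM1, HM2. vring X. }
  apply (f_equal (fun z : X => norm z)) in Ha.
  rewrite norm_scalR, Rabs_pos_eq in Ha by (pose proof (Hr n); lra).
  pose proof (norm_minus_le (T n (plus (v n) (scal (r n) (e n))))
    (T n (minus (v n) (scal (r n) (e n))))). lra. }
destruct (geometric_seq_lim (v := v) (b := 1) (q := 1 / 3) ltac:(lra) Hv1)
  as [y [_ Hy]].
exists y. intros K.
destruct (Pow_x_infinity (4 / 3) ltac:(rewrite Rabs_pos_eq; lra) (3 * (Rabs K + 1)))
  as [n Hn].
specialize (Hn n (le_n _)).
rewrite (Rabs_pos_eq ((4 / 3) ^ n)) in Hn by (apply pow_le; lra).
exists n. destruct (He n) as (He1 & He2 & He3).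
destruct (Hb n) as [M HM].
specialize (Hy (S n)).
assert (Hy' : norm (minus y (v (S n))) <= r n / 2).
{ eapply Rle_trans; [apply Hy|]. unfold r. simpl. right; field. }
assert (norm (T n (v (S n))) <= norm (T n y) + norm (T n (minus y (v (S n))))).
{ replace (T n (v (S n))) with (minus (T n y) (T n (minus y (v (S n))))).
  - apply norm_minus_le.
  - rewrite (bl_minus _ _ HM). vring X. }
specialize (He3 (minus y (v (S n)))).
assert (4 / 3 * norm (T n (e n)) * norm (minus y (v (S n))) <=
  4 / 3 * norm (T n (e n)) * (r n / 2)).
{ apply Rmult_le_compat_l; auto. pose proof (norm_ge0 (T n (e n))). lra. }
specialize (Hv2 n).
(* The later steps cost at most 4/3 times 1/2, that is two thirds of the gain. The third that
   remains grows like (4/3)^n, because 4^n beats 3^n. *)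
assert (r n * norm (T n (e n)) * (1 / 3) <= norm (T n y)) by lra.
assert ((4 / 3) ^ n <= r n * norm (T n (e n))).
{ replace ((4 / 3) ^ n) with (r n * 4 ^ n).
  - apply Rmult_le_compat_l; auto. left; auto.
  - unfold r. rewrite <- Rpow_mult_distr. f_equal; field. }
pose proof (Rle_abs K). lra.
Qed.

End UniformBoundedness.

(** * Strongly continuous semigroups *)

Record c0_semigroup (X : CompleteNormedModule R_AbsRing) (E : R -> X -> X) : Prop :=
  C0Semigroup {
    csg_linear : forall t, 0 <= t -> is_linear (E t);
    csg_zero : forall x, E 0 x = x;
    csg_add : forall s t x, 0 <= s -> 0 <= t -> E (s + t) x = E s (E t x);
    csg_right : forall x, filterlim (fun t => E t x) (at_right 0) (locally x)
  }.

Definition growth (X : CompleteNormedModule R_AbsRing) (E : R -> X -> X) (w : R) : Prop :=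
  exists M, 0 <= M /\ forall t x, 0 <= t -> norm (E t x) <= M * exp (w * t) * norm x.

Section Semigroup.

Variable X : CompleteNormedModule R_AbsRing.
Implicit Types x y z : X.
Variable E : R -> X -> X.
Hypothesis HE : c0_semigroup E.

Lemma E_zero x : E 0 x = x.
Proof. apply (csg_zero HE). Qed.

Lemma E_add s t x : 0 <= s -> 0 <= t -> E (s + t) x = E s (E t x).
Proof. apply (csg_add HE). Qed.

Lemma E_bl t : 0 <= t -> exists M, bounded_linear (E t) M.
Proof. intros Ht. now apply is_linear_bl, (csg_linear HE). Qed.

Lemma E_plus t x y : 0 <= t -> E t (plus x y) = plus (E t x) (E t y).
Proof. intros Ht. now apply (linear_plus _ (csg_linear HE Ht)). Qed.

Lemma E_scal t (k : R) x : 0 <= t -> E t (scal k x) = scal k (E t x).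
Proof. intros Ht. now apply (linear_scal _ (csg_linear HE Ht)). Qed.

Lemma E_minus t x y : 0 <= t -> E t (minus x y) = minus (E t x) (E t y).
Proof. intros Ht. destruct (E_bl Ht) as [M HM]. apply (bl_minus _ _ HM). Qed.

Lemma E_right_eps x e : 0 < e ->
  exists d, 0 < d /\ forall t, 0 <= t < d -> norm (minus (E t x) x) < e.
Proof.
intros He.
assert (Hf := @norm_factor_gt_0 R_AbsRing X).
assert (He' : 0 < e / norm_factor (V := X)) by (apply Rdiv_lt_0_compat; auto).
assert (Hr := @csg_right _ _ HE x).
rewrite (filterlim_locally (fun t => E t x) x) in Hr.
destruct (Hr (mkposreal _ He')) as [d Hd].
exists d; split; [apply cond_pos|]. intros t [Ht0 Ht1].
destruct Ht0 as [Ht0|<-].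
- specialize (Hd t).
  assert (Hb : @ball X x (mkposreal _ He') (E t x)).
  { apply Hd; auto. unfold ball; simpl; unfold AbsRing_ball, abs, minus, plus, opp; simpl.
    rewrite Ropp_0, Rplus_0_r, Rabs_pos_eq; lra. }
  apply ball_norm_lt in Hb. simpl in Hb.
  replace e with (norm_factor (V := X) * (e / norm_factor (V := X))) by (field; lra).
  exact Hb.
- rewrite E_zero. replace (minus x x) with (@zero X) by vring X.
  now rewrite norm0.
Qed.

(** Otherwise operators E(t_n) with t_n <= 1 / (n + 1) exceed 4^n, and the gliding hump gives one
    vector with unbounded E(t_n) y. Right continuity at 0 bounds this sequence for large n, and the
    other terms are finite in number. *)
Lemma E_locally_bounded : exists d M, 0 < d /\ 1 <= M /\
  forall t x, 0 <= t <= d -> norm (E t x) <= M * norm x.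
Proof.
apply NNPP. intros Hno.
assert (H : forall n : nat, exists t, 0 <= t <= / (INR n + 1) /\
  exists x, 4 ^ n * norm x < norm (E t x)).
{ intros n. apply NNPP. intros Hn. apply Hno.
  assert (0 < / (INR n + 1)) by (apply Rinv_0_lt_compat; pose proof (pos_INR n); lra).
  exists (/ (INR n + 1)), (4 ^ n). repeat split; auto.
  - apply pow_R1_Rle; lra.
  - intros t x Ht. apply Rnot_lt_le. intros Hlt. apply Hn. exists t; split; eauto. }
pose (t := fun n => proj1_sig (constructive_indefinite_description _ (H n))).
assert (Ht : forall n : nat, 0 <= t n <= / (INR n + 1) /\
  exists x, 4 ^ n * norm x < norm (E (t n) x)).
{ intros n. unfold t. now destruct (constructive_indefinite_description _ _). }
clearbody t.
destruct (gliding_hump (T := fun n => E (t n))) as [y Hy].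
- intros n. apply E_bl, Ht.
- intros n. apply Ht.
- destruct (E_right_eps y (e := 1) ltac:(lra)) as [d [Hd0 Hd]].
  assert (Hs : forall n : nat, (/ (INR n + 1) < d) -> norm (E (t n) y) <= norm y + 1).
  { intros n Hn. specialize (Hd (t n)). pose proof (proj1 (Ht n)).
    specialize (Hd ltac:(lra)). pose proof (norm_le_minus (E (t n) y) y). lra. }
  assert (Hfin : forall N : nat, exists K, forall n, (n < N)%nat -> norm (E (t n) y) <= K).
  { induction N as [|N [K HK]].
    - exists 0. intros; lia.
    - exists (Rmax K (norm (E (t N) y))). intros n Hn.
      destruct (Nat.eq_dec n N) as [->|]; [apply Rmax_r|].
      eapply Rle_trans; [apply HK; lia|apply Rmax_l]. }
  destruct (archimed_cor1 d Hd0) as [N [HN HN']].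
  destruct (Hfin N) as [K HK].
  destruct (Hy (Rmax K (norm y + 1))) as [n Hn].
  pose proof (Rmax_l K (norm y + 1)). pose proof (Rmax_r K (norm y + 1)).
  destruct (Nat.lt_ge_cases n N) as [Hlt|Hge].
  + specialize (HK n Hlt). lra.
  + assert (norm (E (t n) y) <= norm y + 1); [|lra].
    apply Hs. eapply Rle_lt_trans; [|apply HN].
    apply Rinv_le_contravar; [apply lt_0_INR; lia|].
    apply le_INR in Hge. lra.
Qed.

(** Time is reduced by [t0] until it lies in [0, t0]. Only the bound at [t0] itself is iterated, so
    [M] enters once and does not affect the exponent. *)
Lemma growth_from_time t0 w M :
  0 < t0 -> 0 <= w -> 1 <= M ->
  (forall t x, 0 <= t <= t0 -> norm (E t x) <= M * norm x) ->
  (forall x, norm (E t0 x) <= exp (w * t0) * norm x) ->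
  growth E w.
Proof.
intros Ht0 Hw HM H1 H2. exists M; split; [lra|].
assert (G : forall n t x, 0 <= t <= INR (S n) * t0 ->
  norm (E t x) <= M * exp (w * t) * norm x).
{ assert (Hbase : forall t x, 0 <= t <= t0 -> norm (E t x) <= M * exp (w * t) * norm x).
  { intros t x Ht. eapply Rle_trans; [now apply H1|].
    apply Rmult_le_compat_r; [apply norm_ge0|].
    rewrite <- (Rmult_1_r M) at 1. apply Rmult_le_compat_l; [lra|].
    rewrite <- exp_0. destruct (Req_dec (w * t) 0) as [->|]; [lra|].
    left; apply exp_increasing. assert (0 <= w * t) by nra. lra. }
  induction n as [|n IH]; intros t x Ht.
  - simpl in Ht. apply Hbase; lra.
  - destruct (Rle_or_lt t t0) as [Hle|Hlt]; [apply Hbase; lra|].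
    rewrite S_INR in Ht.
    replace (E t x) with (E t0 (E (t - t0) x)).
    2:{ rewrite <- E_add by lra. f_equal. ring. }
    eapply Rle_trans; [apply H2|].
    replace (exp (w * t)) with (exp (w * t0) * exp (w * (t - t0)))
      by (rewrite <- exp_plus; f_equal; ring).
    specialize (IH (t - t0) x ltac:(lra)).
    pose proof (exp_pos (w * t0)). nra. }
intros t x Ht. destruct (INR_unbounded (t / t0)) as [n Hn].
apply (G n). split; auto. rewrite S_INR.
apply Rlt_le, Rlt_le_trans with (INR n * t0); [|nra].
apply (Rmult_lt_reg_r (/ t0)); [now apply Rinv_0_lt_compat|].
replace (INR n * t0 * / t0) with (INR n) by (field; lra). exact Hn.
Qed.

Lemma growth_exists : exists w, 0 <= w /\ growth E w.
Proof.
destruct E_locally_bounded as (d & M & Hd & HM & H).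
exists (ln M / d). assert (0 <= ln M).
{ rewrite <- ln_1. destruct HM as [HM|<-]; [left; apply ln_increasing; lra|lra]. }
split.
- apply Rmult_le_pos; auto. left; now apply Rinv_0_lt_compat.
- apply growth_from_time with d M; auto.
  + apply Rmult_le_pos; auto. left; now apply Rinv_0_lt_compat.
  + intros x. replace (ln M / d * d) with (ln M) by (field; lra).
    rewrite exp_ln by lra. apply H; lra.
Qed.

Lemma E_bounded_on S : exists M, 0 < M /\
  forall t x, 0 <= t <= S -> norm (E t x) <= M * norm x.
Proof.
destruct growth_exists as (w & Hw & M & HM & H).
exists (M * exp (w * S) + 1). split.
{ pose proof (exp_pos (w * S)). nra. }
intros t x Ht. eapply Rle_trans; [apply H; lra|].
apply Rmult_le_compat_r; [apply norm_ge0|].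
assert (exp (w * t) <= exp (w * S)).
{ destruct (Req_dec (w * t) (w * S)) as [->|]; [lra|].
  left; apply exp_increasing. nra. }
nra.
Qed.

(** Freezing the orbit at negative times makes it continuous on the whole line, so that
    integrability needs no conditions on the end points. *)
Definition Epos (t : R) (x : X) : X := E (Rmax 0 t) x.

Lemma Epos_eq t x : 0 <= t -> Epos t x = E t x.
Proof. intros Ht. unfold Epos. now rewrite Rmax_right. Qed.

(** The integrands of convolutions move both the operator and the vector; the local bound on the
    operators separates the two motions. *)
Lemma Epos_joint (D : R -> X) t :
  continuous D t -> continuous (fun r => Epos r (D r)) t.
Proof.
intros HD. apply continuous_eps. intros e He.
set (a := Rmax 0 t).
destruct (E_bounded_on (a + 1)) as (M & HM & Hb).
destruct (proj1 (continuous_eps _ _) HD (e / (2 * M))) as [d1 [Hd1 Hd1']].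
{ apply Rdiv_lt_0_compat; lra. }
destruct (E_right_eps (D t) (e := e / (2 * M))) as [d2 [Hd2 Hd2']].
{ apply Rdiv_lt_0_compat; lra. }
exists (Rmin 1 (Rmin d1 d2)). split; [repeat apply Rmin_pos; lra|].
intros r Hr.
assert (Hr1 : Rabs (r - t) < 1) by (eapply Rlt_le_trans; [exact Hr|apply Rmin_l]).
assert (Hr2 : Rabs (r - t) < d1).
{ eapply Rlt_le_trans; [exact Hr|].
  eapply Rle_trans; [apply Rmin_r|apply Rmin_l]. }
assert (Hr3 : Rabs (r - t) < d2).
{ eapply Rlt_le_trans; [exact Hr|].
  eapply Rle_trans; [apply Rmin_r|apply Rmin_r]. }
unfold Epos. fold a. set (b := Rmax 0 r).
assert (Ha0 : 0 <= a) by apply Rmax_l. assert (Hb0 : 0 <= b) by apply Rmax_l.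
assert (Hab : Rabs (b - a) <= Rabs (r - t)).
{ unfold a, b, Rmax. destruct (Rle_dec 0 r), (Rle_dec 0 t);
  split_Rabs; lra. }
assert (Hba : b <= a + 1).
{ pose proof (Rle_abs (b - a)). lra. }
eapply Rle_lt_trans; [apply (norm_minus_tri _ (E b (D t)))|].
rewrite <- E_minus by auto.
assert (H1 : norm (E b (minus (D r) (D t))) < e / 2).
{ eapply Rle_lt_trans; [apply Hb; lra|].
  replace (e / 2) with (M * (e / (2 * M))) by (field; lra).
  apply Rmult_lt_compat_l; auto. }
assert (H2 : norm (minus (E b (D t)) (E a (D t))) < e / 2).
(* Continuity is known only from the right at 0. Taking out the operator [E p] of the earlier time
   covers both sides, as its bound is locally uniform. *)
{ assert (G : forall p q, 0 <= p <= q -> q <= a + 1 -> q - p < d2 ->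
    norm (minus (E q (D t)) (E p (D t))) < e / 2).
  { intros p q Hp Hq Hpq.
    replace (E q (D t)) with (E p (E (q - p) (D t)))
      by (rewrite <- E_add by lra; f_equal; ring).
    rewrite <- E_minus by lra. eapply Rle_lt_trans; [apply Hb; lra|].
    replace (e / 2) with (M * (e / (2 * M))) by (field; lra).
    apply Rmult_lt_compat_l; auto. apply Hd2'; lra. }
  destruct (Rle_or_lt a b) as [Hle|Hlt].
  - apply G; try lra. pose proof (Rle_abs (b - a)). lra.
  - rewrite norm_minus_sym. apply G; try lra.
    pose proof (Rle_abs (-(b - a))). rewrite Rabs_Ropp in *. lra. }
lra.
Qed.

Lemma Epos_continuous x t : continuous (fun r => Epos r x) t.
Proof. apply (Epos_joint (D := fun _ => x)). apply continuous_const. Qed.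

End Semigroup.

(** * Resolvent estimates *)

(** The condition on [a] says that the argument is at least [phi]; the angle is the arc cosine of a
    / r, with the sign of [b]. This matches Cartesian points with the polar description of the
    sector. *)
Lemma polar_coordinates (phi a b : R) :
  0 < phi < PI / 2 -> 0 < sqrt (a * a + b * b) ->
  a <= sqrt (a * a + b * b) * cos phi ->
  exists theta, phi <= Rabs theta <= PI /\
    a = sqrt (a * a + b * b) * cos theta /\ b = sqrt (a * a + b * b) * sin theta.
Proof.
intros Hphi Hr Ha. set (r := sqrt (a * a + b * b)) in *.
assert (Hr2 : r * r = a * a + b * b) by (apply sqrt_sqrt; nra).
assert (Har : -1 <= a / r <= 1).
{ assert (Rabs a <= r).
  { rewrite <- (Rabs_pos_eq r) by lra. apply Rsqr_le_abs_0. unfold Rsqr; nra. }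
  split.
  - apply (Rmult_le_reg_r r); auto. replace (a / r * r) with a by (field; lra).
    pose proof (Rle_abs (- a)). rewrite Rabs_Ropp in *. lra.
  - apply (Rmult_le_reg_r r); auto. replace (a / r * r) with a by (field; lra).
    pose proof (Rle_abs a). lra. }
set (t := acos (a / r)).
assert (Ht : 0 <= t <= PI) by apply acos_bound.
assert (Hcos : cos t = a / r) by now apply cos_acos.
assert (Hphit : phi <= t).
{ apply Rnot_lt_le. intros Hlt.
  pose proof PI_RGT_0.
  assert (cos phi < cos t) by (apply cos_decreasing_1; lra).
  rewrite Hcos in H0. apply (Rmult_lt_compat_l r) in H0; auto.
  replace (r * (a / r)) with a in H0 by (field; lra). lra. }
assert (Hsin : r * sin t = Rabs b).
{ apply Rsqr_inj.
  - apply Rmult_le_pos; [lra|]. apply sin_ge_0; lra.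
  - apply Rabs_pos.
  - rewrite <- Rsqr_abs, Rsqr_mult, sin2, Hcos. unfold Rsqr.
    replace (r * r * (1 - a / r * (a / r))) with (r * r - a * a) by (field; lra).
    lra. }
destruct (Rle_or_lt 0 b) as [Hb|Hb].
- exists t. rewrite Rabs_pos_eq, Hcos, Hsin, (Rabs_pos_eq b) by lra.
  split; [lra|]. split; [field; lra|auto].
- exists (- t). rewrite Rabs_Ropp, Rabs_pos_eq, cos_neg, sin_neg, Hcos by lra.
  rewrite Rabs_left in Hsin by lra.
  split; [lra|]. split; [field; lra|lra].
Qed.

Section Generator.

Variable X : CompleteNormedModule R_AbsRing.
Implicit Types x y z : X.
Variable A : operator X.

(** The size of (A + p + iq)(x + iy), real and imaginary part added; up to sign this is lam - A
    applied to a complex vector, with lam = -p - iq. *)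
Definition shifted (p q : R) x y : R :=
  norm (plus (minus (scal p x) (scal q y)) (app A x)) +
  norm (plus (plus (scal p y) (scal q x)) (app A y)).

Lemma shifted_ge0 p q x y : 0 <= shifted p q x y.
Proof. apply Rplus_le_le_0_compat; apply norm_ge0. Qed.

(** One factor 2 bounds |x| + |y| by the product norm, the other bounds the product norm of the
    image by [shifted]. The weight [r] is 1 at an arbitrary point of the resolvent set and the
    distance to the vertex in the sector. *)
Lemma resolvent_lower_bound p q (Res : X * X -> X * X) (K r : R) x y :
  0 <= K -> 0 <= r ->
  is_resolvent A (- p, - q) Res ->
  (forall z : X * X, r * norm (Res z) <= K * norm z) ->
  dom A x -> dom A y ->
  r * (norm x + norm y) <= 4 * K * shifted p q x y.
Proof.
intros HK Hr (_ & H & _) Hb Hx Hy.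
set (z1 := plus (minus (scal p x) (scal q y)) (app A x)).
set (z2 := plus (plus (scal p y) (scal q x)) (app A y)).
assert (E1 : Res (opp z1, opp z2) = (x, y)).
{ rewrite <- (H (x, y)) by (split; auto). f_equal.
  unfold cscal, capp; simpl.
  transitivity (minus (minus (scal (- p) x) (scal (- q) y)) (app A x),
    minus (plus (scal (- p) y) (scal (- q) x)) (app A y)).
  - unfold z1, z2. f_equal; vring X.
  - reflexivity. }
specialize (Hb (opp z1, opp z2)). rewrite E1 in Hb.
assert (H1 := norm_le_prod_norm_1 (U := X) (V := X) (x, y)). simpl in H1.
assert (H2 := norm_le_prod_norm_2 (U := X) (V := X) (x, y)). simpl in H2.
assert (H3 := proj2 (norm_prod (U := X) (V := X) (opp z1) (opp z2))).
assert (Hs : norm ((opp z1, opp z2) : X * X) <= 2 * shifted p q x y).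
{ eapply Rle_trans; [exact H3|].
  assert (sqrt 2 <= 2).
  { rewrite <- (sqrt_pow2 2) at 2 by lra. apply sqrt_le_1; simpl; lra. }
  assert (Rmax (norm (opp z1)) (norm (opp z2)) <= shifted p q x y).
  { unfold shifted. fold z1 z2. rewrite !norm_oppE.
    pose proof (norm_ge0 z1). pose proof (norm_ge0 z2). apply Rmax_lub; lra. }
  apply Rmult_le_compat; auto; [apply sqrt_pos|].
  eapply Rle_trans; [|apply Rmax_l]. apply norm_ge0. }
set (n := norm ((x, y) : X * X)) in *.
apply Rle_trans with (2 * (r * n)).
- change (norm x <= n) in H1. change (norm y <= n) in H2. nra.
- assert (K * norm ((opp z1, opp z2) : X * X) <= K * (2 * shifted p q x y)).
  { now apply Rmult_le_compat_l. }
  lra.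
Qed.

Hypothesis Asect : sectorial A.
Hypothesis Aspec : forall lam : C, spectrum A lam -> 0 < Re lam.

Lemma resolvent_exists p q : 0 <= p -> exists Res, is_resolvent A (- p, - q) Res.
Proof.
intros Hp. apply NNPP. intros Hn.
specialize (Aspec (lam := (- p, - q)) Hn). simpl in Aspec. lra.
Qed.

(** The bound at (p, q) survives a perturbation of size 1 / (4 K'), because the error it causes is
    at most half of the left side. One number [d] is both radius and lower bound, and it is provided
    for every [p], since the compactness argument asks for one positive function on the plane. *)
Lemma resolvent_lower_bound_local p q : exists d : posreal, 0 <= p ->
  forall p' q', Rabs (p' - p) < d -> Rabs (q' - q) < d ->
  forall x y, dom A x -> dom A y -> 2 * d * (norm x + norm y) <= shifted p' q' x y.
Proof.
destruct (Rle_or_lt 0 p) as [Hp|Hp]; [|exists (mkposreal 1 Rlt_0_1); intros; lra].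
destruct (resolvent_exists q Hp) as [Res HR].
destruct (proj2 (proj2 HR)) as [K HK].
set (K' := 4 * (Rabs K + 1)).
assert (HK' : 0 < K') by (unfold K'; pose proof (Rabs_pos K); lra).
assert (Hd : 0 < / (4 * K')) by (apply Rinv_0_lt_compat; lra).
exists (mkposreal _ Hd). simpl. intros _ p' q' Hp' Hq' x y Hx Hy.
assert (H := @resolvent_lower_bound p q Res (Rabs K + 1) 1 x y).
assert (H' : norm x + norm y <= K' * shifted p q x y).
{ rewrite <- (Rmult_1_l (norm x + norm y)). unfold K'. apply H; auto; try lra.
  - pose proof (Rabs_pos K); lra.
  - intros z. rewrite Rmult_1_l. eapply Rle_trans; [apply HK|].
    apply Rmult_le_compat_r; [exact (norm_ge_0 (V := prod_NormedModule _ X X) z)|].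
    pose proof (Rle_abs K); lra. }
assert (Hs : shifted p q x y <= shifted p' q' x y + 2 * / (4 * K') * (norm x + norm y)).
{ unfold shifted.
  assert (G1 : norm (plus (minus (scal p x) (scal q y)) (app A x)) <=
    norm (plus (minus (scal p' x) (scal q' y)) (app A x)) +
    / (4 * K') * (norm x + norm y)).
  { eapply Rle_trans; [apply (norm_le_minus _ (plus (minus (scal p' x) (scal q' y)) (app A x)))|].
    apply Rplus_le_compat_l.
    replace (minus _ _) with (minus (scal (q' - q) y) (scal (p' - p) x)) by vring X.
    eapply Rle_trans; [apply norm_minus_le|]. rewrite !norm_scalR.
    pose proof (norm_ge0 x). pose proof (norm_ge0 y). nra. }
  assert (G2 : norm (plus (plus (scal p y) (scal q x)) (app A y)) <=
    norm (plus (plus (scal p' y) (scal q' x)) (app A y)) +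
    / (4 * K') * (norm x + norm y)).
  { eapply Rle_trans; [apply (norm_le_minus _ (plus (plus (scal p' y) (scal q' x)) (app A y)))|].
    apply Rplus_le_compat_l.
    replace (minus _ _) with (opp (plus (scal (q' - q) x) (scal (p' - p) y))) by vring X.
    rewrite norm_oppE.
    eapply Rle_trans; [apply norm_plus_le|]. rewrite !norm_scalR.
    pose proof (norm_ge0 x). pose proof (norm_ge0 y). nra. }
  lra. }
set (n := norm x + norm y) in *.
assert (G : n <= K' * shifted p' q' x y + n / 2).
{ eapply Rle_trans; [exact H'|].
  replace (n / 2) with (K' * (2 * / (4 * K') * n)) by (field; lra).
  rewrite <- Rmult_plus_distr_l. apply Rmult_le_compat_l; lra. }
apply (Rmult_le_reg_l (2 * K')); [lra|].
replace (2 * K' * (2 * / (4 * K') * n)) with n by (field; lra). lra.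
Qed.

(** On a rectangle compactness makes the local lower bounds uniform; outside it the sectorial bound
    supplies the factor [p + Rabs q]. *)
Lemma resolvent_estimate : exists K, 0 < K /\
  forall p q x y, 0 <= p -> dom A x -> dom A y ->
    (p + Rabs q) * (norm x + norm y) <= K * shifted p q x y.
Proof.
destruct Asect as (_ & _ & a & phi & M & Hphi & HM & HS).
pose (d := fun p q => proj1_sig
  (constructive_indefinite_description _ (resolvent_lower_bound_local p q))).
assert (Hd : forall p q, 0 <= p ->
  forall p' q', Rabs (p' - p) < d p q -> Rabs (q' - q) < d p q ->
  forall x y, dom A x -> dom A y ->
    2 * d p q * (norm x + norm y) <= shifted p' q' x y).
{ intros p q. unfold d. now destruct (constructive_indefinite_description _ _). }
clearbody d.
(* Outside this rectangle -p - iq has distance at least 1 from the vertex [a] and lies in the sector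
   around it. For negative [a] the left half plane meets the complement of the sector only up to the
   height |a| tan phi. *)
set (R1 := Rabs a + 1). set (R2 := Rabs a * tan phi + 1).
assert (Ha0 := Rabs_pos a).
assert (Htan : 0 < tan phi) by (apply tan_gt_0; lra).
assert (HR1 : 1 <= R1) by (unfold R1; lra).
assert (HR2 : 1 <= R2) by (unfold R2; nra).
destruct (compactness_value_2d 0 R1 (- R2) R2 d) as [e He].
assert (He0 := cond_pos e).
set (K1 := (R1 + R2) / (2 * e)). set (K2 := 4 * M * (2 + Rabs a)).
assert (HK1 : 0 < K1) by (apply Rdiv_lt_0_compat; lra).
assert (HK2 : 0 < K2) by (unfold K2; nra).
exists (K1 + K2). split; [lra|].
intros p q x y Hp Hx Hy.
assert (Hs := shifted_ge0 p q x y).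
assert (Hn : 0 <= norm x + norm y)
  by (pose proof (norm_ge0 x); pose proof (norm_ge0 y); lra).
destruct (classic (p <= R1 /\ Rabs q <= R2)) as [[Hp1 Hq1]|Hout].
- assert (Hq2 : - R2 <= q <= R2).
  { split_Rabs; lra. }
  destruct (NNPP _ (He p q ltac:(lra) Hq2)) as (u & v & Hu & Hv & Hpu & Hqv & Heu).
  specialize (Hd u v ltac:(lra) p q Hpu Hqv x y Hx Hy).
  assert (e * (norm x + norm y) <= d u v * (norm x + norm y))
    by (now apply Rmult_le_compat_r).
  apply Rle_trans with ((R1 + R2) * (norm x + norm y)).
  { apply Rmult_le_compat_r; lra. }
  apply Rle_trans with (K1 * shifted p q x y); [|nra].
  unfold K1. apply (Rmult_le_reg_r (2 * e)); [lra|].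
  replace ((R1 + R2) / (2 * e) * shifted p q x y * (2 * e)) with
    ((R1 + R2) * shifted p q x y) by (field; lra).
  rewrite Rmult_assoc. apply Rmult_le_compat_l; lra.
- set (a0 := - p - a).
  assert (Hout' : R1 < p \/ R2 < Rabs q).
  { destruct (Rle_or_lt p R1), (Rle_or_lt (Rabs q) R2); auto. elim Hout; auto. }
  set (r := sqrt (a0 * a0 + (- q) * (- q))).
  assert (Hr2 : r * r = a0 * a0 + q * q).
  { unfold r. rewrite sqrt_sqrt by nra. ring. }
  assert (Hr0 : 0 <= r) by apply sqrt_pos.
  assert (Ha1 : Rabs a0 <= r).
  { rewrite <- (Rabs_pos_eq r) by lra. apply Rsqr_le_abs_0. unfold Rsqr; nra. }
  assert (Hq1 : Rabs q <= r).
  { rewrite <- (Rabs_pos_eq r) by lra. apply Rsqr_le_abs_0. unfold Rsqr; nra. }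
  assert (Hr1 : 1 <= r).
  { destruct Hout' as [H|H]; [|lra].
    apply Rle_trans with (Rabs a0); auto. unfold a0, R1 in *. split_Rabs; lra. }
  assert (Hc0 : 0 < cos phi) by (apply cos_gt_0; lra).
  assert (Hcond : a0 <= r * cos phi).
  { destruct (Rle_or_lt a0 0) as [Hneg|Hpos]; [nra|].
    assert (Hpa : p < Rabs a /\ a0 <= Rabs a) by (unfold a0 in *; split_Rabs; lra).
    assert (Hq2 : R2 < Rabs q) by (unfold R1 in *; destruct Hout'; lra).
    assert (Hq3 : a0 * tan phi < Rabs q) by (unfold R2 in Hq2; nra).
    assert (Htc : tan phi * cos phi = sin phi) by (unfold tan; field; lra).
    apply Rsqr_incr_0; [|lra|nra].
    assert (Hq4 : (a0 * sin phi) * (a0 * sin phi) <= (q * cos phi) * (q * cos phi)).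
    { replace ((q * cos phi) * (q * cos phi)) with
        ((Rabs q * cos phi) * (Rabs q * cos phi)).
      - assert (0 <= a0 * sin phi <= Rabs q * cos phi).
        { rewrite <- Htc. split; [|nra]. apply Rmult_le_pos; nra. }
        nra.
      - pose proof (Rsqr_abs q) as Hqq. unfold Rsqr in Hqq.
        replace (Rabs q * cos phi * (Rabs q * cos phi)) with
          (Rabs q * Rabs q * (cos phi * cos phi)) by ring.
        rewrite <- Hqq. ring. }
    pose proof (sin2_cos2 phi) as Hsc. unfold Rsqr in *.
    replace (r * cos phi * (r * cos phi)) with (r * r * (cos phi * cos phi)) by ring.
    rewrite Hr2.
    replace (a0 * a0) with (a0 * a0 * (sin phi * sin phi + cos phi * cos phi))
      by (rewrite Hsc; ring).
    nra. }
  destruct (@polar_coordinates phi a0 (- q)) as (theta & Ht & Hta & Htb); auto.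
  { fold r. lra. }
  fold r in Hta, Htb.
  destruct (HS r theta ltac:(lra) Ht) as (Res & HR & HRb).
  replace (a + r * cos theta, r * sin theta) with (- p, - q) in HR.
  2:{ rewrite <- Hta, <- Htb. unfold a0. f_equal; ring. }
  assert (H := @resolvent_lower_bound p q Res M r x y ltac:(lra) ltac:(lra) HR).
  assert (H' : r * (norm x + norm y) <= 4 * M * shifted p q x y).
  { apply H; auto. intros z. specialize (HRb z).
    apply (Rmult_le_compat_l r) in HRb; auto.
    eapply Rle_trans; [exact HRb|]. right; field; lra. }
  apply Rle_trans with ((2 + Rabs a) * r * (norm x + norm y)).
  { apply Rmult_le_compat_r; auto.
    assert (p <= Rabs a0 + Rabs a) by (unfold a0; split_Rabs; lra). nra. }
  rewrite Rmult_assoc.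
  apply Rle_trans with (K2 * shifted p q x y); [|nra].
  unfold K2. nra.
Qed.

(** The spectrum has positive real part, so 0 is in the resolvent set. Linearity of the inverse is
    deduced from uniqueness, as linearity is not part of [is_resolvent]. *)
Lemma inverse_exists : exists (B : X -> X) M, bounded_linear B M /\
  (forall y, dom A (B y) /\ app A (B y) = y) /\
  (forall x, dom A x -> B (app A x) = x).
Proof.
destruct Asect as ((H0 & Hplus & Hscal) & _ & _).
assert (HA0 : app A zero = zero).
{ destruct (Hscal 0 _ H0) as [_ H].
  replace (scal 0 (@zero X)) with (@zero X) in H by vring X. rewrite H. vring X. }
destruct (@resolvent_exists 0 0 (Rle_refl 0)) as [Res (HR1 & HR2 & K & HK)].
(* The resolvent at 0 inverts -A, hence the sign; the first component is the real part. *)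
pose (B := fun y => opp (fst (Res (y, zero)))).
assert (Hopp : forall x, dom A x -> dom A (opp x) /\ app A (opp x) = opp (app A x)).
{ intros x Hx. destruct (Hscal (-1) x Hx) as [H1 H2].
  replace (scal (-1) x) with (opp x) in * by vring X. split; auto.
  rewrite H2. vring X. }
assert (HB : forall y, dom A (B y) /\ app A (B y) = y).
{ intros y. destruct (HR1 (y, zero)) as [[Hd _] He].
  destruct (Hopp _ Hd) as [Hd' Ho]. split; auto. unfold B. rewrite Ho.
  apply (f_equal fst) in He. simpl in He.
  transitivity (minus (minus (scal (- 0) (fst (Res (y, zero))))
    (scal (- 0) (snd (Res (y, zero))))) (app A (fst (Res (y, zero))))).
  - vring X.
  - exact He. }
assert (HB' : forall x, dom A x -> B (app A x) = x).
{ intros x Hx.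
  destruct (Hopp x Hx) as [Hd Ho].
  specialize (HR2 (opp x, zero) ltac:(split; auto)).
  unfold B.
  replace (app A x, @zero X) with
    (minus (cscal (- 0, - 0) (opp x, zero)) (capp A (opp x, zero))).
  - rewrite HR2. simpl. vring X.
  - unfold cscal, capp; simpl. rewrite Ho, HA0.
    transitivity (minus (minus (scal (- 0) (opp x)) (scal (- 0) (@zero X))) (opp (app A x)),
      minus (plus (scal (- 0) (@zero X)) (scal (- 0) (opp x))) (@zero X)).
    + reflexivity.
    + f_equal; vring X. }
exists B, (Rabs K). split; [|split; auto].
split; [apply Rabs_pos|]. split; [|split].
- intros x y. destruct (HB x) as [H1 H2], (HB y) as [H3 H4].
  destruct (Hplus _ _ H1 H3) as [H5 H6].
  rewrite <- (HB' _ H5). f_equal. now rewrite H6, H2, H4.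
- intros k x. destruct (HB x) as [H1 H2].
  destruct (Hscal k _ H1) as [H5 H6].
  rewrite <- (HB' _ H5). f_equal. now rewrite H6, H2.
- intros x. unfold B. rewrite norm_oppE.
  assert (H1 := norm_le_prod_norm_1 (U := X) (V := X) (Res (x, zero))).
  eapply Rle_trans; [exact H1|]. eapply Rle_trans; [apply HK|].
  assert (H3 : norm ((x, zero) : X * X) <= norm x).
  { change (sqrt (norm x ^ 2 + norm (@zero X) ^ 2) <= norm x).
    rewrite norm0. replace (norm x ^ 2 + 0 ^ 2) with (norm x ^ 2) by ring.
    rewrite sqrt_pow2; [lra|apply norm_ge0]. }
  assert (H4 : 0 <= norm ((x, zero) : X * X)) by
    exact (norm_ge_0 (V := prod_NormedModule _ X X) _).
  eapply Rle_trans; [apply Rmult_le_compat_r; [exact H4|apply Rle_abs]|].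
  apply Rmult_le_compat_l; auto. apply Rabs_pos.
Qed.

End Generator.

(** * The Fejer kernel *)

Fixpoint dirichlet (m : nat) (r : R) : R :=
  match m with
  | O => 1
  | S k => dirichlet k r + 2 * cos (INR m * r)
  end.

(* Unnormalised: [fejer n] is n times the usual Fejer kernel. *)
Fixpoint fejer (n : nat) (r : R) : R :=
  match n with
  | O => 0
  | S k => fejer k r + dirichlet k r
  end.

Lemma dirichlet_sin m r :
  dirichlet m r * sin (r / 2) = sin ((2 * INR m + 1) * (r / 2)).
Proof.
induction m as [|m IH].
- simpl. rewrite Rmult_1_l. f_equal. ring.
- change (dirichlet (S m) r) with (dirichlet m r + 2 * cos (INR (S m) * r)).
  rewrite Rmult_plus_distr_r, IH, S_INR.
  replace ((2 * INR m + 1) * (r / 2)) with ((INR m + 1) * r - r / 2) by field.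
  replace ((2 * (INR m + 1) + 1) * (r / 2)) with ((INR m + 1) * r + r / 2) by field.
  rewrite sin_minus, sin_plus. ring.
Qed.

(** With x = r / 2, the product sin((2n+1)x) sin x is sin((n+1)x)^2 - sin(nx)^2, so the sum of the
    Dirichlet kernels telescopes. *)
Lemma fejer_sin n r :
  fejer n r * (sin (r / 2) * sin (r / 2)) = sin (INR n * (r / 2)) * sin (INR n * (r / 2)).
Proof.
induction n as [|n IH].
- simpl. rewrite !Rmult_0_l, sin_0. ring.
- change (fejer (S n) r) with (fejer n r + dirichlet n r).
  rewrite Rmult_plus_distr_r, IH.
  replace (dirichlet n r * (sin (r / 2) * sin (r / 2))) with
    (dirichlet n r * sin (r / 2) * sin (r / 2)) by ring.
  rewrite dirichlet_sin, S_INR.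
  replace ((2 * INR n + 1) * (r / 2)) with (INR n * (r / 2) + (INR n + 1) * (r / 2)) by ring.
  set (a := INR n * (r / 2)).
  replace (INR n * (r / 2)) with a by reflexivity.
  replace ((INR n + 1) * (r / 2)) with (a + r / 2) by (unfold a; ring).
  assert (H : sin (r / 2) = sin (a + r / 2) * cos a - cos (a + r / 2) * sin a).
  { rewrite <- sin_minus. f_equal. ring. }
  rewrite H, (sin_plus a (a + r / 2)).
  set (b := a + r / 2).
  pose proof (sin2_cos2 a) as Ha. pose proof (sin2_cos2 b) as Hb. unfold Rsqr in *.
  replace (sin a * sin a + (sin a * cos b + cos a * sin b) *
    (sin b * cos a - cos b * sin a)) with
    (sin a * sin a + sin b * sin b * (cos a * cos a) - sin a * sin a * (cos b * cos b))
    by ring.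
  replace (cos a * cos a) with (1 - sin a * sin a) by lra.
  replace (cos b * cos b) with (1 - sin b * sin b) by lra. ring.
Qed.

Lemma fejer_0_ge0 n : 0 <= fejer n 0.
Proof.
assert (H : forall m, 0 <= dirichlet m 0).
{ induction m as [|m IH]; [simpl; lra|].
  change (dirichlet (S m) 0) with (dirichlet m 0 + 2 * cos (INR (S m) * 0)).
  rewrite Rmult_0_r, cos_0. lra. }
induction n as [|n IH]; [simpl; lra|].
change (fejer (S n) 0) with (fejer n 0 + dirichlet n 0). specialize (H n). lra.
Qed.

(** The closed form decides the sign only where the sine does not vanish. Within one period window
    the exceptional case reduces to the centre, where all cosines are 1. *)
Lemma fejer_ge0 n r : fejer n r >= 0 \/ sin (r / 2) = 0.
Proof.
destruct (Req_dec (sin (r / 2)) 0) as [H|H]; auto. left.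
assert (0 < sin (r / 2) * sin (r / 2)) by nra.
pose proof (fejer_sin n r).
destruct (Rge_or_gt (fejer n r) 0) as [|Hlt]; auto.
assert (fejer n r * (sin (r / 2) * sin (r / 2)) < 0) by nra.
assert (0 <= sin (INR n * (r / 2)) * sin (INR n * (r / 2))) by nra. lra.
Qed.

Lemma fejer_le n r m0 :
  0 < m0 -> m0 <= sin (r / 2) * sin (r / 2) -> fejer n r <= / m0.
Proof.
intros H0 H. pose proof (fejer_sin n r).
destruct (Rle_or_lt (fejer n r) 0) as [Hle|Hlt].
- pose proof (Rinv_0_lt_compat _ H0). lra.
- assert (sin (INR n * (r / 2)) * sin (INR n * (r / 2)) <= 1).
  { pose proof (sin2_cos2 (INR n * (r / 2))) as Hs. unfold Rsqr in Hs. nra. }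
  apply (Rmult_le_reg_r m0); auto. rewrite Rinv_l by lra. nra.
Qed.

Lemma continuous_R_plus (f g : R -> R) t :
  continuous f t -> continuous g t -> continuous (fun r => f r + g r) t.
Proof. intros Hf Hg. exact (continuous_plus f g t Hf Hg). Qed.

Lemma continuous_R_mult (f g : R -> R) t :
  continuous f t -> continuous g t -> continuous (fun r => f r * g r) t.
Proof. intros Hf Hg. exact (continuous_mult f g t Hf Hg). Qed.

Lemma continuous_cos_lin a b t : continuous (fun r => cos (a * (r - b))) t.
Proof. apply (@ex_derive_continuous R_AbsRing R_NormedModule). auto_derive. auto. Qed.

Lemma dirichlet_continuous m d t0 t :
  continuous (fun s => dirichlet m (d * (s - t0))) t.
Proof.
induction m as [|m IH]; [apply continuous_const|].
apply continuous_ext with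
  (fun s => dirichlet m (d * (s - t0)) + 2 * cos (INR (S m) * d * (s - t0))).
{ intros s. change (dirichlet (S m) (d * (s - t0))) with
  (dirichlet m (d * (s - t0)) + 2 * cos (INR (S m) * (d * (s - t0)))).
  now rewrite Rmult_assoc. }
apply continuous_R_plus; auto.
apply continuous_R_mult; [apply continuous_const|]. apply continuous_cos_lin.
Qed.

Lemma fejer_continuous n d t0 t : continuous (fun s => fejer n (d * (s - t0))) t.
Proof.
induction n as [|n IH]; [apply continuous_const|].
apply continuous_R_plus; auto. apply dirichlet_continuous.
Qed.

Lemma dirichlet_integral m l t0 :
  0 < l -> is_RInt (fun s => dirichlet m (2 * PI / l * (s - t0))) 0 l l.
Proof.
intros Hl. induction m as [|m IH].
- simpl. replace l with (scal (l - 0) 1) at 2.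
  + apply (@is_RInt_const R_NormedModule).
  + unfold scal; simpl; unfold mult; simpl. ring.
- enough (H : is_RInt (fun s => plus (dirichlet m (2 * PI / l * (s - t0)))
       (2 * cos (INR (S m) * (2 * PI / l * (s - t0))))) 0 l (l + 0))
    by (rewrite Rplus_0_r in H; exact H).
  apply (@is_RInt_plus R_NormedModule); auto.
  assert (Hm : 0 < INR (S m)) by (apply lt_0_INR; lia).
  pose proof PI_RGT_0.
  remember (INR (S m)) as k eqn:Hk.
  set (F := fun s => l / (k * PI) * sin (k * (2 * PI / l * (s - t0)))).
  assert (HF : minus (F l) (F 0) = 0).
  2:{ enough (G : is_RInt (fun s => 2 * cos (k * (2 * PI / l * (s - t0)))) 0 l
      (minus (F l) (F 0))) by (rewrite HF in G; exact G).
    apply (@is_RInt_derive R_CompleteNormedModule).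
    * intros x _. unfold F. auto_derive; auto. change (x + - t0) with (x - t0). field. split; lra.
    * intros x _. apply (@ex_derive_continuous R_AbsRing R_NormedModule).
      auto_derive. auto. }
  { unfold F, minus, plus, opp; simpl.
    replace (k * (2 * PI / l * (l - t0))) with
      (k * (2 * PI / l * (0 - t0)) + 2 * k * PI) by (field; lra).
    rewrite Hk, sin_period. simpl. ring. }
Qed.

Lemma fejer_integral n l t0 :
  0 < l -> is_RInt (fun s => fejer n (2 * PI / l * (s - t0))) 0 l (INR n * l).
Proof.
intros Hl. induction n as [|n IH].
- simpl. replace (0 * l) with (scal (l - 0) 0).
  + apply (@is_RInt_const R_NormedModule).
  + unfold scal; simpl; unfold mult; simpl. ring.
- rewrite S_INR. replace ((INR n + 1) * l) with (plus (INR n * l) l)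
    by (unfold plus; simpl; ring).
  apply (@is_RInt_plus R_NormedModule); auto. now apply dirichlet_integral.
Qed.

Lemma sin_lower_bound a b : 0 < a -> b < PI ->
  exists m, 0 < m /\ forall x, a <= x <= b -> m <= sin x.
Proof.
intros Ha Hb. destruct (Rlt_or_le b a) as [Hlt|Hle].
{ exists 1. split; [lra|]. intros; lra. }
pose proof PI_RGT_0.
exists (Rmin (sin a) (sin b)). split.
- apply Rmin_pos; apply sin_gt_0; lra.
- intros x Hx. destruct (Rle_or_lt x (PI / 2)).
  + eapply Rle_trans; [apply Rmin_l|]. apply sin_incr_1; lra.
  + eapply Rle_trans; [apply Rmin_r|]. apply sin_decr_1; lra.
Qed.

Section FejerEvaluation.

Variable X : CompleteNormedModule R_AbsRing.
Implicit Types x y z : X.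

Lemma continuous_scalX (g : R -> R) (f : R -> X) t :
  continuous g t -> continuous f t -> continuous (fun r => scal (g r) (f r)) t.
Proof. intros Hg Hf. exact (continuous_scal (K := R_AbsRing) (V := X) g f t Hg Hf). Qed.

Lemma continuous_plusX (g f : R -> X) t :
  continuous g t -> continuous f t -> continuous (fun r => plus (g r) (f r)) t.
Proof. intros Hg Hf. exact (continuous_plus (V := X) g f t Hg Hf). Qed.

Lemma continuous_minusX (g f : R -> X) t :
  continuous g t -> continuous f t -> continuous (fun r => minus (g r) (f r)) t.
Proof. intros Hg Hf. exact (continuous_minus (V := X) g f t Hg Hf). Qed.

(** The multiple [INR n * l] of F(t) is the integral of F against the kernel plus that of F(t) - F.
    The first is at most n times the assumed bound. The second is at most e / 2 per unit of mass
    near [t], and bounded independently of n elsewhere, so division by n gives the claim. As [t] is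
    interior, the kernel is harmless at both ends of the window, where F may take different
    values. *)
Lemma fejer_evaluation (F : R -> X) l t b :
  0 < t < l -> (forall s, continuous F s) ->
  (forall m, norm (RInt (fun s => scal (dirichlet m (2 * PI / l * (s - t))) (F s)) 0 l)
     <= l * b) ->
  norm (F t) <= b.
Proof.
intros Ht HF Hb.
set (d := 2 * PI / l). pose proof PI_RGT_0 as HPI.
assert (Hex : forall (g : R -> R), (forall s, continuous g s) ->
  ex_RInt (fun s => scal (g s) (F s)) 0 l).
{ intros g Hg. apply ex_RInt_cont. intros s. now apply continuous_scalX. }
assert (HS : forall n, norm (RInt (fun s => scal (fejer n (d * (s - t))) (F s)) 0 l)
  <= INR n * (l * b)).
{ induction n as [|n IH].
  - rewrite (RInt_ext _ (fun _ => @zero X)).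
    + rewrite RInt_const. replace (scal (l - 0) (@zero X)) with (@zero X) by vring X.
      rewrite norm0. simpl; lra.
    + intros s _. simpl. vring X.
  - rewrite (RInt_ext _ (fun s => plus (scal (fejer n (d * (s - t))) (F s))
      (scal (dirichlet n (d * (s - t))) (F s)))).
    + rewrite (RInt_plus (V := X)).
      * eapply Rle_trans; [apply norm_plus_le|]. rewrite S_INR.
        specialize (Hb n). fold d in Hb. lra.
      * apply Hex. intros; apply fejer_continuous.
      * apply Hex. intros; apply dirichlet_continuous.
    + intros s _. simpl. vring X. }
destruct (bounded_continuity (V := X) F 0 l) as [Fm HFm].
{ intros s _. apply HF. }
assert (HFm0 : 0 < Fm).
{ specialize (HFm 0 ltac:(lra)). eapply Rle_lt_trans; [|exact HFm]. apply norm_ge0. }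
apply le_epsilon. intros e He.
destruct (proj1 (continuous_eps F t) (HF t) (e / 2) ltac:(lra)) as [r [Hr Hr']].
(* For s in the window at distance at least r from [t], the angle pi |s - t| / l stays away from 0
   and, as [t] is interior, also from pi. *)
destruct (@sin_lower_bound (PI * r / l) (PI * Rmax t (l - t) / l)) as [m0 [Hm0 Hm0']].
{ apply Rdiv_lt_0_compat; nra. }
{ apply (Rmult_lt_reg_r l); [lra|].
  replace (PI * Rmax t (l - t) / l * l) with (PI * Rmax t (l - t)) by (field; lra).
  apply Rmult_lt_compat_l; auto. apply Rmax_lub_lt; lra. }
set (C := / (m0 * m0) * (2 * Fm)).
assert (HC : 0 < C).
{ apply Rmult_lt_0_compat; [apply Rinv_0_lt_compat; nra|lra]. }
assert (Hpt : forall n s, 0 <= s <= l ->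
  norm (scal (fejer n (d * (s - t))) (minus (F t) (F s))) <=
  e / 2 * fejer n (d * (s - t)) + C).
{ intros n s Hs. rewrite norm_scalR.
  assert (Hhalf : d * (s - t) / 2 = PI * (s - t) / l) by (unfold d; field; lra).
  destruct (Rlt_or_le (Rabs (s - t)) r) as [Hlt|Hle].
  - assert (Hpos : 0 <= fejer n (d * (s - t))).
    { destruct (fejer_ge0 n (d * (s - t))) as [|Hsin]; [lra|].
      rewrite Hhalf in Hsin.
      destruct (Req_dec s t) as [->|Hst].
      - replace (d * (t - t)) with 0 by ring. apply fejer_0_ge0.
      - exfalso. destruct (Rlt_or_le t s).
        + assert (0 < sin (PI * (s - t) / l)); [|lra].
          apply sin_gt_0.
          * apply Rdiv_lt_0_compat; nra.
          * apply (Rmult_lt_reg_r l); [lra|].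
            replace (PI * (s - t) / l * l) with (PI * (s - t)) by (field; lra). nra.
        + assert (0 < sin (PI * (t - s) / l)).
          { apply sin_gt_0.
            - apply Rdiv_lt_0_compat; nra.
            - apply (Rmult_lt_reg_r l); [lra|].
              replace (PI * (t - s) / l * l) with (PI * (t - s)) by (field; lra). nra. }
          replace (PI * (s - t) / l) with (- (PI * (t - s) / l)) in Hsin by (field; lra).
          rewrite sin_neg in Hsin. lra. }
    rewrite (Rabs_pos_eq (fejer _ _)) by auto.
    specialize (Hr' s Hlt). rewrite norm_minus_sym in Hr'. nra.
  - assert (Hsin : m0 * m0 <= sin (d * (s - t) / 2) * sin (d * (s - t) / 2)).
    { rewrite Hhalf.
      assert (G : m0 <= sin (PI * Rabs (s - t) / l)).
      { apply Hm0'. split.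
        - apply (Rmult_le_reg_r l); [lra|].
          replace (PI * r / l * l) with (PI * r) by (field; lra).
          replace (PI * Rabs (s - t) / l * l) with (PI * Rabs (s - t)) by (field; lra). nra.
        - apply (Rmult_le_reg_r l); [lra|].
          replace (PI * Rmax t (l - t) / l * l) with (PI * Rmax t (l - t)) by (field; lra).
          replace (PI * Rabs (s - t) / l * l) with (PI * Rabs (s - t)) by (field; lra).
          apply Rmult_le_compat_l; [lra|].
          pose proof (Rmax_l t (l - t)). pose proof (Rmax_r t (l - t)).
          split_Rabs; lra. }
      destruct (Rle_or_lt 0 (s - t)).
      - rewrite Rabs_pos_eq in G by lra. nra.
      - rewrite Rabs_left in G by lra.
        replace (PI * - (s - t) / l) with (- (PI * (s - t) / l)) in G by (field; lra).
        rewrite sin_neg in G. nra. }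
    pose proof (@fejer_le n (d * (s - t)) (m0 * m0) ltac:(nra) Hsin) as Hf.
    assert (Hpos : 0 <= fejer n (d * (s - t))).
    { destruct (fejer_ge0 n (d * (s - t))) as [|H0]; [lra|].
      rewrite H0 in Hsin. nra. }
    rewrite Rabs_pos_eq by auto.
    assert (Hd : norm (minus (F t) (F s)) <= 2 * Fm).
    { eapply Rle_trans; [apply norm_minus_le|].
      pose proof (HFm t ltac:(lra)) as H1. pose proof (HFm s ltac:(lra)) as H2.
      change (norm (F t) < Fm) in H1. change (norm (F s) < Fm) in H2. lra. }
    assert (fejer n (d * (s - t)) * norm (minus (F t) (F s)) <= C).
    { unfold C. apply Rmult_le_compat; auto. apply norm_ge0. }
    nra. }
assert (Hn : forall n, INR n * l * norm (F t) <=
  INR n * (l * b) + (e / 2 * (INR n * l) + C * l)).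
{ intros n.
  set (I1 := RInt (fun s => scal (fejer n (d * (s - t))) (minus (F t) (F s))) 0 l).
  assert (Hfi := @fejer_integral n l t ltac:(lra)). fold d in Hfi.
  assert (E1 : scal (INR n * l) (F t) =
    plus (RInt (fun s => scal (fejer n (d * (s - t))) (F s)) 0 l) I1).
  { symmetry. unfold I1. rewrite <- (RInt_plus (V := X)).
    - apply is_RInt_unique.
      apply (is_RInt_ext (fun s => scal (fejer n (d * (s - t))) (F t))).
      + intros s _. vring X.
      + now apply is_RInt_scal_vec.
    - apply Hex. intros; apply fejer_continuous.
    - apply ex_RInt_cont. intros s. apply continuous_scalX; [apply fejer_continuous|].
      apply continuous_minusX; auto. apply continuous_const. }
  assert (E2 : norm I1 <= e / 2 * (INR n * l) + C * l).
  { unfold I1.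
    apply Rle_trans with (RInt (fun s => e / 2 * fejer n (d * (s - t)) + C) 0 l).
    - apply norm_RInt_dom.
      + lra.
      + apply ex_RInt_cont. intros s. apply continuous_scalX; [apply fejer_continuous|].
        apply continuous_minusX; auto. apply continuous_const.
      + apply (@ex_RInt_continuous R_CompleteNormedModule). intros s _.
        apply continuous_R_plus; [|apply continuous_const].
        apply continuous_R_mult; [apply continuous_const|apply fejer_continuous].
      + intros s Hs. now apply Hpt.
    - right. apply is_RInt_unique.
      replace (C * l) with (scal (l - 0) C) by (unfold scal; simpl; unfold mult; simpl; ring).
      apply (@is_RInt_plus R_NormedModule).
      + apply (@is_RInt_scal R_NormedModule _ _ _ (e / 2)). exact Hfi.
      + apply (@is_RInt_const R_NormedModule). }
  assert (E3 : INR n * l * norm (F t) = norm (scal (INR n * l) (F t))).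
  { rewrite norm_scalR, Rabs_pos_eq; auto. pose proof (pos_INR n). nra. }
  rewrite E3, E1. eapply Rle_trans; [apply norm_plus_le|].
  specialize (HS n). lra. }
destruct (INR_unbounded (2 * C / e)) as [n Hn'].
specialize (Hn n).
assert (HC2 : 2 * C < INR n * e).
{ apply (Rmult_lt_compat_r e) in Hn'; auto.
  replace (2 * C / e * e) with (2 * C) in Hn' by (field; lra). exact Hn'. }
assert (Hn0 : 0 < INR n) by nra.
apply (Rmult_le_reg_l (INR n * l)); [nra|]. nra.
Qed.

End FejerEvaluation.

(** * Windowed Laplace transforms of orbits *)

(* B stands for the inverse of A: it commutes with the semigroup, and the last
   clause says that the right derivative of E(t) B y at 0 is - y. *)
Record generator_inverse (X : CompleteNormedModule R_AbsRing) (E : R -> X -> X)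
    (B : X -> X) : Prop := GeneratorInverse {
  gi_commute : forall t y, 0 <= t -> E t (B y) = B (E t y);
  gi_derive : forall y e, 0 < e -> exists d, 0 < d /\
    forall h, 0 < h < d ->
      norm (plus (minus (E h (B y)) (B y)) (scal h y)) <= e * h
}.

Section InverseOfGenerator.

Variable X : CompleteNormedModule R_AbsRing.
Implicit Types x y z : X.
Variables (E : R -> X -> X) (B : X -> X) (MB : R).
Hypothesis HE : c0_semigroup E.
Hypothesis HB : bounded_linear B MB.
Hypothesis HI : generator_inverse E B.

Lemma ex_RInt_orbit (G : R -> R) y a b :
  (forall s, continuous G s) -> ex_RInt (fun s => scal (G s) (Epos E s y)) a b.
Proof.
intros HG. apply ex_RInt_cont. intros s. apply continuous_scalX; auto.
now apply Epos_continuous.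
Qed.

(** The orbit of [B y] plus the integral of the orbit of [y] has right derivative zero at every
    time, hence is constant. *)
Lemma E_B_increment t r y : 0 <= t -> t <= r ->
  minus (E r (B y)) (E t (B y)) = opp (RInt (fun s => Epos E s y) t r).
Proof.
intros Ht Htr.
assert (Hcont : forall s, continuous (fun s => Epos E s y) s)
  by (intros; now apply Epos_continuous).
assert (Hex : forall a b, ex_RInt (fun s => Epos E s y) a b)
  by (intros; apply ex_RInt_cont; auto).
set (v := fun s => plus (Epos E s (B y)) (RInt (fun s => Epos E s y) t s)).
destruct (E_bounded_on HE r) as (M & HM & HMb).
assert (Hv : norm (minus (v r) (v t)) <= 0 * (r - t)).
{ apply mean_value_right; auto.
  - intros s Hs.
    assert (Hc : continuous v s).
    { apply continuous_plusX; [now apply Epos_continuous|].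
      apply (@ex_derive_continuous R_AbsRing X). exists (Epos E s y).
      now apply (@is_derive_RInt_cont X (fun s => Epos E s y)). }
    intros e He. destruct (proj1 (continuous_eps v s) Hc e He) as [d [Hd Hd']].
    exists d; split; auto. intros q Hq Hq'. rewrite norm_minus_sym. apply Hd'.
    rewrite Rabs_left1; lra.
  - intros s Hs e He.
    destruct (gi_derive HI y (e := e / (2 * M))) as [d1 [Hd1 Hd1']].
    { apply Rdiv_lt_0_compat; lra. }
    destruct (proj1 (continuous_eps _ s) (Hcont s) (e / 2) ltac:(lra))
      as [d2 [Hd2 Hd2']].
    exists (Rmin d1 d2). split; [now apply Rmin_pos|]. intros q Hq Hqd.
    assert (q - s < d1) by (eapply Rlt_le_trans; [exact Hqd|apply Rmin_l]).
    assert (q - s < d2) by (eapply Rlt_le_trans; [exact Hqd|apply Rmin_r]).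
    set (h := q - s) in *.
    assert (E1 : minus (v q) (v s) =
      plus (E s (plus (minus (E h (B y)) (B y)) (scal h y)))
        (RInt (fun r => minus (Epos E r y) (Epos E s y)) s q)).
    { rewrite (RInt_minus (V := X)); auto; [|apply ex_RInt_const].
      rewrite RInt_const.
      unfold v. rewrite <- (RInt_Chasles (V := X) _ t s q) by auto.
      rewrite !(@Epos_eq X) by lra.
      rewrite (E_plus HE), (E_minus HE), (E_scal HE) by lra.
      rewrite <- (E_add HE) by (unfold h; lra).
      replace (s + h) with q by (unfold h; ring). unfold h. vring X. }
    rewrite E1. eapply Rle_trans; [apply norm_plus_le|].
    assert (G1 : norm (E s (plus (minus (E h (B y)) (B y)) (scal h y))) <= e / 2 * h).
    { eapply Rle_trans; [apply HMb; lra|].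
      replace (e / 2 * h) with (M * (e / (2 * M) * h)) by (field; lra).
      apply Rmult_le_compat_l; [lra|]. apply Hd1'. unfold h in *; lra. }
    assert (G2 : norm (RInt (fun r => minus (Epos E r y) (Epos E s y)) s q) <=
      (q - s) * (e / 2)).
    { apply norm_RInt_const; [lra| |].
      - apply ex_RInt_cont. intros z. apply continuous_minusX; auto.
        apply continuous_const.
      - intros z Hz. left. apply Hd2'. rewrite Rabs_pos_eq; unfold h in *; lra. }
    fold h in G2 |- *. lra. }
rewrite Rmult_0_l in Hv.
assert (Hv0 : minus (v r) (v t) = zero).
{ apply norm_eq0. pose proof (norm_ge0 (minus (v r) (v t))). lra. }
unfold v in Hv0. rewrite (RInt_point (V := X)) in Hv0.
rewrite !(@Epos_eq X) in Hv0 by lra.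
apply minus_zero_eq.
rewrite <- Hv0. vring X.
Qed.

Lemma orbit_by_parts (G G' : R -> R) l y :
  0 <= l -> (forall s, is_derive G s (G' s)) -> (forall s, continuous G' s) ->
  RInt (fun s => scal (G s) (Epos E s y)) 0 l =
  plus (minus (scal (G 0) (B y)) (scal (G l) (E l (B y))))
    (RInt (fun s => scal (G' s) (Epos E s (B y))) 0 l).
Proof.
intros Hl HG HG'.
assert (Hcont : forall s, continuous (fun s => Epos E s y) s)
  by (intros; now apply Epos_continuous).
set (J := fun t => minus (B y) (RInt (fun s => Epos E s y) 0 t)).
assert (HJ : forall t, 0 <= t -> J t = E t (B y)).
{ intros t Ht. pose proof (@E_B_increment 0 t y ltac:(lra) Ht) as H.
  rewrite (E_zero HE) in H. unfold J.
  replace (E t (B y)) with (plus (minus (E t (B y)) (B y)) (B y)) by vring X.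
  rewrite H. vring X. }
assert (HJd : forall t, is_derive J t (opp (Epos E t y))).
{ intros t. unfold J.
  replace (opp (Epos E t y)) with (minus zero (Epos E t y)) by vring X.
  apply (@is_derive_minus R_AbsRing X).
  - apply (@is_derive_const R_AbsRing X).
  - now apply (@is_derive_RInt_cont X (fun s => Epos E s y)). }
set (I := RInt (fun s => scal (G' s) (Epos E s (B y))) 0 l).
assert (HIJ : is_RInt (fun s => scal (G' s) (J s)) 0 l I).
{ apply (is_RInt_ext (fun s => scal (G' s) (Epos E s (B y)))).
  - rewrite Rmin_left, Rmax_right by auto. intros s Hs.
    rewrite HJ, (@Epos_eq X) by lra. auto.
  - apply (RInt_correct (V := X)). now apply ex_RInt_orbit. }
assert (H := @is_RInt_scal_derive_r X G J G' (fun t => opp (Epos E t y)) 0 l I).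
assert (HG0 : forall s, continuous G s).
{ intros s. apply (@ex_derive_continuous R_AbsRing R_NormedModule). now exists (G' s). }
specialize (H ltac:(auto) ltac:(auto) ltac:(auto)).
assert (Hc : forall t, continuous (fun t => opp (Epos E t y)) t).
{ intros t. apply (continuous_opp (V := X)). auto. }
specialize (H ltac:(auto) HIJ).
apply (is_RInt_unique (V := X)) in H.
rewrite (RInt_ext (V := X) (fun s => scal (G s) (opp (Epos E s y)))
  (fun s => opp (scal (G s) (Epos E s y)))) in H by (intros; vring X).
rewrite (RInt_opp (V := X)) in H by now apply ex_RInt_orbit.
rewrite !HJ in H by lra. rewrite (E_zero HE) in H.
replace (RInt (fun s => scal (G s) (Epos E s y)) 0 l) with
  (opp (opp (RInt (fun s => scal (G s) (Epos E s y)) 0 l))) by vring X.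
rewrite H. vring X.
Qed.

Lemma B_orbit_integral (G : R -> R) l y :
  0 <= l -> (forall s, continuous G s) ->
  B (RInt (fun s => scal (G s) (Epos E s y)) 0 l) =
  RInt (fun s => scal (G s) (Epos E s (B y))) 0 l.
Proof.
intros Hl HG. rewrite (bl_RInt HB) by now apply ex_RInt_orbit.
apply (RInt_ext (V := X)). rewrite Rmin_left by auto. intros s Hs.
rewrite !(@Epos_eq X) by lra. rewrite (gi_commute HI) by lra. apply HB.
Qed.

Variable K : R.
Hypothesis K_pos : 0 < K.
(** The resolvent estimate at the points [B x] and [B y], so that A itself no longer appears. *)
Hypothesis resolvent : forall p q x y, 0 <= p ->
  (p + Rabs q) * (norm (B x) + norm (B y)) <=
  K * (norm (plus (minus (scal p (B x)) (scal q (B y))) x) +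
       norm (plus (plus (scal p (B y)) (scal q (B x))) y)).

Section Window.

Variables (l w eta : R).
Hypothesis Hl : 0 < l.
Hypothesis Hw : 0 < w.

Definition cosine_part (q : R -> R) (s : R) : R := q s * exp (- w * s) * cos (eta * s).
Definition sine_part (q : R -> R) (s : R) : R := q s * exp (- w * s) * sin (eta * s).

(* The complex vector int_0^l q(s) e^{-(w + i eta) s} E(s) y ds, split into real
   and imaginary part. *)
Definition cosine_integral (q : R -> R) y : X :=
  RInt (fun s => scal (cosine_part q s) (Epos E s y)) 0 l.
Definition sine_integral (q : R -> R) y : X :=
  RInt (fun s => scal (sine_part q s) (Epos E s y)) 0 l.
Definition window_norm (q : R -> R) y : R :=
  norm (cosine_integral q y) + norm (sine_integral q y).

Lemma cosine_part_continuous q : (forall s, continuous q s) ->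
  forall s, continuous (cosine_part q) s.
Proof.
intros Hq s. apply continuous_R_mult; [apply continuous_R_mult; auto|];
apply (@ex_derive_continuous R_AbsRing R_NormedModule); auto_derive; auto.
Qed.

Lemma sine_part_continuous q : (forall s, continuous q s) ->
  forall s, continuous (sine_part q) s.
Proof.
intros Hq s. apply continuous_R_mult; [apply continuous_R_mult; auto|];
apply (@ex_derive_continuous R_AbsRing R_NormedModule); auto_derive; auto.
Qed.

(** For z = c - i s, with c and s the cosine and the sine integral, differentiating the exponential
    gives (w + i eta) z(B y) + z(y) = boundary terms + z'(B y), where z' is formed with q'. The two
    equations are the real part and the negative imaginary part. *)
Lemma window_by_parts (q q' : R -> R) y :
  (forall s, is_derive q s (q' s)) -> (forall s, continuous q' s) ->
  let bl := plus (minus (scal (q 0) (B y))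
    (scal (q l * exp (- w * l) * cos (eta * l)) (E l (B y))))
    (cosine_integral q' (B y)) in
  let bs := minus (sine_integral q' (B y))
    (scal (q l * exp (- w * l) * sin (eta * l)) (E l (B y))) in
  plus (plus (scal w (cosine_integral q (B y))) (scal eta (sine_integral q (B y))))
    (cosine_integral q y) = bl /\
  plus (minus (scal w (sine_integral q (B y))) (scal eta (cosine_integral q (B y))))
    (sine_integral q y) = bs.
Proof.
intros Hq Hq' bl bs.
assert (Hq0 : forall s, continuous q s).
{ intros s. apply (@ex_derive_continuous R_AbsRing R_NormedModule). now exists (q' s). }
assert (Hcq := cosine_part_continuous Hq0).
assert (Hsq := sine_part_continuous Hq0).
assert (Hcq' := cosine_part_continuous Hq').
assert (Hsq' := sine_part_continuous Hq').
assert (Hlin : forall a b c : R, forall f1 f2 f3 : R -> R,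
  (forall s, continuous f1 s) -> (forall s, continuous f2 s) ->
  (forall s, continuous f3 s) ->
  RInt (fun s => scal (a * f1 s + b * f2 s + c * f3 s) (Epos E s (B y))) 0 l =
  plus (plus (scal a (RInt (fun s => scal (f1 s) (Epos E s (B y))) 0 l))
    (scal b (RInt (fun s => scal (f2 s) (Epos E s (B y))) 0 l)))
    (scal c (RInt (fun s => scal (f3 s) (Epos E s (B y))) 0 l))).
{ intros a b c f1 f2 f3 H1 H2 H3. apply (is_RInt_unique (V := X)).
  apply (is_RInt_ext (fun s => plus (plus (scal a (scal (f1 s) (Epos E s (B y))))
    (scal b (scal (f2 s) (Epos E s (B y))))) (scal c (scal (f3 s) (Epos E s (B y)))))).
  { intros s _. vring X. }
  apply (is_RInt_plus (V := X)); [apply (is_RInt_plus (V := X))|];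
  apply (is_RInt_scal (V := X)); apply (RInt_correct (V := X)); now apply ex_RInt_orbit. }
split.
- unfold cosine_integral at 2.
  rewrite (@orbit_by_parts (cosine_part q)
    (fun s => 1 * cosine_part q' s + (- w) * cosine_part q s + (- eta) * sine_part q s)).
  + rewrite Hlin by auto. unfold bl, cosine_integral, sine_integral.
    unfold cosine_part at 2 3. rewrite !Rmult_0_r, exp_0, cos_0. vring X.
  + lra.
  + intros s. unfold cosine_part, sine_part.
    assert (H1 : is_derive (fun s => exp (- w * s) * cos (eta * s)) s
      (- w * (exp (- w * s) * cos (eta * s)) - eta * (exp (- w * s) * sin (eta * s)))).
    { auto_derive; auto. ring. }
    assert (H2 := @is_derive_mult R_AbsRing q _ s _ _ (Hq s) H1 Rmult_comm).
    apply (is_derive_ext (fun s => q s * (exp (- w * s) * cos (eta * s)))).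
    { intros r. now rewrite Rmult_assoc. }
    evar_last; [exact H2|]. unfold plus, mult; simpl. ring.
  + intros s. apply continuous_R_plus; [apply continuous_R_plus|];
    (apply continuous_R_mult; [apply continuous_const|auto]).
- unfold sine_integral at 2.
  rewrite (@orbit_by_parts (sine_part q)
    (fun s => 1 * sine_part q' s + (- w) * sine_part q s + eta * cosine_part q s)).
  + rewrite Hlin by auto. unfold bs, cosine_integral, sine_integral.
    unfold sine_part at 2 3. rewrite !Rmult_0_r, exp_0, sin_0. vring X.
  + lra.
  + intros s. unfold cosine_part, sine_part.
    assert (H1 : is_derive (fun s => exp (- w * s) * sin (eta * s)) s
      (- w * (exp (- w * s) * sin (eta * s)) + eta * (exp (- w * s) * cos (eta * s)))).
    { auto_derive; auto. ring. }
    assert (H2 := @is_derive_mult R_AbsRing q _ s _ _ (Hq s) H1 Rmult_comm).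
    apply (is_derive_ext (fun s => q s * (exp (- w * s) * sin (eta * s)))).
    { intros r. now rewrite Rmult_assoc. }
    evar_last; [exact H2|]. unfold plus, mult; simpl. ring.
  + intros s. apply continuous_R_plus; [apply continuous_R_plus|];
    (apply continuous_R_mult; [apply continuous_const|auto]).
Qed.

(** The left side of the complex identity is (w + i eta) B + 1 applied to z(y), so the resolvent
    estimate gains one power of w + |eta| at the price of one derivative of q. The end [l] counts
    for the cosine and for the sine, the end 0 only for the cosine. *)
Lemma window_gain (q q' : R -> R) y :
  (forall s, is_derive q s (q' s)) -> (forall s, continuous q' s) ->
  (w + Rabs eta) * window_norm q (B y) <=
  K * (window_norm q' (B y) + Rabs (q 0) * norm (B y) +
       2 * (Rabs (q l) * exp (- w * l) * norm (E l (B y)))).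
Proof.
intros Hq Hq'.
destruct (window_by_parts y Hq Hq') as [H1 H2].
assert (Hq0 : forall s, continuous q s).
{ intros s. apply (@ex_derive_continuous R_AbsRing R_NormedModule). now exists (q' s). }
assert (Hr := @resolvent w eta (cosine_integral q y) (opp (sine_integral q y))
  ltac:(lra)).
rewrite (bl_opp _ HB) in Hr.
assert (EC : B (cosine_integral q y) = cosine_integral q (B y)).
{ apply B_orbit_integral; [lra|]. now apply cosine_part_continuous. }
assert (ES : B (sine_integral q y) = sine_integral q (B y)).
{ apply B_orbit_integral; [lra|]. now apply sine_part_continuous. }
rewrite EC, ES, norm_oppE in Hr.
eapply Rle_trans; [exact Hr|]. apply Rmult_le_compat_l; [lra|].
set (b := Rabs (q l) * exp (- w * l) * norm (E l (B y))).
assert (Hb : forall v, Rabs v <= 1 ->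
  norm (scal (q l * exp (- w * l) * v) (E l (B y))) <= b).
{ intros v Hv. rewrite norm_scalR. unfold b. rewrite !Rabs_mult.
  rewrite (Rabs_pos_eq (exp _)) by (left; apply exp_pos).
  apply Rmult_le_compat_r; [apply norm_ge0|].
  rewrite <- (Rmult_1_r (Rabs (q l) * exp (- w * l))) at 2.
  apply Rmult_le_compat_l; auto.
  apply Rmult_le_pos; [apply Rabs_pos|left; apply exp_pos]. }
assert (G1 : norm (plus (minus (scal w (cosine_integral q (B y)))
  (scal eta (opp (sine_integral q (B y))))) (cosine_integral q y)) <=
  norm (cosine_integral q' (B y)) + Rabs (q 0) * norm (B y) + b).
{ replace (plus _ _) with (plus (plus (scal w (cosine_integral q (B y)))
    (scal eta (sine_integral q (B y)))) (cosine_integral q y)) by vring X.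
  rewrite H1. eapply Rle_trans; [apply norm_plus_le|].
  assert (norm (minus (scal (q 0) (B y))
    (scal (q l * exp (- w * l) * cos (eta * l)) (E l (B y)))) <=
    Rabs (q 0) * norm (B y) + b); [|lra].
  eapply Rle_trans; [apply norm_minus_le|]. rewrite norm_scalR.
  apply Rplus_le_compat_l, Hb. pose proof (COS_bound (eta * l)). split_Rabs; lra. }
assert (G2 : norm (plus (plus (scal w (opp (sine_integral q (B y))))
  (scal eta (cosine_integral q (B y)))) (opp (sine_integral q y))) <=
  norm (sine_integral q' (B y)) + b).
{ replace (plus _ _) with (opp (plus (minus (scal w (sine_integral q (B y)))
    (scal eta (cosine_integral q (B y)))) (sine_integral q y))) by vring X.
  rewrite H2, norm_oppE. eapply Rle_trans; [apply norm_minus_le|].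
  apply Rplus_le_compat_l, Hb. pose proof (SIN_bound (eta * l)). split_Rabs; lra. }
unfold window_norm. lra.
Qed.

(** Here the identity is solved for z(y) itself: no power of w + |eta| is gained, but [y] is traded
    for [B y], on which the gains can then operate. *)
Lemma window_generator (q q' : R -> R) y :
  (forall s, is_derive q s (q' s)) -> (forall s, continuous q' s) ->
  q 0 = 0 -> q l = 0 ->
  window_norm q y <= (1 + K) * window_norm q' (B y).
Proof.
intros Hq Hq' Hq0 Hql.
destruct (window_by_parts y Hq Hq') as [H1 H2].
assert (H3 := window_gain y Hq Hq').
rewrite Hq0, Hql in *. rewrite !Rabs_R0 in H3.
replace (K * (window_norm q' (B y) + 0 * norm (B y) +
  2 * (0 * exp (- w * l) * norm (E l (B y))))) with (K * window_norm q' (B y)) in H3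
  by ring.
assert (G1 : norm (cosine_integral q y) <= norm (cosine_integral q' (B y)) +
  (w * norm (cosine_integral q (B y)) + Rabs eta * norm (sine_integral q (B y)))).
{ replace (cosine_integral q y) with (minus (cosine_integral q' (B y))
    (plus (scal w (cosine_integral q (B y))) (scal eta (sine_integral q (B y))))).
  - eapply Rle_trans; [apply norm_minus_le|]. apply Rplus_le_compat_l.
    eapply Rle_trans; [apply norm_plus_le|]. rewrite !norm_scalR.
    rewrite (Rabs_pos_eq w) by lra. lra.
  - replace (cosine_integral q' (B y)) with (plus (plus (scal w (cosine_integral q (B y)))
      (scal eta (sine_integral q (B y)))) (cosine_integral q y)); [vring X|].
    rewrite H1. vring X. }
assert (G2 : norm (sine_integral q y) <= norm (sine_integral q' (B y)) +
  (w * norm (sine_integral q (B y)) + Rabs eta * norm (cosine_integral q (B y)))).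
{ replace (sine_integral q y) with (minus (sine_integral q' (B y))
    (minus (scal w (sine_integral q (B y))) (scal eta (cosine_integral q (B y))))).
  - eapply Rle_trans; [apply norm_minus_le|]. apply Rplus_le_compat_l.
    eapply Rle_trans; [apply norm_minus_le|]. rewrite !norm_scalR.
    rewrite (Rabs_pos_eq w) by lra. lra.
  - replace (sine_integral q' (B y)) with (plus (minus (scal w (sine_integral q (B y)))
      (scal eta (cosine_integral q (B y)))) (sine_integral q y)); [vring X|].
    rewrite H2. vring X. }
assert (Hsum : window_norm q y <= window_norm q' (B y) +
  (w + Rabs eta) * window_norm q (B y)).
{ unfold window_norm. lra. }
lra.
Qed.

End Window.

End InverseOfGenerator.

(** * Boundedness and smoothing *)

Lemma exp_neg_le z : 0 < z -> exp (- z) <= / z.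
Proof.
intros Hz. rewrite exp_Ropp. apply Rinv_le_contravar; auto.
left. apply Rlt_trans with (1 + z); [lra|]. apply exp_ineq1. lra.
Qed.

Lemma exp_le_mono a b : a <= b -> exp a <= exp b.
Proof.
intros [H| ->]; [left; now apply exp_increasing|lra].
Qed.

Section Decay.

Variable X : CompleteNormedModule R_AbsRing.
Implicit Types x y z : X.
Variables (E : R -> X -> X) (B : X -> X) (MB : R).
Hypothesis HE : c0_semigroup E.
Hypothesis HB : bounded_linear B MB.
Hypothesis HI : generator_inverse E B.
Variable K : R.
Hypothesis K_pos : 0 < K.
Hypothesis resolvent : forall p q x y, 0 <= p ->
  (p + Rabs q) * (norm (B x) + norm (B y)) <=
  K * (norm (plus (minus (scal p (B x)) (scal q (B y))) x) +
       norm (plus (plus (scal p (B y)) (scal q (B x))) y)).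

Section Growth.

Variables (w0 M w : R).
Hypothesis Hw0 : 0 <= w0 < w.
Hypothesis HM : 0 <= M.
Hypothesis Hgrowth : forall t x, 0 <= t -> norm (E t x) <= M * exp (w0 * t) * norm x.

Lemma exp_integral_le l : 0 < l -> RInt (fun s => exp ((w0 - w) * s)) 0 l <= / (w - w0).
Proof.
intros Hl.
set (F := fun s => - / (w - w0) * exp ((w0 - w) * s)).
assert (H : is_RInt (fun s => exp ((w0 - w) * s)) 0 l (minus (F l) (F 0))).
{ apply (@is_RInt_derive R_CompleteNormedModule).
  - intros s _. unfold F. auto_derive; auto. field. lra.
  - intros s _. apply (@ex_derive_continuous R_AbsRing R_NormedModule).
    auto_derive. auto. }
apply (is_RInt_unique (V := R_CompleteNormedModule)) in H. rewrite H. unfold F, minus, plus, opp; simpl.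
rewrite Rmult_0_r, exp_0. pose proof (exp_pos ((w0 - w) * l)).
assert (0 < / (w - w0)) by (apply Rinv_0_lt_compat; lra). nra.
Qed.

Lemma window_norm_le l eta q c y :
  0 < l -> 0 <= c -> (forall s, continuous q s) ->
  (forall s, 0 <= s <= l -> Rabs (q s) <= c) ->
  window_norm E l w eta q y <= 2 * (c * M / (w - w0)) * norm y.
Proof.
intros Hl Hc Hq Hqc.
assert (Hn := norm_ge0 y).
assert (G : forall p : R -> R, (forall s, continuous p s) ->
  (forall s, 0 <= s <= l -> Rabs (p s) <= c * exp (- w * s)) ->
  norm (RInt (fun s => scal (p s) (Epos E s y)) 0 l) <= c * M / (w - w0) * norm y).
{ intros p Hp Hpc.
  apply Rle_trans with (RInt (fun s => c * M * norm y * exp ((w0 - w) * s)) 0 l).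
  - apply norm_RInt_dom; [lra| | |].
    + now apply ex_RInt_orbit.
    + apply (@ex_RInt_continuous R_CompleteNormedModule). intros s _.
      apply (@ex_derive_continuous R_AbsRing R_NormedModule). auto_derive. auto.
    + intros s Hs. rewrite norm_scalR, (@Epos_eq X) by lra.
      specialize (Hpc s Hs). pose proof (@Hgrowth s y ltac:(lra)) as Hg.
      replace ((w0 - w) * s) with (- w * s + w0 * s) by ring. rewrite exp_plus.
      replace (c * M * norm y * (exp (- w * s) * exp (w0 * s))) with
        ((c * exp (- w * s)) * (M * exp (w0 * s) * norm y)) by ring.
      apply Rmult_le_compat; auto; [apply Rabs_pos|apply norm_ge0].
  - rewrite (RInt_scal (V := R_CompleteNormedModule)).
    + unfold scal; simpl; unfold mult; simpl.
      pose proof (@exp_integral_le l Hl).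
      assert (0 <= c * M * norm y) by (apply Rmult_le_pos; auto; nra).
      replace (c * M / (w - w0) * norm y) with (c * M * norm y * / (w - w0)) by (field; lra).
      now apply Rmult_le_compat_l.
    + apply (@ex_RInt_continuous R_CompleteNormedModule). intros s _.
      apply (@ex_derive_continuous R_AbsRing R_NormedModule). auto_derive. auto. }
assert (Hb : forall s v, 0 <= s <= l -> Rabs v <= 1 ->
  Rabs (q s * exp (- w * s) * v) <= c * exp (- w * s)).
{ intros s v Hs Hv. rewrite !Rabs_mult.
  pose proof (exp_pos (- w * s)). rewrite (Rabs_pos_eq (exp _)) by lra.
  specialize (Hqc s Hs). pose proof (Rabs_pos (q s)). pose proof (Rabs_pos v).
  apply Rle_trans with (Rabs (q s) * exp (- w * s) * 1).
  - apply Rmult_le_compat_l; auto. apply Rmult_le_pos; lra.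
  - nra. }
assert (G1 := G (cosine_part w eta q) (@cosine_part_continuous w eta q Hq)).
assert (G2 := G (sine_part w eta q) (@sine_part_continuous w eta q Hq)).
unfold window_norm, cosine_integral, sine_integral.
specialize (G1 ltac:(intros s Hs; apply Hb; auto;
  pose proof (COS_bound (eta * s)); split_Rabs; lra)).
specialize (G2 ltac:(intros s Hs; apply Hb; auto;
  pose proof (SIN_bound (eta * s)); split_Rabs; lra)).
lra.
Qed.

(** The function and its derivative vanish at both ends, so the first two integrations by parts
    leave no boundary terms. The normalisation makes the second derivative 2 at both ends whatever
    [l] is, and the value at s <= l / 2 at least s^2 / 4. *)
Definition bump (l s : R) : R := s ^ 2 * (1 - s / l) ^ 2.

(** The chain descends to the third derivative of the bump. The end 0 contributes 2. The third
    derivative contributes 24 and the far end 4 multiples of M / ((w - w0) l); as 24 + 4 = 28, the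
    lower bound on [l] makes these at most 1. The sum is 3, and [M] has disappeared. *)
Lemma bump_window l eta y :
  0 < l -> 28 * M / (w - w0) <= l ->
  (w + Rabs eta) ^ 2 * window_norm E l w eta (bump l) y <=
  3 * (1 + K) * K ^ 2 * norm (B y).
Proof.
intros Hl HlM.
set (q1 := fun s => 2 * s - 6 * s ^ 2 / l + 4 * s ^ 3 / l ^ 2).
set (q2 := fun s => 2 - 12 * s / l + 12 * s ^ 2 / l ^ 2).
set (q3 := fun s => - 12 / l + 24 * s / l ^ 2).
assert (Hd0 : forall s, is_derive (bump l) s (q1 s)).
{ intros s. unfold bump, q1. auto_derive; auto. field. lra. }
assert (Hd1 : forall s, is_derive q1 s (q2 s)).
{ intros s. unfold q1, q2. auto_derive; auto. field. lra. }
assert (Hd2 : forall s, is_derive q2 s (q3 s)).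
{ intros s. unfold q2, q3. auto_derive; auto. field. lra. }
assert (Hc1 : forall s, continuous q1 s).
{ intros s. apply (@ex_derive_continuous R_AbsRing R_NormedModule). now exists (q2 s). }
assert (Hc2 : forall s, continuous q2 s).
{ intros s. apply (@ex_derive_continuous R_AbsRing R_NormedModule). now exists (q3 s). }
assert (Hc3 : forall s, continuous q3 s).
{ intros s. apply (@ex_derive_continuous R_AbsRing R_NormedModule).
  unfold q3. auto_derive. auto. }
assert (Hw : 0 < w) by lra.
assert (H1 := window_generator HE HB HI K_pos resolvent eta Hl Hw y Hd0 Hc1).
specialize (H1 ltac:(unfold bump; ring) ltac:(unfold bump; field; lra)).
assert (H2 := window_gain HE HB HI K_pos resolvent eta Hl Hw y Hd1 Hc2).
replace (q1 0) with 0 in H2 by (unfold q1; field; lra).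
replace (q1 l) with 0 in H2 by (unfold q1; field; lra).
rewrite Rabs_R0 in H2.
assert (H3 := window_gain HE HB HI K_pos resolvent eta Hl Hw y Hd2 Hc3).
replace (q2 0) with 2 in H3 by (unfold q2; field; lra).
replace (q2 l) with 2 in H3 by (unfold q2; field; lra).
rewrite (Rabs_pos_eq 2) in H3 by lra.
assert (H4 : window_norm E l w eta q3 (B y) <= 2 * (12 / l * M / (w - w0)) * norm (B y)).
{ apply window_norm_le; auto.
  - left; apply Rdiv_lt_0_compat; lra.
  - intros s Hs. unfold q3.
    replace (- 12 / l + 24 * s / l ^ 2) with (12 / l * (2 * (s / l) - 1)) by (field; lra).
    assert (0 <= s / l <= 1).
    { split; [apply Rdiv_le_0_compat; lra|].
      apply (Rmult_le_reg_r l); auto. replace (s / l * l) with s by (field; lra). lra. }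
    assert (0 < 12 / l) by (apply Rdiv_lt_0_compat; lra).
    rewrite Rabs_mult, Rabs_pos_eq by lra.
    rewrite <- (Rmult_1_r (12 / l)) at 2. apply Rmult_le_compat_l; [lra|].
    split_Rabs; lra. }
assert (H5 : exp (- w * l) * norm (E l (B y)) <= M / ((w - w0) * l) * norm (B y)).
{ pose proof (@Hgrowth l (B y) ltac:(lra)) as Hg.
  apply Rle_trans with (exp (- w * l) * (M * exp (w0 * l) * norm (B y))).
  - apply Rmult_le_compat_l; auto. left; apply exp_pos.
  - replace (exp (- w * l) * (M * exp (w0 * l) * norm (B y))) with
      (exp (- w * l) * exp (w0 * l) * M * norm (B y)) by ring.
    rewrite <- exp_plus. apply Rmult_le_compat_r; [apply norm_ge0|].
    replace (- w * l + w0 * l) with (- ((w - w0) * l)) by ring.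
    assert (0 < (w - w0) * l) by nra.
    pose proof (exp_neg_le H). unfold Rdiv. rewrite Rmult_comm.
    now apply Rmult_le_compat_l. }
assert (H6 : 28 * (M / ((w - w0) * l)) <= 1).
{ assert (0 < (w - w0) * l) by nra.
  apply (Rmult_le_reg_r ((w - w0) * l)); auto.
  replace (28 * (M / ((w - w0) * l)) * ((w - w0) * l)) with (28 * M) by (field; lra).
  apply (Rmult_le_compat_r (w - w0)) in HlM; [|lra].
  replace (28 * M / (w - w0) * (w - w0)) with (28 * M) in HlM by (field; lra). lra. }
replace (2 * (12 / l * M / (w - w0)) * norm (B y)) with
  (24 * (M / ((w - w0) * l)) * norm (B y)) in H4 by (field; lra).
set (b := M / ((w - w0) * l)) in *.
assert (Hn := norm_ge0 (B y)).
assert (Hbn : 28 * b * norm (B y) <= 1 * norm (B y)) by (apply Rmult_le_compat_r; auto).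
assert (H7 : (w + Rabs eta) * window_norm E l w eta q2 (B y) <= K * (3 * norm (B y))).
{ eapply Rle_trans; [exact H3|]. apply Rmult_le_compat_l; lra. }
assert (H8 : (w + Rabs eta) * window_norm E l w eta q1 (B y) <=
  K * window_norm E l w eta q2 (B y)) by lra.
assert (He := Rabs_pos eta).
set (W := w + Rabs eta) in *. assert (HW : 0 < W) by (unfold W; lra).
apply Rle_trans with (W ^ 2 * ((1 + K) * window_norm E l w eta q1 (B y))).
{ apply Rmult_le_compat_l; auto. nra. }
apply Rle_trans with ((1 + K) * (W * (K * window_norm E l w eta q2 (B y)))).
{ replace (W ^ 2 * ((1 + K) * window_norm E l w eta q1 (B y))) with
    ((1 + K) * (W * (W * window_norm E l w eta q1 (B y)))) by ring.
  apply Rmult_le_compat_l; [lra|]. apply Rmult_le_compat_l; lra. }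
replace ((1 + K) * (W * (K * window_norm E l w eta q2 (B y)))) with
  ((1 + K) * K * (W * window_norm E l w eta q2 (B y))) by ring.
replace (3 * (1 + K) * K ^ 2 * norm (B y)) with ((1 + K) * K * (K * (3 * norm (B y)))) by ring.
apply Rmult_le_compat_l; auto. nra.
Qed.

(* [a_k <= c / (w + k d)^2] and the sum of the a_k telescopes. *)
Lemma dirichlet_window l t m y :
  0 < t < l -> 28 * M / (w - w0) <= l ->
  let c := 3 * (1 + K) * K ^ 2 * norm (B y) in
  let d := 2 * PI / l in
  norm (RInt (fun s => scal (dirichlet m (2 * PI / l * (s - t)))
    (scal (bump l s * exp (- w * s)) (Epos E s y))) 0 l) <=
  c / w ^ 2 + 2 * c / d * (/ w - / (w + INR m * d)).
Proof.
intros Ht HlM c d. fold d.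
assert (Hd : 0 < d) by (apply Rdiv_lt_0_compat; [pose proof PI_RGT_0|]; lra).
assert (Hc : 0 <= c).
{ unfold c. pose proof (norm_ge0 (B y)). apply Rmult_le_pos; auto. nra. }
assert (Hq : forall s, continuous (bump l) s).
{ intros s. apply (@ex_derive_continuous R_AbsRing R_NormedModule).
  unfold bump. auto_derive. auto. }
assert (Hqe : forall s, continuous (fun s => bump l s * exp (- w * s)) s).
{ intros s. apply continuous_R_mult; auto.
  apply (@ex_derive_continuous R_AbsRing R_NormedModule). auto_derive. auto. }
assert (HF : forall s, continuous (fun s => scal (bump l s * exp (- w * s)) (Epos E s y)) s).
{ intros s. apply continuous_scalX; auto. now apply Epos_continuous. }
assert (Hwin : forall eta, 0 <= eta -> window_norm E l w eta (bump l) y <= c / (w + eta) ^ 2).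
{ intros eta He. pose proof (@bump_window l eta y ltac:(lra) HlM) as H.
  rewrite (Rabs_pos_eq eta) in H by auto.
  assert (0 < (w + eta) ^ 2) by (apply pow_lt; lra).
  apply (Rmult_le_reg_l ((w + eta) ^ 2)); auto.
  replace ((w + eta) ^ 2 * (c / (w + eta) ^ 2)) with c by (field; lra). exact H. }
induction m as [|m IH].
- simpl INR. rewrite Rmult_0_l, Rplus_0_r, Rminus_diag, Rmult_0_r, Rplus_0_r.
  specialize (Hwin 0 (Rle_refl 0)). rewrite Rplus_0_r in Hwin.
  eapply Rle_trans; [|exact Hwin].
  unfold window_norm, cosine_integral.
  rewrite (RInt_ext (V := X) _ (fun s => scal (cosine_part w 0 (bump l) s) (Epos E s y))).
  + pose proof (norm_ge0 (sine_integral E l w 0 (bump l) y)). lra.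
  + intros s _. unfold cosine_part. rewrite Rmult_0_l, cos_0. simpl. vring X.
- set (eta := INR (S m) * d).
  assert (He : 0 < eta) by (unfold eta; apply Rmult_lt_0_compat; auto; apply lt_0_INR; lia).
  specialize (Hwin eta ltac:(lra)).
  assert (HC : ex_RInt (fun s => scal (cosine_part w eta (bump l) s) (Epos E s y)) 0 l)
    by (apply ex_RInt_orbit; auto; now apply cosine_part_continuous).
  assert (HS : ex_RInt (fun s => scal (sine_part w eta (bump l) s) (Epos E s y)) 0 l)
    by (apply ex_RInt_orbit; auto; now apply sine_part_continuous).
  assert (E1 : RInt (fun s => scal (dirichlet (S m) (d * (s - t)))
      (scal (bump l s * exp (- w * s)) (Epos E s y))) 0 l =
    plus (RInt (fun s => scal (dirichlet m (d * (s - t)))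
      (scal (bump l s * exp (- w * s)) (Epos E s y))) 0 l)
    (scal 2 (plus (scal (cos (eta * t)) (cosine_integral E l w eta (bump l) y))
      (scal (sin (eta * t)) (sine_integral E l w eta (bump l) y))))).
  { apply (is_RInt_unique (V := X)).
    apply (is_RInt_ext (fun s => plus (scal (dirichlet m (d * (s - t)))
      (scal (bump l s * exp (- w * s)) (Epos E s y)))
      (scal 2 (plus (scal (cos (eta * t)) (scal (cosine_part w eta (bump l) s) (Epos E s y)))
      (scal (sin (eta * t)) (scal (sine_part w eta (bump l) s) (Epos E s y))))))).
    - intros s _. unfold cosine_part, sine_part.
      change (dirichlet (S m) (d * (s - t))) with
        (dirichlet m (d * (s - t)) + 2 * cos (INR (S m) * (d * (s - t)))).
      replace (INR (S m) * (d * (s - t))) with (eta * s - eta * t) by (unfold eta; ring).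
      rewrite cos_minus. vring X.
    - apply (is_RInt_plus (V := X)).
      + apply (RInt_correct (V := X)). apply ex_RInt_cont. intros s.
        apply continuous_scalX; auto. apply dirichlet_continuous.
      + apply (is_RInt_scal (V := X)). apply (is_RInt_plus (V := X));
        apply (is_RInt_scal (V := X)); now apply (RInt_correct (V := X)). }
  rewrite E1. eapply Rle_trans; [apply norm_plus_le|].
  assert (G : norm (scal 2 (plus (scal (cos (eta * t)) (cosine_integral E l w eta (bump l) y))
      (scal (sin (eta * t)) (sine_integral E l w eta (bump l) y)))) <=
    2 * (c / (w + eta) ^ 2)).
  { rewrite norm_scalR, Rabs_pos_eq by lra. apply Rmult_le_compat_l; [lra|].
    eapply Rle_trans; [apply norm_plus_le|]. rewrite !norm_scalR.
    unfold window_norm in Hwin.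
    pose proof (norm_ge0 (cosine_integral E l w eta (bump l) y)).
    pose proof (norm_ge0 (sine_integral E l w eta (bump l) y)).
    assert (Rabs (cos (eta * t)) <= 1) by (pose proof (COS_bound (eta * t)); split_Rabs; lra).
    assert (Rabs (sin (eta * t)) <= 1) by (pose proof (SIN_bound (eta * t)); split_Rabs; lra).
    nra. }
  assert (T : 2 * (c / (w + eta) ^ 2) <= 2 * c / d * (/ (w + INR m * d) - / (w + eta))).
  { assert (Hw' : 0 < w) by lra.
    assert (Hm : 0 < w + INR m * d) by (pose proof (pos_INR m); nra).
    assert (Heta : eta = INR m * d + d) by (unfold eta; rewrite S_INR; ring).
    replace (2 * c / d * (/ (w + INR m * d) - / (w + eta))) with
      (2 * (c / ((w + INR m * d) * (w + eta)))).
    2:{ rewrite Heta. field. repeat split; lra. }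
    apply Rmult_le_compat_l; [lra|]. unfold Rdiv. apply Rmult_le_compat_l; auto.
    apply Rinv_le_contravar; [nra|]. simpl. rewrite Rmult_1_r.
    apply Rmult_le_compat_r; lra. }
  fold eta. lra.
Qed.

(** With c = 3 (1 + K) K^2 |B y| the Dirichlet sums are at most 2 c l / w. Fejer evaluation then
    gives 2 c / w at time [t], and removing the factor t^2 / 4 of the bump leads to 24. *)
Lemma key_estimate t y : 0 < t ->
  t ^ 2 * norm (E t y) <= 24 * (1 + K) * K ^ 2 * (exp (w * t) / w) * norm (B y).
Proof.
intros Ht.
(* The first entry puts [t] into the left half of the window, the second removes [M], and the third
   allows the zero frequency term c / w^2 to be bounded by l c / w. *)
set (l := Rmax (2 * t) (Rmax (28 * M / (w - w0)) (/ w))).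
assert (Hl1 : 2 * t <= l) by apply Rmax_l.
assert (Hl2 : 28 * M / (w - w0) <= l).
{ eapply Rle_trans; [|apply Rmax_r]. apply Rmax_l. }
assert (Hl3 : / w <= l).
{ eapply Rle_trans; [|apply Rmax_r]. apply Rmax_r. }
clearbody l.
set (c := 3 * (1 + K) * K ^ 2 * norm (B y)).
assert (Hc : 0 <= c).
{ unfold c. pose proof (norm_ge0 (B y)). apply Rmult_le_pos; auto. nra. }
assert (Hlw : 1 <= l * w).
{ apply (Rmult_le_compat_r w) in Hl3; [|lra]. rewrite Rinv_l in Hl3 by lra. exact Hl3. }
pose proof PI_RGT_0 as HPI. pose proof PI2_1 as HPI2.
assert (HF : forall s, continuous (fun s => scal (bump l s * exp (- w * s)) (Epos E s y)) s).
{ intros s. apply continuous_scalX; [|now apply Epos_continuous].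
  unfold bump. apply (@ex_derive_continuous R_AbsRing R_NormedModule). auto_derive. auto. }
assert (H := @fejer_evaluation X
  (fun s => scal (bump l s * exp (- w * s)) (Epos E s y)) l t (2 * c / w)
  ltac:(lra) HF).
assert (H' : norm (scal (bump l t * exp (- w * t)) (Epos E t y)) <= 2 * c / w).
{ apply H. intros m. eapply Rle_trans; [apply dirichlet_window; auto; lra|].
  fold c. set (d := 2 * PI / l).
  assert (Hd : 0 < d) by (apply Rdiv_lt_0_compat; lra).
  assert (Hm : 0 < / (w + INR m * d)).
  { apply Rinv_0_lt_compat. pose proof (pos_INR m). nra. }
  apply Rle_trans with (c / w ^ 2 + 2 * c / d * / w).
  { apply Rplus_le_compat_l, Rmult_le_compat_l; [|lra].
    apply Rdiv_le_0_compat; lra. }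
  apply Rle_trans with (l * c / w + l * c / w).
  2:{ right. field. lra. }
  apply Rplus_le_compat.
  - apply (Rmult_le_reg_r (w ^ 2)); [nra|].
    replace (c / w ^ 2 * w ^ 2) with c by (field; lra).
    replace (l * c / w * w ^ 2) with (l * w * c) by (field; lra). nra.
  - unfold d. replace (2 * c / (2 * PI / l) * / w) with (l * c / w * / PI) by (field; lra).
    rewrite <- (Rmult_1_r (l * c / w)) at 2. apply Rmult_le_compat_l.
    + apply Rdiv_le_0_compat; nra.
    + rewrite <- Rinv_1. apply Rinv_le_contravar; lra. }
rewrite (@Epos_eq X), norm_scalR in H' by lra.
rewrite Rabs_mult, (Rabs_pos_eq (exp _)) in H' by (left; apply exp_pos).
assert (Hb : t ^ 2 / 4 <= Rabs (bump l t)).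
{ rewrite Rabs_pos_eq.
  - unfold bump. assert (0 <= t / l <= / 2).
    { split; [apply Rdiv_le_0_compat; lra|].
      apply (Rmult_le_reg_r l); [lra|]. replace (t / l * l) with t by (field; lra). lra. }
    replace (t ^ 2 / 4) with (t ^ 2 * (/ 2) ^ 2) by field.
    apply Rmult_le_compat_l; [nra|]. apply pow_incr. lra.
  - unfold bump. apply Rmult_le_pos; apply pow2_ge_0. }
assert (Hexp : exp (- w * t) * exp (w * t) = 1).
{ rewrite <- exp_plus. replace (- w * t + w * t) with 0 by ring. apply exp_0. }
pose proof (exp_pos (w * t)) as Hp. pose proof (exp_pos (- w * t)) as Hp'.
pose proof (norm_ge0 (E t y)) as Hn.
assert (H2 : t ^ 2 / 4 * exp (- w * t) * norm (E t y) <= 2 * c / w).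
{ eapply Rle_trans; [|exact H']. apply Rmult_le_compat_r; auto.
  apply Rmult_le_compat_r; lra. }
apply (Rmult_le_compat_r (4 * exp (w * t))) in H2; [|lra].
replace (t ^ 2 / 4 * exp (- w * t) * norm (E t y) * (4 * exp (w * t))) with
  (t ^ 2 * norm (E t y) * (exp (- w * t) * exp (w * t))) in H2 by field.
rewrite Hexp, Rmult_1_r in H2. eapply Rle_trans; [exact H2|].
right. unfold c. field. lra.
Qed.

End Growth.

(** With w = w0 + 1 / t0 the exponential costs a further factor e <= 3, and 1 / w is at most [t0];
    hence |E(t0)| is at most a multiple of e^{w0 t0} / t0, and [t0] is so large that this is half of
    e^{w0 t0}. As [t0] depends only on [K] and [MB], the gain ln 2 / t0 is the same for every w0 and
    every growth constant. *)
Lemma growth_shift : exists kappa, 0 < kappa /\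
  forall w0, 0 <= w0 -> growth E w0 -> growth E (Rmax (w0 - kappa) 0).
Proof.
set (CK := 24 * (1 + K) * K ^ 2).
assert (HCK : 0 < CK) by (unfold CK; assert (0 < K ^ 2) by (apply pow_lt; lra); nra).
set (c3 := 3 * CK * MB + 1).
assert (HMB := proj1 HB).
assert (Hc3 : 1 <= c3) by (unfold c3; nra).
set (t0 := 2 * c3). assert (Ht0 : 0 < t0) by (unfold t0; lra).
assert (Hln2 : 0 < ln 2) by (rewrite <- ln_1; apply ln_increasing; lra).
exists (ln 2 / t0). split; [now apply Rdiv_lt_0_compat|].
intros w0 Hw0 (M & HM & Hg).
apply growth_from_time with t0 (M * exp (w0 * t0) + 1); auto.
- apply Rmax_r.
- pose proof (exp_pos (w0 * t0)). nra.
- intros t x Ht. eapply Rle_trans; [apply Hg; lra|].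
  apply Rmult_le_compat_r; [apply norm_ge0|].
  assert (exp (w0 * t) <= exp (w0 * t0)) by (apply exp_le_mono; nra). nra.
- intros x.
  assert (Hit0 : 0 < / t0) by now apply Rinv_0_lt_compat.
  assert (H := @key_estimate w0 M (w0 + / t0) ltac:(lra) HM Hg t0 x Ht0). fold CK in H.
  replace ((w0 + / t0) * t0) with (w0 * t0 + 1) in H by (field; lra).
  rewrite exp_plus in H. pose proof exp_le_3 as H3.
  pose proof (exp_pos (w0 * t0)) as Hp. pose proof (norm_ge0 x) as Hn.
  assert (H1 : exp (w0 * t0) * exp 1 / (w0 + / t0) <= exp (w0 * t0) * 3 * t0).
  { unfold Rdiv. apply Rmult_le_compat.
    - apply Rmult_le_pos; [lra|left; apply exp_pos].
    - left; apply Rinv_0_lt_compat; lra.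
    - apply Rmult_le_compat_l; lra.
    - rewrite <- (Rinv_inv t0) at 2. apply Rinv_le_contravar; lra. }
  assert (H2 : norm (B x) <= MB * norm x) by apply HB.
  assert (H4 : t0 ^ 2 * norm (E t0 x) <=
    CK * (exp (w0 * t0) * 3 * t0) * (MB * norm x)).
  { eapply Rle_trans; [exact H|]. apply Rmult_le_compat; auto.
    - apply Rmult_le_pos; [lra|]. apply Rdiv_le_0_compat; [|lra].
      apply Rmult_le_pos; [lra|left; apply exp_pos].
    - apply norm_ge0.
    - apply Rmult_le_compat_l; lra. }
  assert (H5 : norm (E t0 x) <= / 2 * exp (w0 * t0) * norm x).
  { apply (Rmult_le_reg_l (t0 ^ 2)); [apply pow_lt; auto|].
    eapply Rle_trans; [exact H4|].
    replace (CK * (exp (w0 * t0) * 3 * t0) * (MB * norm x)) with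
      (3 * CK * MB * (t0 * exp (w0 * t0) * norm x)) by ring.
    replace (t0 ^ 2 * (/ 2 * exp (w0 * t0) * norm x)) with
      (c3 * (t0 * exp (w0 * t0) * norm x)) by (unfold t0; field).
    apply Rmult_le_compat_r; [|unfold c3; lra].
    apply Rmult_le_pos; auto. apply Rmult_le_pos; lra. }
  eapply Rle_trans; [exact H5|]. apply Rmult_le_compat_r; auto.
  replace (/ 2 * exp (w0 * t0)) with (exp ((w0 - ln 2 / t0) * t0)).
  + apply exp_le_mono. apply Rmult_le_compat_r; [lra|]. apply Rmax_l.
  + replace ((w0 - ln 2 / t0) * t0) with (- ln 2 + w0 * t0) by (field; lra).
    rewrite exp_plus, exp_Ropp, exp_ln by lra. reflexivity.
Qed.

Lemma semigroup_bounded : exists M, 1 <= M /\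
  forall t x, 0 <= t -> norm (E t x) <= M * norm x.
Proof.
destruct growth_shift as (kappa & Hk & Hstep).
assert (G : forall n w0, 0 <= w0 <= INR n * kappa -> growth E w0 -> growth E 0).
{ induction n as [|n IH]; intros w0 Hw0 Hg.
  - simpl in Hw0. replace w0 with 0 in Hg by lra. exact Hg.
  - rewrite S_INR in Hw0. apply (IH (Rmax (w0 - kappa) 0)).
    + split; [apply Rmax_r|]. apply Rmax_lub; [lra|].
      apply Rmult_le_pos; [apply pos_INR|lra].
    + apply Hstep; auto; lra. }
destruct (growth_exists HE) as (w0 & Hw0 & Hg).
destruct (INR_unbounded (w0 / kappa)) as [n Hn].
destruct (G n w0) as (M & HM & H); auto.
{ split; auto. left. apply (Rmult_lt_compat_r kappa) in Hn; auto.
  replace (w0 / kappa * kappa) with w0 in Hn by (field; lra). exact Hn. }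
exists (M + 1). split; [lra|]. intros t x Ht. specialize (H t x Ht).
rewrite Rmult_0_l, exp_0 in H. pose proof (norm_ge0 x). nra.
Qed.

(** For y = A x this is |A E(t) x| <= C |x| / t on the domain of A; the extension to all vectors
    follows later by density. *)
Lemma semigroup_smoothing : exists C, 0 < C /\
  forall t y, 0 < t -> t * norm (E t y) <= C * norm (B y).
Proof.
destruct semigroup_bounded as (M & HM & Hb).
set (CK := 24 * (1 + K) * K ^ 2).
assert (HCK : 0 < CK) by (unfold CK; assert (0 < K ^ 2) by (apply pow_lt; lra); nra).
exists (3 * CK). split; [lra|]. intros t y Ht.
assert (Hit : 0 < / t) by now apply Rinv_0_lt_compat.
assert (H := @key_estimate 0 M (/ t) ltac:(lra) ltac:(lra)). fold CK in H.
specialize (H ltac:(intros s x Hs; rewrite Rmult_0_l, exp_0, Rmult_1_r; auto) t y Ht).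
rewrite Rinv_l in H by lra.
replace (exp 1 / / t) with (t * exp 1) in H by (field; lra).
pose proof exp_le_3. pose proof (norm_ge0 (B y)).
apply (Rmult_le_reg_l t); auto.
replace (t * (t * norm (E t y))) with (t ^ 2 * norm (E t y)) by ring.
eapply Rle_trans; [exact H|].
replace (t * (3 * CK * norm (B y))) with (CK * (t * 3) * norm (B y)) by ring.
apply Rmult_le_compat_r; auto. apply Rmult_le_compat_l; [lra|].
apply Rmult_le_compat_l; lra.
Qed.

End Decay.

(** * Improper integrals on the half line *)

Lemma Rpower_pos a b : 0 < Rpower a b.
Proof. apply exp_pos. Qed.

Lemma is_derive_Rpower p t : 0 < t ->
  is_derive (fun s => Rpower s p) t (p * Rpower t (p - 1)).
Proof. intros Ht. apply is_derive_Reals. now apply derivable_pt_lim_power. Qed.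

Lemma continuous_Rpower p t : 0 < t -> continuous (fun s => Rpower s p) t.
Proof.
intros Ht. apply (@ex_derive_continuous R_AbsRing R_NormedModule).
exists (p * Rpower t (p - 1)). now apply is_derive_Rpower.
Qed.

Lemma Rpower_small p e : 0 < p -> 0 < e ->
  exists d, 0 < d /\ forall t, 0 < t < d -> Rpower t p < e.
Proof.
intros Hp He. exists (Rpower e (/ p)). split; [apply Rpower_pos|].
intros t Ht. replace e with (Rpower (Rpower e (/ p)) p).
- apply Rlt_Rpower_l; auto.
- rewrite Rpower_mult, Rinv_l, Rpower_1; lra.
Qed.

Lemma Rpower_small_inf p e : 0 < p -> 0 < e ->
  exists N, 0 < N /\ forall t, N < t -> Rpower t (- p) < e.
Proof.
intros Hp He. destruct (Rpower_small Hp He) as [d [Hd H]].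
exists (/ d). split; [now apply Rinv_0_lt_compat|]. intros t Ht.
assert (Hd' : 0 < / d) by now apply Rinv_0_lt_compat.
assert (Ht0 : 0 < t) by lra.
replace (Rpower t (- p)) with (Rpower (/ t) p).
- apply H. split; [now apply Rinv_0_lt_compat|].
  rewrite <- (Rinv_inv d). apply Rinv_lt_contravar; [nra|auto].
- unfold Rpower. rewrite ln_Rinv by auto. f_equal. ring.
Qed.

Lemma power_integral p a b : p <> 0 -> 0 < a <= b ->
  is_RInt (fun t => Rpower t (p - 1)) a b ((Rpower b p - Rpower a p) / p).
Proof.
intros Hp Hab.
assert (H : is_RInt (fun t => Rpower t (p - 1)) a b
  (minus (/ p * Rpower b p) (/ p * Rpower a p))).
{ apply (@is_RInt_derive R_CompleteNormedModule (fun t => / p * Rpower t p)).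
  - rewrite Rmin_left, Rmax_right by lra. intros t Ht.
    evar_last; [apply is_derive_scal; apply is_derive_Rpower; lra|]. simpl.
    field. auto.
  - rewrite Rmin_left, Rmax_right by lra. intros t Ht. apply continuous_Rpower; lra. }
replace ((Rpower b p - Rpower a p) / p) with (minus (/ p * Rpower b p) (/ p * Rpower a p)).
- exact H.
- unfold minus, plus, opp; simpl. field. auto.
Qed.

Definition zero_infinity := filter_prod (at_right 0) (Rbar_locally p_infty).

#[export] Instance zero_infinity_proper : ProperFilter zero_infinity.
Proof. apply filter_prod_proper; typeclasses eauto. Qed.

Lemma zero_infinity_between d N :
  0 < d -> zero_infinity (fun ab => 0 < fst ab < d /\ N < snd ab).
Proof.
intros Hd. apply (@Filter_prod _ _ _ _ _ (fun a => 0 < a < d) (fun b => N < b)).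
- exists (mkposreal d Hd). intros a Ha Ha0. split; auto.
  unfold ball in Ha; simpl in Ha; unfold AbsRing_ball, abs, minus, plus, opp in Ha; simpl in Ha.
  rewrite Ropp_0, Rplus_0_r in Ha. pose proof (Rle_abs a). simpl in *. lra.
- exists N. auto.
- simpl. auto.
Qed.

Lemma zero_infinity_scale (s : R) P : 0 < s ->
  zero_infinity P -> zero_infinity (fun ab => P (s * fst ab, s * snd ab)).
Proof.
intros Hs [Q R' [d Hd] [N HN] H].
apply (@Filter_prod _ _ _ _ _ (fun a => Q (s * a)) (fun b => R' (s * b))).
- assert (Hds : 0 < d / s) by (apply Rdiv_lt_0_compat; auto; apply cond_pos).
  exists (mkposreal _ Hds). intros a Ha Ha0. apply Hd; [|nra].
  unfold ball in *; simpl in *; unfold AbsRing_ball, abs, minus, plus, opp in *; simpl in *.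
  rewrite Ropp_0, Rplus_0_r in *. rewrite Rabs_pos_eq in * by nra.
  apply (Rmult_lt_compat_l s) in Ha; auto.
  replace (s * (d / s)) with (pos d) in Ha by (field; lra). exact Ha.
- exists (N / s). intros b Hb. apply HN.
  apply (Rmult_lt_compat_l s) in Hb; auto.
  replace (s * (N / s)) with N in Hb by (field; lra). exact Hb.
- intros a b Ha Hb. simpl. now apply H.
Qed.

Section Improper.

Variable X : CompleteNormedModule R_AbsRing.
Implicit Types (x y z : X) (F G : R -> X).

(** Continuity on the open half line is part of the notion, so that every integral between positive
    end points exists; the limit is kept in epsilon form. *)
Definition is_imp F (I : X) : Prop :=
  (forall t, 0 < t -> continuous F t) /\
  forall e, 0 < e -> zero_infinity (fun ab =>
    norm (minus (RInt F (fst ab) (snd ab)) I) < e).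

Lemma ex_RInt_pos F a b : (forall t, 0 < t -> continuous F t) ->
  0 < a -> 0 < b -> ex_RInt F a b.
Proof.
intros HF Ha Hb. apply (@ex_RInt_continuous X). intros t [Ht _]. apply HF.
eapply Rlt_le_trans; [|exact Ht]. now apply Rmin_pos.
Qed.

Lemma is_imp_is_RInt_gen F F' I :
  is_imp F I -> (forall t, 0 < t -> F t = F' t) ->
  is_RInt_gen F' (at_right 0) (Rbar_locally p_infty) I.
Proof.
intros [HF HI] HFF'. unfold is_RInt_gen.
apply (filterlimi_locally (F := zero_infinity)). intros e.
generalize (filter_and _ _ (zero_infinity_between 1 Rlt_0_1) (HI e (cond_pos e))).
apply filter_imp. intros [a b]; simpl. intros [[Ha Hb] H].
exists (RInt F a b). split; [|now apply norm_lt_ball; rewrite norm_minus_sym in H; rewrite norm_minus_sym].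
apply (is_RInt_ext F).
- intros t [Ht _]. apply HFF'. eapply Rlt_trans; [|exact Ht]. apply Rmin_pos; lra.
- apply (@RInt_correct X). apply ex_RInt_pos; auto; lra.
Qed.

Lemma is_imp_RInt_gen F F' I :
  is_imp F I -> (forall t, 0 < t -> F t = F' t) ->
  RInt_gen F' (at_right 0) (Rbar_locally p_infty) = I.
Proof.
intros H1 H2. apply is_RInt_gen_unique; try typeclasses eauto.
now apply is_imp_is_RInt_gen with F.
Qed.

Lemma is_imp_unique F I J : is_imp F I -> is_imp F J -> I = J.
Proof.
intros [_ HI] [_ HJ]. apply norm_small_eq. intros e He.
apply (norm_lim_le (F := zero_infinity) HI).
generalize (HJ e He). apply filter_imp. intros; lra.
Qed.

Lemma is_imp_ext F G I : (forall t, 0 < t -> F t = G t) -> is_imp F I -> is_imp G I.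
Proof.
intros HFG [HF HI]. split.
- intros t Ht. apply continuous_ext_loc with F; auto.
  exists (mkposreal t Ht). intros r Hr. apply HFG.
  unfold ball in Hr; simpl in Hr; unfold AbsRing_ball, abs, minus, plus, opp in Hr; simpl in Hr.
  split_Rabs; lra.
- intros e He.
  generalize (filter_and _ _ (zero_infinity_between 1 Rlt_0_1) (HI e He)).
  apply filter_imp. intros [a b]; simpl. intros [[Ha Hb] H].
  rewrite (RInt_ext (V := X) G F); auto.
  intros t [Ht _]. symmetry. apply HFG.
  eapply Rlt_trans; [|exact Ht]. apply Rmin_pos; lra.
Qed.

Lemma is_imp_plus F G I J : is_imp F I -> is_imp G J ->
  is_imp (fun t => plus (F t) (G t)) (plus I J).
Proof.
intros [HF HI] [HG HJ]. split.
- intros t Ht. apply continuous_plusX; auto.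
- intros e He.
  generalize (filter_and _ _ (zero_infinity_between 1 Rlt_0_1)
    (filter_and (F := zero_infinity) _ _ (HI (e / 2) ltac:(lra)) (HJ (e / 2) ltac:(lra)))).
  apply filter_imp. intros [a b]; simpl. intros [[Ha Hb] [H1 H2]].
  rewrite (RInt_plus (V := X)) by (apply ex_RInt_pos; auto; lra).
  replace (minus _ _) with (plus (minus (RInt F a b) I) (minus (RInt G a b) J)) by vring X.
  eapply Rle_lt_trans; [apply norm_plus_le|]. lra.
Qed.

Lemma is_imp_bl l M F I : bounded_linear l M -> is_imp F I ->
  is_imp (fun t => l (F t)) (l I).
Proof.
intros Hl [HF HI]. split.
- intros t Ht. apply (bl_continuous Hl). auto.
- intros e He.
  generalize (filter_and _ _ (zero_infinity_between 1 Rlt_0_1) (bl_lim Hl HI He)).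
  apply filter_imp. intros [a b]; simpl. intros [[Ha Hb] H].
  rewrite <- (bl_RInt Hl); auto. apply ex_RInt_pos; auto; lra.
Qed.

Lemma scal_bl (k : R) : bounded_linear (fun x : X => scal k x) (Rabs k).
Proof.
split; [apply Rabs_pos|]. split; [intros; vring X|]. split; [intros; vring X|].
intros x. rewrite norm_scalR. lra.
Qed.

Lemma is_imp_scal (k : R) F I : is_imp F I ->
  is_imp (fun t => scal k (F t)) (scal k I).
Proof. apply (is_imp_bl (scal_bl k)). Qed.

Lemma is_imp_minus F G I J : is_imp F I -> is_imp G J ->
  is_imp (fun t => minus (F t) (G t)) (minus I J).
Proof.
intros HI HJ.
replace (minus I J) with (plus I (scal (-1) J)) by vring X.
apply (is_imp_ext (F := fun t => plus (F t) (scal (-1) (G t)))).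
- intros; vring X.
- apply is_imp_plus; auto. now apply is_imp_scal.
Qed.

Lemma is_imp_scale (s : R) F I : 0 < s -> is_imp F I ->
  is_imp (fun t => scal s (F (s * t))) I.
Proof.
intros Hs [HF HI]. split.
- intros t Ht. apply continuous_scalX; [apply continuous_const|].
  apply (continuous_comp (fun t => s * t) F).
  + apply (@ex_derive_continuous R_AbsRing R_NormedModule). auto_derive. auto.
  + apply HF. nra.
- intros e He.
  generalize (filter_and _ _ (zero_infinity_between 1 Rlt_0_1)
    (zero_infinity_scale Hs (HI e He))).
  apply filter_imp. intros [a b]; simpl. intros [[Ha Hb] H].
  replace (RInt (fun t => scal s (F (s * t))) a b) with (RInt F (s * a) (s * b)); auto.
  rewrite <- (Rplus_0_r (s * a)), <- (Rplus_0_r (s * b)).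
  rewrite <- (RInt_comp_lin (V := X)).
  + apply (RInt_ext (V := X)). intros t _. now rewrite Rplus_0_r.
  + apply ex_RInt_pos; auto; nra.
Qed.

(** For positive [p] and [q] the first bound is integrable at 0, the second at infinity. Both are
    imposed on the whole half line, which leaves the point of splitting free. *)
Definition power_bounds (p q C1 C2 : R) F : Prop :=
  (forall t, 0 < t -> norm (F t) <= C1 * Rpower t (p - 1)) /\
  (forall t, 0 < t -> norm (F t) <= C2 * Rpower t (- q - 1)).

Lemma RInt_power_le (p C : R) F a b :
  p <> 0 -> 0 < a <= b -> (forall t, 0 < t -> continuous F t) ->
  (forall t, 0 < t -> norm (F t) <= C * Rpower t (p - 1)) ->
  norm (RInt F a b) <= C * ((Rpower b p - Rpower a p) / p).
Proof.
intros Hp Hab HF HC.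
assert (H := is_RInt_scal (V := R_NormedModule) _ _ _ C _ (power_integral Hp Hab)).
apply (norm_RInt_le F (fun t => C * Rpower t (p - 1)) a b); try lra.
- intros t Ht. apply HC; lra.
- apply (@RInt_correct X). apply ex_RInt_pos; auto; lra.
- exact H.
Qed.

Lemma RInt_zero_le (p C : R) F a b :
  0 < p -> 0 < a <= b -> (forall t, 0 < t -> continuous F t) ->
  (forall t, 0 < t -> norm (F t) <= C * Rpower t (p - 1)) ->
  norm (RInt F a b) <= C * (Rpower b p / p).
Proof.
intros Hp Hab HF HC.
assert (HC0 : 0 <= C).
{ pose proof (HC 1 Rlt_0_1). pose proof (norm_ge0 (F 1)).
  pose proof (Rpower_pos 1 (p - 1)). nra. }
eapply Rle_trans; [apply (RInt_power_le (p := p) (C := C)); auto; lra|].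
apply Rmult_le_compat_l; auto. unfold Rdiv. apply Rmult_le_compat_r.
- left; now apply Rinv_0_lt_compat.
- pose proof (Rpower_pos a p). lra.
Qed.

Lemma RInt_infinity_le (q C : R) F a b :
  0 < q -> 0 < a <= b -> (forall t, 0 < t -> continuous F t) ->
  (forall t, 0 < t -> norm (F t) <= C * Rpower t (- q - 1)) ->
  norm (RInt F a b) <= C * (Rpower a (- q) / q).
Proof.
intros Hq Hab HF HC.
assert (HC0 : 0 <= C).
{ pose proof (HC 1 Rlt_0_1). pose proof (norm_ge0 (F 1)).
  pose proof (Rpower_pos 1 (- q - 1)). nra. }
eapply Rle_trans; [apply (RInt_power_le (p := - q) (C := C)); auto; lra|].
apply Rmult_le_compat_l; auto.
replace ((Rpower b (- q) - Rpower a (- q)) / - q) with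
  ((Rpower a (- q) - Rpower b (- q)) / q) by (field; lra).
unfold Rdiv. apply Rmult_le_compat_r.
- left; now apply Rinv_0_lt_compat.
- pose proof (Rpower_pos b (- q)). lra.
Qed.

Lemma imp_exists p q C1 C2 F :
  0 < p -> 0 < q -> (forall t, 0 < t -> continuous F t) ->
  power_bounds p q C1 C2 F -> exists I, is_imp F I.
Proof.
intros Hp Hq HF [H1 H2].
assert (HC1 : 0 <= C1).
{ pose proof (H1 1 Rlt_0_1). pose proof (norm_ge0 (F 1)).
  pose proof (Rpower_pos 1 (p - 1)). nra. }
assert (HC2 : 0 <= C2).
{ pose proof (H2 1 Rlt_0_1). pose proof (norm_ge0 (F 1)).
  pose proof (Rpower_pos 1 (- q - 1)). nra. }
destruct (filter_cauchy_lim (F := zero_infinity)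
  (f := fun ab => RInt F (fst ab) (snd ab))) as [I HI].
2:{ exists I. split; auto. }
intros e He.
destruct (@Rpower_small p (e / 2 * p / (C1 + 1))) as [d [Hd Hd']]; auto.
{ apply Rdiv_lt_0_compat; nra. }
destruct (@Rpower_small_inf q (e / 2 * q / (C2 + 1))) as [N [HN HN']]; auto.
{ apply Rdiv_lt_0_compat; nra. }
exists (fun ab => 0 < fst ab < d /\ N < snd ab). split.
{ now apply zero_infinity_between. }
assert (G1 : forall a b, 0 < a -> a <= b < d -> norm (RInt F a b) < e / 2).
{ intros a b Ha Hb. eapply Rle_lt_trans; [apply (RInt_zero_le (p := p) (C := C1)); auto; lra|].
  specialize (Hd' b ltac:(lra)).
  apply (Rmult_lt_compat_r ((C1 + 1) / p)) in Hd'; [|apply Rdiv_lt_0_compat; lra].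
  replace (e / 2 * p / (C1 + 1) * ((C1 + 1) / p)) with (e / 2) in Hd' by (field; lra).
  eapply Rle_lt_trans; [|exact Hd'].
  replace (Rpower b p * ((C1 + 1) / p)) with ((C1 + 1) * (Rpower b p / p)) by (field; lra).
  apply Rmult_le_compat_r; [|lra]. apply Rdiv_le_0_compat; auto. left; apply Rpower_pos. }
assert (G2 : forall a b, N < a <= b -> norm (RInt F a b) < e / 2).
{ intros a b Hab. eapply Rle_lt_trans; [apply (RInt_infinity_le (q := q) (C := C2)); auto; lra|].
  specialize (HN' a ltac:(lra)).
  apply (Rmult_lt_compat_r ((C2 + 1) / q)) in HN'; [|apply Rdiv_lt_0_compat; lra].
  replace (e / 2 * q / (C2 + 1) * ((C2 + 1) / q)) with (e / 2) in HN' by (field; lra).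
  eapply Rle_lt_trans; [|exact HN'].
  replace (Rpower a (- q) * ((C2 + 1) / q)) with ((C2 + 1) * (Rpower a (- q) / q)) by (field; lra).
  apply Rmult_le_compat_r; [|lra]. apply Rdiv_le_0_compat; auto. left; apply Rpower_pos. }
assert (Hsym : forall a b, 0 < a -> 0 < b -> RInt F a b = opp (RInt F b a)).
{ intros a b Ha Hb. symmetry. apply (opp_RInt_swap (V := X)). apply ex_RInt_pos; auto. }
assert (G1' : forall a b, 0 < a < d -> 0 < b < d -> norm (RInt F a b) < e / 2).
{ intros a b Ha Hb. destruct (Rle_or_lt a b); [apply G1; lra|].
  rewrite Hsym, norm_oppE by lra. apply G1; lra. }
assert (G2' : forall a b, N < a -> N < b -> norm (RInt F a b) < e / 2).
{ intros a b Ha Hb. destruct (Rle_or_lt a b); [apply G2; lra|].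
  rewrite Hsym, norm_oppE by lra. apply G2; lra. }
intros [a b] [a' b']; simpl. intros [Ha Hb] [Ha' Hb'].
assert (Hex : forall a b, 0 < a -> 0 < b -> ex_RInt F a b)
  by (intros; now apply ex_RInt_pos).
replace (minus (RInt F a b) (RInt F a' b')) with (plus (RInt F a a') (RInt F b' b)).
- eapply Rle_lt_trans; [apply norm_plus_le|].
  specialize (G1' a a' Ha Ha'). specialize (G2' b' b Hb' Hb). lra.
- rewrite <- (RInt_Chasles (V := X) F a a' b) by (apply Hex; lra).
  rewrite <- (RInt_Chasles (V := X) F a' b' b) by (apply Hex; lra). vring X.
Qed.

(** The first bound is integrated up to [t], the second beyond it. The choice of [t] balances the
    two and later produces the right powers of time. *)
Lemma imp_norm_le p q C1 C2 F I t :
  0 < p -> 0 < q -> power_bounds p q C1 C2 F -> is_imp F I -> 0 < t ->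
  norm I <= C1 * (Rpower t p / p) + C2 * (Rpower t (- q) / q).
Proof.
intros Hp Hq [H1 H2] [HF HI] Ht.
replace I with (minus I zero) by vring X.
apply (norm_lim_le (F := zero_infinity) HI).
generalize (zero_infinity_between t Ht). apply filter_imp.
intros [a b]; simpl. intros [Ha Hb].
apply Rle_trans with (norm (RInt F a b)).
{ right. f_equal. vring X. }
rewrite <- (RInt_Chasles (V := X) F a t b) by (apply ex_RInt_pos; auto; lra).
eapply Rle_trans; [apply norm_plus_le|]. apply Rplus_le_compat.
- apply RInt_zero_le; auto; lra.
- apply RInt_infinity_le; auto; lra.
Qed.

End Improper.

Lemma is_imp_scal_vec (X : CompleteNormedModule R_AbsRing) (k : R -> R) (I : R) (x : X) :
  is_imp (X := R_CompleteNormedModule) k I -> is_imp (fun t => scal (k t) x) (scal I x).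
Proof.
intros [Hk HI]. split.
- intros t Ht. apply continuous_scalX; auto. apply continuous_const.
- intros e He. assert (Hx := norm_ge0 x).
  generalize (filter_and _ _ (zero_infinity_between 1 Rlt_0_1)
    (HI (e / (norm x + 1)) ltac:(apply Rdiv_lt_0_compat; lra))).
  apply filter_imp. intros [a b]; simpl. intros [[Ha Hb] H].
  replace (RInt (fun t => scal (k t) x) a b) with (scal (RInt k a b) x).
  + replace (minus _ _) with (scal (RInt k a b - I) x) by vring X.
    rewrite norm_scalR.
    change (Rabs (RInt k a b - I) < e / (norm x + 1)) in H.
    apply Rle_lt_trans with (Rabs (RInt k a b - I) * (norm x + 1)).
    * apply Rmult_le_compat_l; [apply Rabs_pos|lra].
    * apply Rlt_le_trans with (e / (norm x + 1) * (norm x + 1)); [|right; field; lra].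
      apply Rmult_lt_compat_r; lra.
  + symmetry. apply (is_RInt_unique (V := X)). apply is_RInt_scal_vec.
    apply (@RInt_correct R_CompleteNormedModule).
    apply ex_RInt_pos; auto; lra.
Qed.

(** Serves to show that Gamma(a) and the beta constant are positive, through their mass on
    [1, 2]. *)
Lemma is_imp_ge (k : R -> R) (I m : R) :
  is_imp (X := R_CompleteNormedModule) k I -> (forall t, 0 < t -> 0 <= k t) ->
  (forall t, 1 <= t <= 2 -> m <= k t) -> m <= I.
Proof.
intros [Hk HI] H0 Hm. apply le_epsilon. intros e He.
destruct (filter_ex _ (filter_and _ _ (zero_infinity_between (d := 1) 2 Rlt_0_1)
  (HI e He))) as [[a b] [[Ha Hb] H]]. simpl in *.
change (Rabs (RInt k a b - I) < e) in H.
assert (Hex : forall a b, 0 < a -> 0 < b -> ex_RInt k a b).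
{ intros. now apply (ex_RInt_pos (X := R_CompleteNormedModule)). }
assert (E1 : RInt k a b = RInt k a 1 + (RInt k 1 2 + RInt k 2 b)).
{ assert (G1 := RInt_Chasles (V := R_CompleteNormedModule) k a 1 b
    (Hex a 1 ltac:(lra) ltac:(lra)) (Hex 1 b ltac:(lra) ltac:(lra))).
  assert (G2 := RInt_Chasles (V := R_CompleteNormedModule) k 1 2 b
    (Hex 1 2 ltac:(lra) ltac:(lra)) (Hex 2 b ltac:(lra) ltac:(lra))).
  rewrite <- G1, <- G2. reflexivity. }
assert (P1 : 0 <= RInt k a 1).
{ apply RInt_ge_0; [lra|apply Hex; lra|]. intros t Ht. apply H0; lra. }
assert (P2 : 0 <= RInt k 2 b).
{ apply RInt_ge_0; [lra|apply Hex; lra|]. intros t Ht. apply H0; lra. }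
assert (P3 : m <= RInt k 1 2).
{ replace m with (RInt (fun _ => m) 1 2).
  - apply RInt_le; [lra|apply ex_RInt_const|apply Hex; lra|]. intros t Ht. apply Hm; lra.
  - rewrite RInt_const. unfold scal; simpl; unfold mult; simpl. ring. }
split_Rabs; lra.
Qed.

(** * Fractional powers *)

(* B is A^{-1}; the last clause says |A E(t)| <= C / t. *)
Record analytic_semigroup (X : CompleteNormedModule R_AbsRing) (E : R -> X -> X)
    (B : X -> X) (MB M C : R) : Prop := AnalyticSemigroup {
  as_semigroup : c0_semigroup E;
  as_linear : bounded_linear B MB;
  as_inverse : generator_inverse E B;
  as_injective : forall x, B x = zero -> x = zero;
  as_M : 1 <= M;
  as_C : 0 < C;
  as_bounded : forall t x, 0 <= t -> norm (E t x) <= M * norm x;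
  as_decay : forall t y, 0 < t -> t * norm (E t y) <= C * norm (B y);
  as_smoothing : forall t x, 0 < t ->
    exists v, B v = E t x /\ t * norm v <= C * norm x
}.

Lemma sectorial_analytic (X : CompleteNormedModule R_AbsRing) (A : operator X)
    (E : R -> X -> X) :
  sectorial A -> densely_defined A -> (forall lam : C, spectrum A lam -> 0 < Re lam) ->
  semigroup_generated_by_opp A E ->
  exists B MB M C, analytic_semigroup E B MB M C.
Proof.
intros Asect Adense Aspec (G1 & G2 & G3 & G4 & G5).
assert (HE : c0_semigroup E) by now split.
destruct (inverse_exists Asect Aspec) as (B & MB & HB & HAB & HBA).
destruct (resolvent_estimate Asect Aspec) as (K & HK & HR).
assert (Hgen : forall x, dom A x -> filterlim (fun t => scal (/ t) (minus (E t x) x))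
  (at_right 0) (locally (opp (app A x)))).
{ intros x Hx. now apply (proj2 (G5 x _)). }
assert (Hcomm : forall t y, 0 <= t -> E t (B y) = B (E t y)).
{ intros t y Ht. destruct (HAB y) as [Hd Ha].
  assert (H := Hgen (B y) Hd). rewrite Ha in H.
  destruct (E_bl HE Ht) as [Mt HMt].
  (* [E t] carries the difference quotient at [B y] to that at [E t (B y)], so the converse clause
     of the generator puts the latter into the domain of A. *)
  assert (H' : filterlim (fun h => scal (/ h) (minus (E h (E t (B y))) (E t (B y))))
    (at_right 0) (locally (opp (E t y)))).
  { rewrite <- (bl_opp _ HMt).
    apply (filterlim_ext_loc (fun h => E t (scal (/ h) (minus (E h (B y)) (B y))))).
    - exists (mkposreal 1 Rlt_0_1). intros h _ Hh.
      rewrite (E_scal HE), (E_minus HE) by lra.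
      rewrite <- !(E_add HE) by lra. now rewrite (Rplus_comm t h).
    - apply (filterlim_eps (F := at_right 0)). intros e He.
      apply (bl_lim (F := at_right 0) HMt); auto.
      now apply (filterlim_eps (F := at_right 0)). }
  apply G5 in H'. destruct H' as [Hd' Ha'].
  assert (E1 : app A (E t (B y)) = E t y).
  { replace (app A (E t (B y))) with (opp (opp (app A (E t (B y))))) by vring X.
    rewrite <- Ha'. vring X. }
  rewrite <- E1. symmetry. now apply HBA. }
assert (HI : generator_inverse E B).
{ split; auto. intros y e He. destruct (HAB y) as [Hd Ha].
  assert (H := Hgen (B y) Hd). rewrite Ha in H.
  destruct (proj1 (filterlim_eps (F := at_right 0) _ _) H e He) as [d Hd'].
  exists d. split; [apply cond_pos|]. intros h Hh.
  specialize (Hd' h). assert (Hb : ball 0 d h).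
  { unfold ball; simpl; unfold AbsRing_ball, abs, minus, plus, opp; simpl.
    rewrite Ropp_0, Rplus_0_r, Rabs_pos_eq; lra. }
  specialize (Hd' Hb ltac:(lra)).
  replace (plus (minus (E h (B y)) (B y)) (scal h y)) with
    (scal h (minus (scal (/ h) (minus (E h (B y)) (B y))) (opp y))) by (vfield X; lra).
  rewrite norm_scalR, Rabs_pos_eq by lra. rewrite Rmult_comm.
  apply Rmult_le_compat_r; [lra|left; exact Hd']. }
assert (Hres : forall p q x y, 0 <= p ->
  (p + Rabs q) * (norm (B x) + norm (B y)) <=
  K * (norm (plus (minus (scal p (B x)) (scal q (B y))) x) +
       norm (plus (plus (scal p (B y)) (scal q (B x))) y))).
{ intros p q x y Hp. destruct (HAB x) as [H1 H2], (HAB y) as [H3 H4].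
  specialize (HR p q (B x) (B y) Hp H1 H3). unfold shifted in HR.
  now rewrite H2, H4 in HR. }
destruct (semigroup_bounded HE HB HI HK Hres) as (M & HM & Hbd).
destruct (semigroup_smoothing HE HB HI HK Hres) as (C & HC & Hsm).
exists B, MB, M, C. split; auto.
{ intros x Hx. transitivity (app A (B x)); [symmetry; apply HAB|].
  rewrite Hx. transitivity (app A (B zero)); [now rewrite (bl_zero HB)|apply HAB]. }
intros t x Ht.
(* By density [B (y n)] tends to [x], and the smoothing estimate makes [E t (y n)] a Cauchy
   sequence; its limit is A E(t) x. *)
assert (Hseq : forall n : nat, exists y, norm (minus (B y) x) < / (INR n + 1)).
{ intros n. destruct (Adense x (/ (INR n + 1))) as [z [Hz1 Hz2]].
  - apply Rinv_0_lt_compat. pose proof (pos_INR n); lra.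
  - exists (app A z). now rewrite HBA. }
pose (y := fun n => proj1_sig (constructive_indefinite_description _ (Hseq n))).
assert (Hy : forall n : nat, norm (minus (B (y n)) x) < / (INR n + 1)).
{ intros n. unfold y. now destruct (constructive_indefinite_description _ _). }
clearbody y.
assert (HBy : forall e, 0 < e -> exists n0, forall n, (n0 <= n)%nat ->
  norm (minus (B (y n)) x) < e).
{ intros e He. destruct (archimed_cor1 e He) as [n0 [Hn0 Hn0']].
  exists n0. intros n Hn. eapply Rlt_trans; [apply Hy|].
  eapply Rle_lt_trans; [|exact Hn0]. apply Rinv_le_contravar.
  - now apply lt_0_INR.
  - apply le_INR in Hn. lra. }
destruct (cauchy_seq_lim (v := fun n => E t (y n))) as [v Hv].
{ intros e He. destruct (HBy (e * t / (2 * C))) as [n0 Hn0].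
  { apply Rdiv_lt_0_compat; nra. }
  exists n0. intros n m Hn Hm.
  rewrite <- (E_minus HE) by lra.
  specialize (Hsm t (minus (y n) (y m)) Ht).
  rewrite (bl_minus _ _ HB) in Hsm.
  assert (Hd : norm (minus (B (y n)) (B (y m))) < e * t / C).
  { eapply Rle_lt_trans; [apply (norm_minus_tri _ x)|].
    rewrite (norm_minus_sym x). pose proof (Hn0 n Hn). pose proof (Hn0 m Hm).
    replace (e * t / C) with (e * t / (2 * C) + e * t / (2 * C)) by (field; lra). lra. }
  apply (Rmult_lt_reg_l t); auto. eapply Rle_lt_trans; [exact Hsm|].
  apply (Rmult_lt_compat_l C) in Hd; auto.
  replace (C * (e * t / C)) with (t * e) in Hd by (field; lra). exact Hd. }
exists v. split.
- apply norm_small_eq. intros e He.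
  destruct (E_bl HE (Rlt_le _ _ Ht)) as [Mt HMt].
  apply (norm_lim_le (F := eventually) (f := fun n => B (E t (y n)))).
  + intros e' He'. apply (bl_lim (F := eventually) HB Hv He').
  + destruct (bl_lim (F := eventually) HMt HBy He) as [n0 Hn0].
    exists n0. intros n Hn. specialize (Hn0 n Hn). rewrite Hcomm in Hn0 by lra. lra.
- assert (Hv' : norm v <= C * norm x / t).
  { apply le_epsilon. intros e He.
    destruct (Hv (e / 2) ltac:(lra)) as [n1 Hn1].
    destruct (HBy (e * t / (2 * C))) as [n2 Hn2].
    { apply Rdiv_lt_0_compat; nra. }
    set (n := max n1 n2). specialize (Hn1 n ltac:(lia)). specialize (Hn2 n ltac:(lia)).
    specialize (Hsm t (y n) Ht).
    assert (Hb : norm (B (y n)) <= norm x + e * t / (2 * C)).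
    { eapply Rle_trans; [apply (norm_le_minus _ x)|]. lra. }
    assert (Hn : norm (E t (y n)) <= C * norm x / t + e / 2).
    { apply (Rmult_le_reg_l t); auto. eapply Rle_trans; [exact Hsm|].
      apply (Rmult_le_compat_l C) in Hb; [|lra]. eapply Rle_trans; [exact Hb|].
      right. field. lra. }
    rewrite norm_minus_sym in Hn1. pose proof (norm_le_minus v (E t (y n))). lra. }
  apply (Rmult_le_compat_l t) in Hv'; [|lra].
  replace (t * (C * norm x / t)) with (C * norm x) in Hv' by (field; lra). exact Hv'.
Qed.

Section FractionalIntegral.

Variable X : CompleteNormedModule R_AbsRing.
Implicit Types x y z v : X.
Variables (E : R -> X -> X) (B : X -> X) (MB M C : R).
Hypothesis HA : analytic_semigroup E B MB M C.

Let HE := as_semigroup HA.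
Let HB := as_linear HA.
Let HI := as_inverse HA.

Lemma decay_norm t x : 0 < t -> t * norm (E t x) <= C * MB * norm x.
Proof.
intros Ht. eapply Rle_trans; [apply (as_decay HA); auto|].
rewrite Rmult_assoc. apply Rmult_le_compat_l; [left; apply (as_C HA)|]. apply HB.
Qed.

Definition frac_kernel (a : R) x (t : R) : X := scal (Rpower t (a - 1)) (Epos E t x).

(* Gamma(a) A^{-a}, for 0 < a < 1. *)
Definition frac_integral (a : R) x : X :=
  RInt_gen (fun t => scal (Rpower t (a - 1)) (E t x)) (at_right 0) (Rbar_locally p_infty).

Lemma frac_kernel_continuous a x t : 0 < t -> continuous (frac_kernel a x) t.
Proof.
intros Ht. apply continuous_scalX; [now apply continuous_Rpower|].
now apply Epos_continuous.
Qed.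

Lemma frac_kernel_bounds a x a1 a2 :
  (forall t, 0 < t -> norm (E t x) <= a1) ->
  (forall t, 0 < t -> t * norm (E t x) <= a2) ->
  power_bounds a (1 - a) a1 a2 (frac_kernel a x).
Proof.
intros H1 H2. split; intros t Ht; unfold frac_kernel;
  rewrite norm_scalR, (@Epos_eq X), Rabs_pos_eq by (try lra; left; apply Rpower_pos).
- rewrite Rmult_comm. apply Rmult_le_compat_r; auto. left; apply Rpower_pos.
- specialize (H2 t Ht).
  replace (Rpower t (a - 1)) with (Rpower t (- (1 - a) - 1) * t).
  + rewrite Rmult_assoc, Rmult_comm. apply Rmult_le_compat_r; auto.
    left; apply Rpower_pos.
  + rewrite <- (Rpower_1 t) at 2 by auto. rewrite <- Rpower_plus. f_equal; ring.
Qed.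

Lemma frac_integral_imp a x : 0 < a < 1 -> is_imp (frac_kernel a x) (frac_integral a x).
Proof.
intros Ha.
destruct (imp_exists (X := X) (p := a) (q := 1 - a) (C1 := M * norm x)
  (C2 := C * MB * norm x) (F := frac_kernel a x)) as [I HI']; try lra.
- intros; now apply frac_kernel_continuous.
- apply frac_kernel_bounds.
  + intros t Ht. apply (as_bounded HA). lra.
  + intros t Ht. now apply decay_norm.
- replace (frac_integral a x) with I; auto.
  symmetry. apply (is_imp_RInt_gen HI'). intros t Ht. unfold frac_kernel.
  now rewrite (@Epos_eq X) by lra.
Qed.

(** [a1], [a2] and the splitting time are left open because the bound is needed for vectors of the
    form A E(t) x, whose own bounds depend on that [t]. *)
Lemma frac_integral_le a x a1 a2 t : 0 < a < 1 -> 0 < t ->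
  (forall s, 0 < s -> norm (E s x) <= a1) ->
  (forall s, 0 < s -> s * norm (E s x) <= a2) ->
  norm (frac_integral a x) <=
  a1 * (Rpower t a / a) + a2 * (Rpower t (- (1 - a)) / (1 - a)).
Proof.
intros Ha Ht H1 H2.
apply (imp_norm_le (p := a) (q := 1 - a) (F := frac_kernel a x)); try lra.
- now apply frac_kernel_bounds.
- now apply frac_integral_imp.
Qed.

Lemma frac_integral_bl a : 0 < a < 1 ->
  exists Ma, bounded_linear (frac_integral a) Ma.
Proof.
intros Ha. exists (M * / a + C * MB * / (1 - a)).
assert (HMB := proj1 HB). assert (HC := as_C HA). assert (HM := as_M HA).
split; [|split; [|split]].
- apply Rplus_le_le_0_compat; apply Rmult_le_pos; try nra;
  left; apply Rinv_0_lt_compat; lra.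
- intros x y. apply (is_imp_unique (F := frac_kernel a (plus x y))).
  + now apply frac_integral_imp.
  + apply (is_imp_ext (F := fun t => plus (frac_kernel a x t) (frac_kernel a y t))).
    * intros t Ht. unfold frac_kernel. rewrite !(@Epos_eq X), (E_plus HE) by lra. vring X.
    * apply is_imp_plus; now apply frac_integral_imp.
- intros k x. apply (is_imp_unique (F := frac_kernel a (scal k x))).
  + now apply frac_integral_imp.
  + apply (is_imp_ext (F := fun t => scal k (frac_kernel a x t))).
    * intros t Ht. unfold frac_kernel. rewrite !(@Epos_eq X), (E_scal HE) by lra. vring X.
    * apply is_imp_scal. now apply frac_integral_imp.
- intros x. eapply Rle_trans.
  + apply (@frac_integral_le a x (M * norm x) (C * MB * norm x) 1); auto; try lra.
    * intros s Hs. apply (as_bounded HA). lra.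
    * intros s Hs. now apply decay_norm.
  + assert (H1 : forall p, Rpower 1 p = 1).
    { intros p. unfold Rpower. now rewrite ln_1, Rmult_0_r, exp_0. }
    rewrite !H1. unfold Rdiv. right. ring.
Qed.

Lemma frac_integral_commute a t x : 0 < a < 1 -> 0 <= t ->
  E t (frac_integral a x) = frac_integral a (E t x).
Proof.
intros Ha Ht. destruct (E_bl HE Ht) as [Mt HMt].
apply (is_imp_unique (F := frac_kernel a (E t x))).
- apply (is_imp_ext (F := fun s => E t (frac_kernel a x s))).
  + intros s Hs. unfold frac_kernel. rewrite !(@Epos_eq X), (E_scal HE) by lra.
    rewrite <- !(E_add HE) by lra. now rewrite Rplus_comm.
  + apply (is_imp_bl HMt). now apply frac_integral_imp.
- now apply frac_integral_imp.
Qed.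

Lemma E_B_lipschitz t r y : 0 <= t -> t <= r ->
  norm (minus (E r (B y)) (E t (B y))) <= (r - t) * (M * norm y).
Proof.
intros Ht Htr. rewrite (E_B_increment HE HI y Ht Htr), norm_oppE.
apply norm_RInt_const; auto.
- apply ex_RInt_cont. intros s. now apply Epos_continuous.
- intros s Hs. rewrite (@Epos_eq X) by lra. apply (as_bounded HA). lra.
Qed.

(** Writing E(t) = E(m/2) E(t - m/2) and using the decay of both factors shows that A E(t) y is of
    order |y| / m^2; the Lipschitz bound for orbits of the range of B then applies. *)
Lemma E_lipschitz m t r y : 0 < m -> m <= t -> m <= r ->
  norm (minus (E r y) (E t y)) <= 4 * M * C * C * MB / m ^ 2 * norm y * Rabs (r - t).
Proof.
intros Hm Ht Hr.
assert (HM := as_M HA). assert (HC := as_C HA). assert (HMB := proj1 HB).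
assert (G : forall t r, m <= t -> t <= r ->
  norm (minus (E r y) (E t y)) <= 4 * M * C * C * MB / m ^ 2 * norm y * (r - t)).
{ clear t r Ht Hr. intros t r Ht Hr.
  destruct (as_smoothing HA (t := m / 2) (E (t - m / 2) y)) as [v [Hv1 Hv2]]; [lra|].
  rewrite <- (E_add HE) in Hv1 by lra. replace (m / 2 + (t - m / 2)) with t in Hv1 by ring.
  assert (Hn : norm (E (t - m / 2) y) <= 2 * C * MB / m * norm y).
  { assert (H := @decay_norm (t - m / 2) y ltac:(lra)).
    assert (H' : m / 2 * norm (E (t - m / 2) y) <= C * MB * norm y).
    { eapply Rle_trans; [|exact H]. apply Rmult_le_compat_r; [apply norm_ge0|lra]. }
    apply (Rmult_le_reg_l (m / 2)); [lra|]. eapply Rle_trans; [exact H'|].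
    right. field. lra. }
  assert (Hnv : norm v <= 4 * C * C * MB / m ^ 2 * norm y).
  { apply (Rmult_le_reg_l (m / 2)); [lra|]. eapply Rle_trans; [exact Hv2|].
    apply (Rmult_le_compat_l C) in Hn; [|lra]. eapply Rle_trans; [exact Hn|].
    right. field. lra. }
  replace (E r y) with (E (r - t) (E t y))
    by (rewrite <- (E_add HE) by lra; f_equal; ring).
  rewrite <- Hv1.
  assert (H := @E_B_lipschitz 0 (r - t) v ltac:(lra) ltac:(lra)).
  rewrite (E_zero HE) in H. eapply Rle_trans; [exact H|].
  replace (4 * M * C * C * MB / m ^ 2 * norm y * (r - t)) with
    ((r - t - 0) * (M * (4 * C * C * MB / m ^ 2 * norm y))) by (field; lra).
  apply Rmult_le_compat_l; [lra|]. apply Rmult_le_compat_l; lra. }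
destruct (Rle_or_lt t r).
- rewrite Rabs_pos_eq by lra. now apply G.
- rewrite norm_minus_sym, Rabs_left by lra. replace (- (r - t)) with (t - r) by ring.
  apply G; lra.
Qed.

(** A Taylor remainder of second order. The quotient of |r - t|^2 by m^2 is invariant under scaling
    of time, which keeps the remainder uniform in the scaled integrals below. *)
Lemma E_B_remainder m t r y : 0 < m -> m <= t -> m <= r ->
  norm (plus (minus (E r (B y)) (E t (B y))) (scal (r - t) (E t y))) <=
  4 * M * C * C * MB / m ^ 2 * norm y * Rabs (r - t) ^ 2.
Proof.
intros Hm Ht Hr.
set (L := 4 * M * C * C * MB / m ^ 2 * norm y).
assert (Hc : forall s, continuous (fun s => Epos E s y) s)
  by (intros; now apply Epos_continuous).
assert (Hex : forall a b, ex_RInt (fun s => Epos E s y) a b)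
  by (intros; now apply ex_RInt_cont).
assert (E1 : plus (minus (E r (B y)) (E t (B y))) (scal (r - t) (E t y)) =
  opp (RInt (fun s => minus (Epos E s y) (E t y)) t r)).
{ rewrite (RInt_minus (V := X)), RInt_const by (auto; apply ex_RInt_const).
  destruct (Rle_or_lt t r).
  - rewrite (E_B_increment HE HI y (t := t) (r := r)) by lra. vring X.
  - replace (minus (E r (B y)) (E t (B y))) with (opp (minus (E t (B y)) (E r (B y))))
      by vring X.
    rewrite (E_B_increment HE HI y (t := r) (r := t)) by lra.
    rewrite <- (opp_RInt_swap (V := X) _ t r) by auto. vring X. }
rewrite E1, norm_oppE.
replace (L * Rabs (r - t) ^ 2) with (Rabs (r - t) * (L * Rabs (r - t))) by ring.
apply (norm_RInt_le_const_abs (fun s => minus (Epos E s y) (E t y)) t r).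
- intros s Hs.
  assert (Hms : m <= s) by (destruct Hs as [Hs _]; revert Hs; apply Rmin_case; lra).
  rewrite (@Epos_eq X) by lra.
  eapply Rle_trans; [apply (@E_lipschitz m); auto|]. fold L.
  apply Rmult_le_compat_l.
  + assert (H := @E_lipschitz m (m + 1) m y Hm ltac:(lra) (Rle_refl m)). fold L in H.
    replace (m - (m + 1)) with (-1) in H by ring. rewrite Rabs_left in H by lra.
    pose proof (norm_ge0 (minus (E m y) (E (m + 1) y))). lra.
  + revert Hs. unfold Rmin, Rmax. destruct (Rle_dec t r); split_Rabs; lra.
- apply (RInt_correct (V := X)). apply ex_RInt_cont. intros s.
  apply continuous_minusX; auto. apply continuous_const.
Qed.

Section Reflection.

Variable a : R.
Hypothesis Ha : 0 < a < 1.

(** Its integral over the half line is the beta integral B(1 - a, a) = pi / sin(pi a); what enters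
    below is that it is positive. *)
Definition beta_kernel (r : R) : R := Rpower r (- a) * / (1 + r).

Lemma beta_kernel_pos r : 0 < r -> 0 < beta_kernel r.
Proof.
intros Hr. apply Rmult_lt_0_compat; [apply Rpower_pos|].
apply Rinv_0_lt_compat; lra.
Qed.

Lemma beta_kernel_continuous r : 0 < r -> continuous beta_kernel r.
Proof.
intros Hr. apply continuous_R_mult; [now apply continuous_Rpower|].
apply (@ex_derive_continuous R_AbsRing R_NormedModule). auto_derive. lra.
Qed.

Lemma beta_kernel_le1 r : 0 < r -> beta_kernel r <= Rpower r (1 - a - 1).
Proof.
intros Hr. unfold beta_kernel. replace (1 - a - 1) with (- a) by ring.
rewrite <- (Rmult_1_r (Rpower r (- a))) at 2. apply Rmult_le_compat_l.
- left; apply Rpower_pos.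
- rewrite <- Rinv_1. apply Rinv_le_contravar; lra.
Qed.

Lemma beta_kernel_le2 r : 0 < r -> beta_kernel r <= Rpower r (- a - 1).
Proof.
intros Hr. unfold beta_kernel.
replace (Rpower r (- a - 1)) with (Rpower r (- a) * / r).
- apply Rmult_le_compat_l; [left; apply Rpower_pos|]. apply Rinv_le_contravar; lra.
- rewrite <- (Rpower_1 r) at 2 by auto. rewrite <- Rpower_Ropp, <- Rpower_plus.
  f_equal; ring.
Qed.

Lemma beta_bounds c (F : R -> X) : (forall r, 0 < r -> norm (F r) <= c * beta_kernel r) ->
  power_bounds (1 - a) a c c F.
Proof.
intros H. assert (Hc : 0 <= c).
{ specialize (H 1 Rlt_0_1). pose proof (norm_ge0 (F 1)).
  pose proof (beta_kernel_pos Rlt_0_1). nra. }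
split; intros r Hr; (eapply Rle_trans; [now apply H|]); apply Rmult_le_compat_l; auto.
- now apply beta_kernel_le1.
- now apply beta_kernel_le2.
Qed.

Lemma beta_exists : exists kappa, 0 < kappa /\
  is_imp (X := R_CompleteNormedModule) beta_kernel kappa.
Proof.
destruct (imp_exists (X := R_CompleteNormedModule) (p := 1 - a) (q := a) (C1 := 1) (C2 := 1)
  (F := beta_kernel)) as [k Hk]; try lra.
- intros; now apply beta_kernel_continuous.
- split; intros r Hr; change (norm (beta_kernel r)) with (Rabs (beta_kernel r));
  rewrite Rabs_pos_eq, Rmult_1_l by (left; now apply beta_kernel_pos).
  + now apply beta_kernel_le1.
  + now apply beta_kernel_le2.
- exists k. split; auto. apply Rlt_le_trans with (Rpower 2 (- a) * / 3).
  + apply Rmult_lt_0_compat; [apply Rpower_pos|lra].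
  + apply (is_imp_ge Hk).
    * intros t Ht. left. now apply beta_kernel_pos.
    * intros t Ht. apply Rmult_le_compat; [left; apply Rpower_pos|lra| |].
      -- rewrite !Rpower_Ropp. apply Rinv_le_contravar; [apply Rpower_pos|].
         apply Rle_Rpower_l; lra.
      -- apply Rinv_le_contravar; lra.
Qed.

Definition beta_orbit y (s r : R) : X :=
  scal (beta_kernel r) (Epos E (s * (1 + r)) (B y)).

Lemma Epos_affine_continuous s y r : continuous (fun r => Epos E (s * (1 + r)) y) r.
Proof.
apply (continuous_comp (fun r => s * (1 + r)) (fun t => Epos E t y)).
- apply (@ex_derive_continuous R_AbsRing R_NormedModule). auto_derive. auto.
- now apply Epos_continuous.
Qed.

Lemma beta_orbit_exists y s : 0 < s -> exists I, is_imp (beta_orbit y s) I.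
Proof.
intros Hs.
apply (imp_exists (p := 1 - a) (q := a) (C1 := M * norm (B y)) (C2 := M * norm (B y))); try lra.
- intros t Ht. apply continuous_scalX; [now apply beta_kernel_continuous|].
  apply Epos_affine_continuous.
- apply beta_bounds. intros r Hr. unfold beta_orbit.
  rewrite norm_scalR, Rabs_pos_eq by (left; now apply beta_kernel_pos).
  rewrite Rmult_comm. apply Rmult_le_compat_r; [left; now apply beta_kernel_pos|].
  rewrite (@Epos_eq X) by nra. apply (as_bounded HA). nra.
Qed.

(** The substitution t = s r in I_{1-a} contributes s times s^{-a}, which the prefactor s^{a-1}
    cancels. *)
Lemma frac_orbit_imp y s : 0 < s ->
  is_imp (fun r => scal (Rpower r (- a)) (Epos E (s * (1 + r)) y))
    (scal (Rpower s (a - 1)) (Epos E s (frac_integral (1 - a) y))).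
Proof.
intros Hs.
assert (H := @frac_integral_imp (1 - a) y ltac:(lra)).
destruct (E_bl HE (Rlt_le _ _ Hs)) as [Ms HMs].
apply (is_imp_bl HMs) in H. apply (is_imp_scale Hs) in H.
apply (is_imp_scal (Rpower s (a - 1))) in H.
rewrite (@Epos_eq X) by lra.
refine (is_imp_ext _ H). intros r Hr. unfold frac_kernel.
assert (0 < s * r) by nra.
rewrite !(@Epos_eq X) by nra. rewrite (E_scal HE) by lra.
rewrite <- (E_add HE) by lra.
replace (s * (1 + r)) with (s + s * r) by ring.
replace (1 - a - 1) with (- a) by ring.
rewrite <- Rpower_mult_distr by auto.
assert (E1 : Rpower s (a - 1) * s * Rpower s (- a) = 1).
{ rewrite <- (Rpower_1 s) at 2 by auto. rewrite <- !Rpower_plus.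
  replace (a - 1 + 1 + - a) with 0 by ring. now apply Rpower_O. }
vcoefs X.
replace (Rpower s (a - 1) * (s * (Rpower s (- a) * Rpower r (- a) * 1))) with
  (Rpower s (a - 1) * s * Rpower s (- a) * (Rpower r (- a) * 1)) by ring.
rewrite E1. ring.
Qed.

(** Differentiation under the integral: the derivative of E(s(1+r)) B y in s brings out a factor 1 +
    r that cancels the denominator of the kernel. The remainder is estimated from the time
    (s/2)(1+r) on, so the factors (1+r)^2 cancel as well and a multiple of the kernel is an
    integrable majorant. *)
Lemma beta_orbit_integral_derive y (H : R -> X) :
  (forall s, 0 < s -> is_imp (beta_orbit y s) (H s)) ->
  forall s, 0 < s -> is_derive H s
    (opp (scal (Rpower s (a - 1)) (Epos E s (frac_integral (1 - a) y)))).
Proof.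
intros HH s Hs.
set (T := scal (Rpower s (a - 1)) (Epos E s (frac_integral (1 - a) y))).
set (L := 4 * M * C * C * MB / (s / 2) ^ 2 * norm y).
assert (HM := as_M HA). assert (HC := as_C HA). assert (HMB := proj1 HB).
assert (HL : 0 <= L).
{ unfold L. apply Rmult_le_pos; [|apply norm_ge0].
  apply Rdiv_le_0_compat; [|apply pow_lt; lra].
  repeat apply Rmult_le_pos; lra. }
set (L' := L * (/ (1 - a) + / a)).
assert (HL' : 0 <= L').
{ apply Rmult_le_pos; auto. apply Rplus_le_le_0_compat; left; apply Rinv_0_lt_compat; lra. }
assert (G : forall r, s / 2 <= r ->
  norm (plus (minus (H r) (H s)) (scal (r - s) T)) <= L' * Rabs (r - s) ^ 2).
{ intros r Hr.
  assert (Hi : is_imp (fun q => plus (minus (beta_orbit y r q) (beta_orbit y s q))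
    (scal (r - s) (scal (Rpower q (- a)) (Epos E (s * (1 + q)) y))))
    (plus (minus (H r) (H s)) (scal (r - s) T))).
  { apply is_imp_plus.
    - apply is_imp_minus; apply HH; lra.
    - apply is_imp_scal. now apply frac_orbit_imp. }
  assert (Hb : power_bounds (1 - a) a (L * Rabs (r - s) ^ 2) (L * Rabs (r - s) ^ 2)
    (fun q => plus (minus (beta_orbit y r q) (beta_orbit y s q))
    (scal (r - s) (scal (Rpower q (- a)) (Epos E (s * (1 + q)) y))))).
  { apply beta_bounds. intros q Hq. unfold beta_orbit.
    rewrite !(@Epos_eq X) by nra.
    replace (plus _ _) with (scal (beta_kernel q) (plus (minus (E (r * (1 + q)) (B y))
      (E (s * (1 + q)) (B y))) (scal (r * (1 + q) - s * (1 + q)) (E (s * (1 + q)) y)))).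
    2:{ vcoefs X; try ring. unfold beta_kernel. field. lra. }
    rewrite norm_scalR, Rabs_pos_eq by (left; now apply beta_kernel_pos).
    rewrite Rmult_comm. apply Rmult_le_compat_r; [left; now apply beta_kernel_pos|].
    eapply Rle_trans.
    { apply (@E_B_remainder (s / 2 * (1 + q))); nra. }
    replace (r * (1 + q) - s * (1 + q)) with ((r - s) * (1 + q)) by ring.
    rewrite Rabs_mult, (Rabs_pos_eq (1 + q)) by lra.
    right. unfold L. field. lra. }
  assert (Hn := imp_norm_le (p := 1 - a) (q := a) (t := 1) ltac:(lra) ltac:(lra) Hb Hi Rlt_0_1).
  assert (H1 : forall p, Rpower 1 p = 1).
  { intros p. unfold Rpower. now rewrite ln_1, Rmult_0_r, exp_0. }
  rewrite !H1 in Hn. eapply Rle_trans; [exact Hn|]. right. unfold L'. field. lra. }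
apply is_derive_eps. intros e He.
exists (Rmin (s / 2) (e / (L' + 1))). split.
{ apply Rmin_pos; [lra|]. apply Rdiv_lt_0_compat; lra. }
intros r Hr.
assert (Hr1 : Rabs (r - s) < s / 2) by (eapply Rlt_le_trans; [exact Hr|apply Rmin_l]).
assert (Hr2 : Rabs (r - s) < e / (L' + 1)) by (eapply Rlt_le_trans; [exact Hr|apply Rmin_r]).
replace (minus (minus (H r) (H s)) (scal (r - s) (opp T))) with
  (plus (minus (H r) (H s)) (scal (r - s) T)) by vring X.
eapply Rle_trans; [apply G; split_Rabs; lra|].
pose proof (Rabs_pos (r - s)).
replace (L' * Rabs (r - s) ^ 2) with (L' * Rabs (r - s) * Rabs (r - s)) by ring.
apply Rmult_le_compat_r; auto.
apply (Rmult_lt_compat_l (L' + 1)) in Hr2; [|lra].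
replace ((L' + 1) * (e / (L' + 1))) with e in Hr2 by (field; lra). nra.
Qed.

(* [s^{a-1} E(s) I_{1-a} y] is minus the derivative of
   [H(s) = int_0^oo r^{-a} (1+r)^{-1} E(s(1+r)) B y dr], which runs from
   [kappa B y] at [0] to [0] at infinity. *)
Lemma frac_integral_reflection : exists kappa, 0 < kappa /\
  forall y, frac_integral a (frac_integral (1 - a) y) = scal kappa (B y).
Proof.
destruct beta_exists as (kappa & Hk & Hkappa).
exists kappa. split; auto. intros y.
set (D := frac_integral (1 - a) y).
assert (HM := as_M HA). assert (HC := as_C HA). assert (HMB := proj1 HB).
assert (Hex : forall s, exists I, 0 < s -> is_imp (beta_orbit y s) I).
{ intros s. destruct (Rlt_or_le 0 s) as [Hs|Hs].
  - destruct (@beta_orbit_exists y s Hs) as [I HI']. now exists I.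
  - exists zero. intros; lra. }
pose (H := fun s => proj1_sig (constructive_indefinite_description _ (Hex s))).
assert (HH : forall s, 0 < s -> is_imp (beta_orbit y s) (H s)).
{ intros s. unfold H. now destruct (constructive_indefinite_description _ _). }
clearbody H.
assert (HRI : forall p q, 0 < p -> 0 < q -> RInt (frac_kernel a D) p q = minus (H p) (H q)).
{ intros p q Hp Hq. apply (is_RInt_unique (V := X)).
  apply (is_RInt_ext (fun t => opp (opp (frac_kernel a D t)))).
  { intros t _. vring X. }
  replace (minus (H p) (H q)) with (opp (minus (H q) (H p))) by vring X.
  apply (is_RInt_opp (V := X)).
  assert (Hmin : forall x : R, Rmin p q <= x -> 0 < x).
  { intros x Hx. eapply Rlt_le_trans; [|exact Hx]. now apply Rmin_pos. }
  apply (@is_RInt_derive X H).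
  - intros x [Hx _]. apply Hmin in Hx. now apply (@beta_orbit_integral_derive y H HH).
  - intros x [Hx _]. apply Hmin in Hx. apply (continuous_opp (V := X)).
    now apply frac_kernel_continuous. }
assert (Hone : forall p, Rpower 1 p = 1).
{ intros p. unfold Rpower. now rewrite ln_1, Rmult_0_r, exp_0. }
set (c1 := M * norm y / (1 - a) + (M + 1) * norm (B y) / a).
assert (Hc1 : 0 <= c1).
{ pose proof (norm_ge0 y). pose proof (norm_ge0 (B y)).
  apply Rplus_le_le_0_compat; apply Rdiv_le_0_compat; nra. }
(* Splitting at 1 / s balances the Lipschitz bound s (1 + r) M |y|, used for small r, against (M +
   1) |B y|, used for large r; both parts are of order s^a. *)
assert (HH0 : forall s, 0 < s -> norm (minus (H s) (scal kappa (B y))) <= c1 * Rpower s a).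
{ intros s Hs.
  assert (Hi := is_imp_minus (HH s Hs) (is_imp_scal_vec (B y) Hkappa)).
  assert (Hb : power_bounds (1 - a) a (M * norm y * s) ((M + 1) * norm (B y))
    (fun t => minus (beta_orbit y s t) (scal (beta_kernel t) (B y)))).
  { split; intros t Ht.
    - replace (minus _ _) with (scal (beta_kernel t)
        (minus (E (s * (1 + t)) (B y)) (E 0 (B y)))).
      2:{ unfold beta_orbit. rewrite (@Epos_eq X), (E_zero HE) by nra. vring X. }
      rewrite norm_scalR, Rabs_pos_eq by (left; now apply beta_kernel_pos).
      assert (Hl := @E_B_lipschitz 0 (s * (1 + t)) y ltac:(lra) ltac:(nra)).
      apply (Rmult_le_compat_l (beta_kernel t)) in Hl; [|left; now apply beta_kernel_pos].
      eapply Rle_trans; [exact Hl|]. right. unfold beta_kernel.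
      replace (1 - a - 1) with (- a) by ring. field. lra.
    - replace (minus _ _) with (scal (beta_kernel t) (minus (E (s * (1 + t)) (B y)) (B y))).
      2:{ unfold beta_orbit. rewrite (@Epos_eq X) by nra. vring X. }
      rewrite norm_scalR, Rabs_pos_eq by (left; now apply beta_kernel_pos).
      rewrite Rmult_comm. apply Rmult_le_compat.
      + apply norm_ge0.
      + left; now apply beta_kernel_pos.
      + eapply Rle_trans; [apply norm_minus_le|].
        assert (norm (E (s * (1 + t)) (B y)) <= M * norm (B y))
          by (apply (as_bounded HA); nra). lra.
      + now apply beta_kernel_le2. }
  assert (His : 0 < / s) by now apply Rinv_0_lt_compat.
  assert (Hn := imp_norm_le (p := 1 - a) (q := a) (t := / s) ltac:(lra) ltac:(lra) Hb Hi His).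
  eapply Rle_trans; [exact Hn|]. right. unfold c1.
  assert (Hinv : forall p, Rpower (/ s) p = Rpower s (- p)).
  { intros p. unfold Rpower. rewrite ln_Rinv by auto. f_equal. ring. }
  rewrite !Hinv, Ropp_involutive.
  replace (M * norm y * s * (Rpower s (- (1 - a)) / (1 - a))) with
    (M * norm y / (1 - a) * (s * Rpower s (- (1 - a)))) by (field; lra).
  replace (s * Rpower s (- (1 - a))) with (Rpower s a); [field; lra|].
  rewrite <- (Rpower_1 s) at 2 by auto. rewrite <- Rpower_plus. f_equal; ring. }
set (c2 := C * MB * norm (B y) * (/ (1 - a) + / a)).
assert (Hc2 : 0 <= c2).
{ pose proof (norm_ge0 (B y)). apply Rmult_le_pos.
  - repeat apply Rmult_le_pos; lra.
  - apply Rplus_le_le_0_compat; left; apply Rinv_0_lt_compat; lra. }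
(* The decay of the orbit is applied at the time s (1 + r) >= s, which gives 1 / s uniformly in
   r. *)
assert (HHinf : forall s, 0 < s -> norm (H s) <= c2 / s).
{ intros s Hs.
  assert (Hb : power_bounds (1 - a) a (C * MB * norm (B y) / s) (C * MB * norm (B y) / s)
    (beta_orbit y s)).
  { apply beta_bounds. intros r Hr. unfold beta_orbit.
    rewrite norm_scalR, Rabs_pos_eq by (left; now apply beta_kernel_pos).
    rewrite Rmult_comm. apply Rmult_le_compat_r; [left; now apply beta_kernel_pos|].
    rewrite (@Epos_eq X) by nra.
    assert (Hd := @decay_norm (s * (1 + r)) (B y) ltac:(nra)).
    apply (Rmult_le_reg_l s); auto.
    replace (s * (C * MB * norm (B y) / s)) with (C * MB * norm (B y)) by (field; lra).
    eapply Rle_trans; [|exact Hd]. apply Rmult_le_compat_r; [apply norm_ge0|nra]. }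
  assert (Hn := imp_norm_le (p := 1 - a) (q := a) (t := 1) ltac:(lra) ltac:(lra) Hb (HH s Hs) Rlt_0_1).
  rewrite !Hone in Hn. eapply Rle_trans; [exact Hn|]. right. unfold c2. field. lra. }
apply (is_imp_unique (F := frac_kernel a D)); [now apply frac_integral_imp|].
split.
{ intros t Ht. now apply frac_kernel_continuous. }
intros e He.
destruct (@Rpower_small a (e / 2 / (c1 + 1))) as [d [Hd Hd']]; [lra|apply Rdiv_lt_0_compat; lra|].
generalize (zero_infinity_between (2 * (c2 + 1) / e) Hd). apply filter_imp.
intros [p q]; simpl. intros [Hp Hq].
assert (Hq0 : 0 < q).
{ eapply Rlt_trans; [|exact Hq]. apply Rdiv_lt_0_compat; lra. }
rewrite HRI by lra.
replace (minus _ _) with (minus (minus (H p) (scal kappa (B y))) (H q)) by vring X.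
eapply Rle_lt_trans; [apply norm_minus_le|].
specialize (HH0 p ltac:(lra)). specialize (HHinf q Hq0). specialize (Hd' p Hp).
assert (c1 * Rpower p a <= e / 2).
{ apply (Rmult_lt_compat_l (c1 + 1)) in Hd'; [|lra].
  replace ((c1 + 1) * (e / 2 / (c1 + 1))) with (e / 2) in Hd' by (field; lra).
  pose proof (Rpower_pos p a). nra. }
assert (c2 / q < e / 2).
{ apply (Rmult_lt_reg_r q); auto. replace (c2 / q * q) with c2 by (field; lra).
  apply (Rmult_lt_compat_l (e / 2)) in Hq; [|lra].
  replace (e / 2 * (2 * (c2 + 1) / e)) with (c2 + 1) in Hq by (field; lra). lra. }
lra.
Qed.

End Reflection.

End FractionalIntegral.

Lemma Gamma_pos a : 0 < a < 1 -> 0 < Gamma a.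
Proof.
intros Ha.
set (k := fun t => Rpower t (a - 1) * exp (- t)).
assert (Hk : forall t, 0 < k t).
{ intros t. apply Rmult_lt_0_compat; apply exp_pos. }
destruct (imp_exists (X := R_CompleteNormedModule) (p := a) (q := 1 - a) (C1 := 1)
  (C2 := 1) (F := k)) as [I HI]; try lra.
- intros t Ht. apply continuous_R_mult; [now apply continuous_Rpower|].
  apply (@ex_derive_continuous R_AbsRing R_NormedModule). auto_derive. auto.
- split; intros t Ht; change (norm (k t)) with (Rabs (k t));
  rewrite Rabs_pos_eq, Rmult_1_l by (left; auto); unfold k.
  + rewrite <- (Rmult_1_r (Rpower t (a - 1))) at 2.
    apply Rmult_le_compat_l; [left; apply Rpower_pos|].
    rewrite <- exp_0. apply exp_le_mono. lra.
  + replace (Rpower t (- (1 - a) - 1)) with (Rpower t (a - 1) * / t).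
    * apply Rmult_le_compat_l; [left; apply Rpower_pos|]. now apply exp_neg_le.
    * rewrite <- (Rpower_1 t) at 2 by auto. rewrite <- Rpower_Ropp, <- Rpower_plus.
      f_equal; ring.
- unfold Gamma.
  rewrite (is_imp_RInt_gen (F' := fun t => Rpower t (a - 1) * exp (- t)) HI) by auto.
  apply Rlt_le_trans with (Rpower 2 (a - 1) * exp (- 2)).
  + apply Rmult_lt_0_compat; apply exp_pos.
  + apply (is_imp_ge HI); [intros t Ht; left; auto|]. intros t Ht. unfold k.
    apply Rmult_le_compat; [left; apply Rpower_pos|left; apply exp_pos| |].
    * replace (a - 1) with (- (1 - a)) by ring. rewrite !Rpower_Ropp.
      apply Rinv_le_contravar; [apply Rpower_pos|]. apply Rle_Rpower_l; lra.
    * apply exp_le_mono. lra.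
Qed.

(* V stands for A^{-alpha}: the norm of the space V is |V^{-1} v|. *)
Record smoothing_scale (X : CompleteNormedModule R_AbsRing) (E : R -> X -> X)
    (V : X -> X) (alpha MV M C : R) : Prop := SmoothingScale {
  ss_semigroup : c0_semigroup E;
  ss_linear : bounded_linear V MV;
  ss_injective : forall x, V x = zero -> x = zero;
  ss_commute : forall t x, 0 <= t -> E t (V x) = V (E t x);
  ss_M : 1 <= M;
  ss_C : 0 < C;
  ss_bounded : forall t x, 0 <= t -> norm (E t x) <= M * norm x;
  ss_smoothing : forall t x, 0 < t ->
    exists w, V w = E t x /\ norm w <= C * Rpower t (- alpha) * norm x
}.

Section FractionalPowers.

Variable X : CompleteNormedModule R_AbsRing.
Implicit Types x y z v w : X.
Variables (E : R -> X -> X) (B : X -> X) (MB M C : R).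
Hypothesis HA : analytic_semigroup E B MB M C.

Let HE := as_semigroup HA.

(** If B v = E(t) x, then I_a I_{1-a} = k1 B shows that (Gamma(a) / k1) I_{1-a} v is mapped to E(t)
    x, and splitting its integral at the same [t] gives the power t^{-a}. Injectivity uses the
    product in reverse order, hence the second constant [k2]. *)
Lemma frac_inv_scale a : 0 < a < 1 ->
  exists MV C', smoothing_scale E (frac_inv E a) a MV M C'.
Proof.
intros Ha.
assert (HG := Gamma_pos Ha).
assert (Hfi : forall x, frac_inv E a x = scal (/ Gamma a) (frac_integral E a x))
  by reflexivity.
destruct (frac_integral_bl HA Ha) as (Ma & HMa0 & Hplus & Hscal & Hnorm).
assert (Ha' : 0 < 1 - a < 1) by lra.
destruct (frac_integral_bl HA Ha') as (Mb & HMb).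
destruct (frac_integral_reflection HA Ha) as (k1 & Hk1 & H1).
destruct (frac_integral_reflection HA Ha') as (k2 & Hk2 & H2).
replace (1 - (1 - a)) with a in H2 by ring.
assert (HM := as_M HA). assert (HC := as_C HA).
assert (HiG : 0 < / Gamma a) by now apply Rinv_0_lt_compat.
exists (/ Gamma a * Ma), (Gamma a / k1 * (M * C / (1 - a) + C * M / a)).
split; auto.
- split; [nra|]. split; [|split].
  + intros x y. rewrite !Hfi, Hplus. vring X.
  + intros k x. rewrite !Hfi, Hscal. vring X.
  + intros x. rewrite Hfi, norm_scalR, Rabs_pos_eq, Rmult_assoc by lra.
    apply Rmult_le_compat_l; auto; lra.
- intros x Hx. rewrite Hfi in Hx.
  assert (Hx' : frac_integral E a x = zero).
  { replace (frac_integral E a x) with (scal (Gamma a) (scal (/ Gamma a) (frac_integral E a x)))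
      by (vfield X; lra).
    rewrite Hx. vring X. }
  specialize (H2 x). rewrite Hx', (bl_zero HMb) in H2.
  apply (as_injective HA).
  replace (B x) with (scal (/ k2) (scal k2 (B x))) by (vfield X; lra).
  rewrite <- H2. vring X.
- intros t x Ht. rewrite !Hfi, (E_scal HE) by auto.
  now rewrite (frac_integral_commute HA).
- apply Rmult_lt_0_compat; [now apply Rdiv_lt_0_compat|].
  apply Rplus_lt_0_compat; apply Rdiv_lt_0_compat; nra.
- apply (as_bounded HA).
- intros t x Ht.
  destruct (as_smoothing HA x Ht) as [v [Hv1 Hv2]].
  exists (scal (Gamma a / k1) (frac_integral E (1 - a) v)). split.
  + rewrite Hfi, Hscal, H1, Hv1. vfield X. lra.
  + assert (Hn : norm (frac_integral E (1 - a) v) <=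
      (M * C / (1 - a) + C * M / a) * Rpower t (- a) * norm x).
    { eapply Rle_trans.
      - apply (@frac_integral_le X E B MB M C HA (1 - a) v (M * C * norm x / t)
          (C * M * norm x) t); auto.
        + intros s Hs. eapply Rle_trans; [apply (as_bounded HA); lra|].
          apply (Rmult_le_compat_l (M / t)) in Hv2.
          * replace (M * C * norm x / t) with (M / t * (C * norm x)) by (field; lra).
            eapply Rle_trans; [|exact Hv2]. right. field. lra.
          * apply Rdiv_le_0_compat; lra.
        + intros s Hs. eapply Rle_trans; [apply (as_decay HA); auto|].
          rewrite Hv1, Rmult_assoc. apply Rmult_le_compat_l; [lra|].
          apply (as_bounded HA). lra.
      - replace (1 - (1 - a)) with a by ring.
        replace (Rpower t (1 - a)) with (t * Rpower t (- a)).
        + right. field. lra.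
        + rewrite <- (Rpower_1 t) at 1 by auto. rewrite <- Rpower_plus. f_equal; ring. }
    rewrite norm_scalR, Rabs_pos_eq by (left; now apply Rdiv_lt_0_compat).
    rewrite 2!Rmult_assoc. rewrite Rmult_assoc in Hn.
    apply Rmult_le_compat_l; [left; now apply Rdiv_lt_0_compat|]. exact Hn.
Qed.

(** For alpha = 0 the operator is the identity. Otherwise injectivity of A^{-alpha} identifies the
    value chosen by [iota], so that membership and norm become statements about preimages. *)
Lemma frac_power_scale alpha : 0 <= alpha < 1 ->
  exists V MV C', smoothing_scale E V alpha MV M C' /\
    (forall v, inV E alpha v <-> exists w, V w = v) /\
    (forall w, normV E alpha (V w) = norm w).
Proof.
intros Ha. unfold inV, normV, frac_power.
destruct (Req_EM_T alpha 0) as [->|Hne]; simpl.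
- exists (fun x => x), 1, M. assert (HM := as_M HA). split; [|split; auto].
  + split; auto.
    * split; [lra|]. repeat split; auto. intros; lra.
    * lra.
    * apply (as_bounded HA).
    * intros t x Ht. exists (E t x). split; auto.
      rewrite Ropp_0, Rpower_O, Rmult_1_r by auto. apply (as_bounded HA). lra.
  + intros v. split; auto. intros _. now exists v.
- destruct (@frac_inv_scale alpha ltac:(lra)) as (MV & C' & HS).
  exists (frac_inv E alpha), MV, C'. split; auto. split.
  + intros v; reflexivity.
  + intros w. f_equal. apply (iota_unique (V := X)); auto.
    intros y Hy. apply minus_zero_eq, (ss_injective HS).
    rewrite (bl_minus _ _ (ss_linear HS)), Hy. vring X.
Qed.

End FractionalPowers.

(** * Convolution with the semigroup *)

Section KernelPrimitive.

Variable alpha : R.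
Hypothesis Halpha : 0 <= alpha < 1.

(* int_0^s r^{-alpha} dr *)
Definition kernel_primitive (s : R) : R :=
  if Rlt_dec 0 s then Rpower s (1 - alpha) / (1 - alpha) else 0.

Lemma kernel_primitive_pos s : 0 < s ->
  kernel_primitive s = Rpower s (1 - alpha) / (1 - alpha).
Proof. intros Hs. unfold kernel_primitive. destruct (Rlt_dec 0 s); lra. Qed.

(** The case distinction in the definition matters here: [Rpower 0 p] is exp 0 = 1, because [ln 0]
    is 0 by convention. *)
Lemma kernel_primitive_0 : kernel_primitive 0 = 0.
Proof. unfold kernel_primitive. destruct (Rlt_dec 0 0); lra. Qed.

Lemma kernel_primitive_ge0 s : 0 <= kernel_primitive s.
Proof.
unfold kernel_primitive. destruct (Rlt_dec 0 s); [|lra].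
apply Rdiv_le_0_compat; [left; apply Rpower_pos|lra].
Qed.

Lemma kernel_primitive_mono s r : s <= r -> kernel_primitive s <= kernel_primitive r.
Proof.
intros Hsr. destruct (Rlt_or_le 0 s) as [Hs|Hs].
- rewrite !kernel_primitive_pos by lra. unfold Rdiv.
  apply Rmult_le_compat_r; [left; apply Rinv_0_lt_compat; lra|].
  apply Rle_Rpower_l; lra.
- replace (kernel_primitive s) with 0.
  + apply kernel_primitive_ge0.
  + unfold kernel_primitive. destruct (Rlt_dec 0 s); lra.
Qed.

Lemma kernel_primitive_small e : 0 < e ->
  exists d, 0 < d /\ forall s, s < d -> kernel_primitive s < e.
Proof.
intros He. destruct (@Rpower_small (1 - alpha) (e * (1 - alpha))) as [d [Hd H]]; [lra|nra|].
exists d. split; auto. intros s Hs. unfold kernel_primitive.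
destruct (Rlt_dec 0 s) as [Hs0|]; [|lra].
specialize (H s ltac:(lra)).
apply (Rmult_lt_reg_r (1 - alpha)); [lra|].
replace (Rpower s (1 - alpha) / (1 - alpha) * (1 - alpha)) with (Rpower s (1 - alpha))
  by (field; lra). exact H.
Qed.

Lemma kernel_primitive_integral a b r : 0 < a -> a <= b -> 0 <= r ->
  is_RInt (fun s => Rpower (s + r) (- alpha)) a b
    (kernel_primitive (b + r) - kernel_primitive (a + r)).
Proof.
intros Ha Hab Hr.
assert (H := @power_integral (1 - alpha) (1 * a + r) (1 * b + r) ltac:(lra) ltac:(lra)).
apply (is_RInt_comp_lin (V := R_NormedModule)) in H.
apply (is_RInt_ext (fun y => scal 1 (Rpower (1 * y + r) (1 - alpha - 1)))).
- intros x _. unfold scal; simpl; unfold mult; simpl. rewrite !Rmult_1_l. f_equal. ring.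
- rewrite !kernel_primitive_pos by lra. rewrite !Rmult_1_l in H.
  replace (Rpower (b + r) (1 - alpha) / (1 - alpha) - Rpower (a + r) (1 - alpha) / (1 - alpha))
    with ((Rpower (b + r) (1 - alpha) - Rpower (a + r) (1 - alpha)) / (1 - alpha))
    by (field; lra). exact H.
Qed.

End KernelPrimitive.

Section Smoothing.

Variable X : CompleteNormedModule R_AbsRing.
Implicit Types x y z v w : X.
Variables (E : R -> X -> X) (V : X -> X) (alpha MV M C : R).
Hypothesis Halpha : 0 <= alpha < 1.
Hypothesis HS : smoothing_scale E V alpha MV M C.

Let HE := ss_semigroup HS.
Let HV := ss_linear HS.
Let kp := kernel_primitive alpha.

(* |v|_V <= b *)
Definition vle v (b : R) : Prop := exists w, V w = v /\ norm w <= b.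

Lemma vle_zero : vle zero 0.
Proof. exists zero. rewrite norm0. split; [apply (bl_zero HV)|lra]. Qed.

Lemma vle_ge0 v b : vle v b -> 0 <= b.
Proof. intros [w [_ H]]. pose proof (norm_ge0 w). lra. Qed.

Lemma vle_plus v1 v2 b1 b2 : vle v1 b1 -> vle v2 b2 -> vle (plus v1 v2) (b1 + b2).
Proof.
intros [w1 [<- H1]] [w2 [<- H2]]. exists (plus w1 w2). split.
- apply HV.
- eapply Rle_trans; [apply norm_plus_le|lra].
Qed.

Lemma vle_opp v b : vle v b -> vle (opp v) b.
Proof.
intros [w [<- H]]. exists (opp w). split; [apply (bl_opp _ HV)|now rewrite norm_oppE].
Qed.

Lemma vle_minus v1 v2 b1 b2 : vle v1 b1 -> vle v2 b2 -> vle (minus v1 v2) (b1 + b2).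
Proof.
intros H1 H2. replace (minus v1 v2) with (plus v1 (opp v2)) by vring X.
apply vle_plus; auto. now apply vle_opp.
Qed.

Lemma vle_weaken v b b' : vle v b -> b <= b' -> vle v b'.
Proof. intros [w [<- H]] Hb. exists w. split; auto; lra. Qed.

Lemma vle_E t v b : 0 <= t -> vle v b -> vle (E t v) (M * b).
Proof.
intros Ht [w [<- H]]. exists (E t w). split; [now rewrite (ss_commute HS)|].
eapply Rle_trans; [now apply (ss_bounded HS)|].
apply Rmult_le_compat_l; auto. pose proof (ss_M HS); lra.
Qed.

(** Preimages are chosen vector by vector; injectivity of [V] makes the choice linear. *)
Lemma smoothing_operator t : 0 < t ->
  exists S, bounded_linear S (C * Rpower t (- alpha)) /\ forall x, V (S x) = E t x.
Proof.
intros Ht.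
pose (S := fun x => proj1_sig (constructive_indefinite_description _ (ss_smoothing HS x Ht))).
assert (HSx : forall x, V (S x) = E t x /\ norm (S x) <= C * Rpower t (- alpha) * norm x).
{ intros x. unfold S. now destruct (constructive_indefinite_description _ _). }
clearbody S. exists S. split; [|intros x; apply HSx].
assert (Hinj : forall x y, V x = V y -> x = y).
{ intros x y Hxy. apply minus_zero_eq, (ss_injective HS).
  rewrite (bl_minus _ _ HV), Hxy. vring X. }
split; [|split; [|split]].
- apply Rmult_le_pos; [left; apply (ss_C HS)|left; apply Rpower_pos].
- intros x y. apply Hinj. rewrite (proj1 (proj2 HV)).
  rewrite !(proj1 (HSx _)). apply (E_plus HE). lra.
- intros k x. apply Hinj. rewrite (proj1 (proj2 (proj2 HV))).
  rewrite !(proj1 (HSx _)). apply (E_scal HE). lra.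
- intros x. apply HSx.
Qed.

Lemma continuous_shift (F : R -> X) (r s : R) :
  continuous F (s + r) -> continuous (fun q : R => F (q + r)) s.
Proof.
intros HF. apply (continuous_comp (fun q : R => q + r) F); auto.
apply (@ex_derive_continuous R_AbsRing R_NormedModule). auto_derive. auto.
Qed.

Lemma Epos_shift_continuous (D : R -> X) (r s : R) :
  (forall q, continuous D q) -> continuous (fun q : R => Epos E (q + r) (D q)) s.
Proof.
intros HD.
apply (continuous_ext (fun q : R => (fun p : R => Epos E p (D (p + - r))) (q + r))).
- intros q. f_equal. f_equal. exact (Rplus_minus_r q r).
- apply (@continuous_shift (fun p : R => Epos E p (D (p + - r)))).
  apply (Epos_joint HE (D := fun p : R => D (p + - r))).
  now apply (@continuous_shift D).
Qed.

Lemma at_right_between d : 0 < d -> at_right 0 (fun a => 0 < a < d).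
Proof.
intros Hd. exists (mkposreal d Hd). intros a Ha Ha0. split; auto.
unfold ball in Ha; simpl in Ha; unfold AbsRing_ball, abs, minus, plus, opp in Ha; simpl in Ha.
rewrite Ropp_0, Rplus_0_r in Ha. pose proof (Rle_abs a). lra.
Qed.

(** The integrand is lifted to G(s) = A^alpha E(s + r) D(s), which may be singular at 0 when r = 0.
    Its integrals over [a, c] converge as a tends to 0, and boundedness of [V] identifies the image
    of the limit with the convolution. The bound is the integral of (s + r)^{-alpha}. *)
Lemma convolution_vle (D : R -> X) (b r c : R) :
  (forall s, continuous D s) -> (forall s, norm (D s) <= b) -> 0 <= r -> 0 <= c ->
  vle (RInt (fun s => Epos E (s + r) (D s)) 0 c) (C * b * (kp (c + r) - kp r)).
Proof.
intros HD Hb Hr Hc.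
assert (HC := ss_C HS). assert (HM := ss_M HS).
assert (Hb0 : 0 <= b) by (pose proof (Hb 0); pose proof (norm_ge0 (D 0)); lra).
destruct Hc as [Hc|<-].
2:{ rewrite (RInt_point (V := X)), Rplus_0_l, Rminus_diag, Rmult_0_r. apply vle_zero. }
assert (HF : forall s, continuous (fun s => Epos E (s + r) (D s)) s).
{ intros s. now apply Epos_shift_continuous. }
pose (S := fun t => match Rlt_dec 0 t with
  | left H => proj1_sig (constructive_indefinite_description _ (smoothing_operator H))
  | right _ => fun x => x end).
assert (HSt : forall t, 0 < t ->
  bounded_linear (S t) (C * Rpower t (- alpha)) /\ forall x, V (S t x) = E t x).
{ intros t Ht. unfold S. destruct (Rlt_dec 0 t); [|lra].
  now destruct (constructive_indefinite_description _ _). }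
clearbody S.
assert (Hinj : forall x y, V x = V y -> x = y).
{ intros x y Hxy. apply minus_zero_eq, (ss_injective HS).
  rewrite (bl_minus _ _ HV), Hxy. vring X. }
set (G := fun s => S (s + r) (D s)).
assert (HG : forall s, 0 < s -> continuous G s).
{ intros s Hs. destruct (HSt (s / 2) ltac:(lra)) as [HS1 HS2].
  (* For q near s the operator S(q + r) is S(s/2) after E(q + r - s/2), so continuity reduces to
     that of an orbit under one fixed bounded operator. *)
  apply (continuous_ext_loc _ (fun q => S (s / 2) (Epos E (q + (r - s / 2)) (D q)))).
  - assert (Hs2 : 0 < s / 2) by lra.
    exists (mkposreal _ Hs2). intros q Hq.
    unfold ball in Hq; simpl in Hq; unfold AbsRing_ball, abs, minus, plus, opp in Hq; simpl in Hq.
    assert (s / 2 < q) by (split_Rabs; lra).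
    apply Hinj. unfold G. destruct (HSt (q + r) ltac:(lra)) as [_ HS4].
    rewrite HS2, HS4, (@Epos_eq X), <- (E_add HE) by lra. f_equal. lra.
  - apply (bl_continuous HS1).
    now apply Epos_shift_continuous. }
assert (HGn : forall s, 0 < s -> norm (G s) <= C * b * Rpower (s + r) (- alpha)).
{ intros s Hs. destruct (HSt (s + r) ltac:(lra)) as [HS1 _].
  eapply Rle_trans; [apply HS1|].
  replace (C * b * Rpower (s + r) (- alpha)) with (C * Rpower (s + r) (- alpha) * b) by ring.
  apply Rmult_le_compat_l; auto. apply Rmult_le_pos; [lra|left; apply Rpower_pos]. }
assert (HGn' : forall s, 0 < s -> norm (G s) <= C * b * Rpower s (1 - alpha - 1)).
{ intros s Hs. eapply Rle_trans; [now apply HGn|]. apply Rmult_le_compat_l; [nra|].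
  replace (1 - alpha - 1) with (- alpha) by ring. rewrite !Rpower_Ropp.
  apply Rinv_le_contravar; [apply Rpower_pos|]. apply Rle_Rpower_l; lra. }
assert (Hex : forall p q, 0 < p -> 0 < q -> ex_RInt G p q) by (intros; now apply ex_RInt_pos).
destruct (filter_cauchy_lim (F := at_right 0) (f := fun a => RInt G a c)) as [w Hw].
{ intros e He.
  destruct (@Rpower_small (1 - alpha) (e * (1 - alpha) / (C * b + 1))) as [d [Hd Hd']]; [lra| |].
  { apply Rdiv_lt_0_compat; nra. }
  exists (fun a => 0 < a < d). split; [now apply at_right_between|].
  assert (G1 : forall p q, 0 < p -> p <= q < d -> norm (RInt G p q) < e).
  { intros p q Hp Hq.
    eapply Rle_lt_trans; [apply (RInt_zero_le (p := 1 - alpha) (C := C * b)); auto; lra|].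
    specialize (Hd' q ltac:(lra)).
    apply (Rmult_lt_compat_r ((C * b + 1) / (1 - alpha))) in Hd';
      [|apply Rdiv_lt_0_compat; nra].
    replace (e * (1 - alpha) / (C * b + 1) * ((C * b + 1) / (1 - alpha))) with e in Hd'
      by (field; split; nra).
    eapply Rle_lt_trans; [|exact Hd'].
    replace (Rpower q (1 - alpha) * ((C * b + 1) / (1 - alpha))) with
      ((C * b + 1) * (Rpower q (1 - alpha) / (1 - alpha))) by (field; lra).
    apply Rmult_le_compat_r; [|lra]. apply Rdiv_le_0_compat; [left; apply Rpower_pos|lra]. }
  intros p q Hp Hq.
  rewrite <- (RInt_Chasles (V := X) G p q c) by (apply Hex; lra).
  replace (minus (plus (RInt G p q) (RInt G q c)) (RInt G q c)) with (RInt G p q) by vring X.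
  destruct (Rle_or_lt p q); [apply G1; lra|].
  rewrite <- (opp_RInt_swap (V := X)) by (apply Hex; lra). rewrite norm_oppE. apply G1; lra. }
assert (HVG : forall a, 0 < a -> V (RInt G a c) = RInt (fun s => Epos E (s + r) (D s)) a c).
{ intros a Ha. rewrite (bl_RInt HV) by (apply Hex; lra).
  apply (RInt_ext (V := X)). intros s [Hs _].
  assert (0 < s) by (eapply Rlt_trans; [|exact Hs]; apply Rmin_pos; lra).
  unfold G. rewrite (proj2 (HSt (s + r) ltac:(lra))). now rewrite (@Epos_eq X) by lra. }
exists w. split.
- apply norm_small_eq. intros e He.
  apply (norm_lim_le (F := at_right 0) (f := fun a => V (RInt G a c))).
  { intros e' He'. apply (bl_lim (F := at_right 0) HV Hw He'). }
  assert (Hd : 0 < Rmin c (e / (M * b + 1))).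
  { apply Rmin_pos; auto. apply Rdiv_lt_0_compat; nra. }
  generalize (at_right_between Hd). apply filter_imp. intros a Ha.
  assert (Ha1 : a < c) by (eapply Rlt_le_trans; [apply Ha|apply Rmin_l]).
  assert (Ha2 : a < e / (M * b + 1)) by (eapply Rlt_le_trans; [apply Ha|apply Rmin_r]).
  rewrite HVG by lra.
  rewrite <- (RInt_Chasles (V := X) _ 0 a c) by (apply ex_RInt_cont; auto).
  replace (minus _ _) with (opp (RInt (fun s => Epos E (s + r) (D s)) 0 a)) by vring X.
  rewrite norm_oppE.
  apply Rle_trans with ((a - 0) * (M * b)).
  + apply norm_RInt_const; [lra|now apply ex_RInt_cont|]. intros s Hs.
    rewrite (@Epos_eq X) by lra. eapply Rle_trans; [apply (ss_bounded HS); lra|].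
    apply Rmult_le_compat_l; auto; lra.
  + apply (Rmult_lt_compat_r (M * b + 1)) in Ha2; [|nra].
    replace (e / (M * b + 1) * (M * b + 1)) with e in Ha2 by (field; nra). nra.
- replace w with (minus w zero) by vring X.
  apply (norm_lim_le (F := at_right 0) Hw).
  generalize (at_right_between Hc). apply filter_imp. intros a Ha.
  apply Rle_trans with (norm (RInt G a c)); [right; f_equal; vring X|].
  assert (Hk := @kernel_primitive_integral alpha Halpha a c r ltac:(lra) ltac:(lra) Hr).
  apply (is_RInt_scal (V := R_NormedModule) _ _ _ (C * b)) in Hk.
  apply Rle_trans with (C * b * (kp (c + r) - kp (a + r))).
  + apply (norm_RInt_le G (fun s => C * b * Rpower (s + r) (- alpha)) a c); try lra.
    * intros s Hs. apply HGn. lra.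
    * apply (@RInt_correct X). apply Hex; lra.
    * exact Hk.
  + apply Rmult_le_compat_l; [nra|].
    assert (kp r <= kp (a + r)) by (apply kernel_primitive_mono; auto; lra). lra.
Qed.

End Smoothing.

(** * Polynomial interpolation *)

(* Real polynomial functions with n coefficients. *)
Fixpoint is_poly (n : nat) (p : R -> R) : Prop :=
  match n with
  | O => forall x, p x = 0
  | S k => exists a q, is_poly k q /\ forall x, p x = a + x * q x
  end.

Lemma is_poly_ext n p q : (forall x, p x = q x) -> is_poly n p -> is_poly n q.
Proof.
intros Hpq. destruct n; simpl.
- intros H x. now rewrite <- Hpq.
- intros (a & r & Hr & H). exists a, r. split; auto. intros x. now rewrite <- Hpq.
Qed.

Lemma is_poly_weaken n p : is_poly n p -> is_poly (S n) p.
Proof.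
revert p; induction n as [|n IH]; intros p Hp.
- exists 0, (fun _ => 0). split; [now simpl|]. intros x. simpl in Hp. rewrite Hp. ring.
- destruct Hp as (a & q & Hq & H). exists a, q. split; auto.
Qed.

Lemma is_poly_le n m p : (n <= m)%nat -> is_poly n p -> is_poly m p.
Proof. induction 1; auto. intros H'. now apply is_poly_weaken, IHle. Qed.

Lemma is_poly_plus n p q : is_poly n p -> is_poly n q -> is_poly n (fun x => p x + q x).
Proof.
revert p q; induction n as [|n IH]; intros p q Hp Hq.
- intros x. simpl in *. rewrite Hp, Hq. ring.
- destruct Hp as (a & p' & Hp' & H1), Hq as (b & q' & Hq' & H2).
  exists (a + b), (fun x => p' x + q' x). split; [now apply IH|].
  intros x. rewrite H1, H2. ring.
Qed.

Lemma is_poly_scal n k p : is_poly n p -> is_poly n (fun x => k * p x).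
Proof.
revert p; induction n as [|n IH]; intros p Hp.
- intros x. simpl in *. rewrite Hp. ring.
- destruct Hp as (a & p' & Hp' & H1). exists (k * a), (fun x => k * p' x).
  split; [now apply IH|]. intros x. rewrite H1. ring.
Qed.

Lemma is_poly_shift n p : is_poly n p -> is_poly (S n) (fun x => x * p x).
Proof. intros Hp. exists 0, p. split; auto. intros; ring. Qed.

Lemma is_poly_linear n a b p : is_poly n p -> is_poly (S n) (fun x => (a * x + b) * p x).
Proof.
intros Hp. apply (is_poly_ext (p := fun x => a * (x * p x) + b * p x)).
{ intros; ring. }
apply is_poly_plus.
- now apply is_poly_scal, is_poly_shift.
- now apply is_poly_weaken, is_poly_scal.
Qed.

Lemma is_poly_pow k : is_poly (S k) (fun x => x ^ k).
Proof.
induction k as [|k IH].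
- exists 1, (fun _ => 0). split; [now simpl|]. intros; simpl; ring.
- exact (is_poly_shift IH).
Qed.

Lemma is_poly_factor n p r : is_poly (S n) p ->
  exists q, is_poly n q /\ forall x, p x = p r + (x - r) * q x.
Proof.
revert p; induction n as [|n IH]; intros p (a & q0 & Hq0 & Hp).
- exists (fun _ => 0). split; [now simpl|]. intros x. simpl in Hq0.
  rewrite !Hp, !Hq0. ring.
- destruct (IH q0 Hq0) as (q1 & Hq1 & H1).
  exists (fun x => q0 r + x * q1 x). split.
  + exists (q0 r), q1. auto.
  + intros x. rewrite !Hp, (H1 x). ring.
Qed.

Lemma is_poly_roots (l : list R) p : NoDup l -> is_poly (length l) p ->
  (forall r, In r l -> p r = 0) -> forall x, p x = 0.
Proof.
revert p; induction l as [|r l IH]; intros p Hl Hp Hr x; [apply Hp|].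
simpl in Hp. destruct (is_poly_factor r Hp) as (q & Hq & H).
inversion Hl as [|? ? Hn Hl']; subst.
rewrite H, (Hr r) by now left. rewrite (IH q); auto; [ring|].
intros z Hz. assert (z <> r) by (intros ->; auto).
specialize (H z). rewrite (Hr z) in H by now right.
rewrite (Hr r) in H by now left.
apply (Rmult_eq_reg_l (z - r)); lra.
Qed.

Section Lagrange.

Variables (s : nat) (c : nat -> R).
Hypothesis Hc : collocation_parameters s c.

Lemma collocation_neq i j : (i < s)%nat -> (j < s)%nat -> i <> j -> c i - c j <> 0.
Proof.
intros Hi Hj Hij H. apply (proj2 (proj2 Hc) i j Hi Hj Hij). lra.
Qed.

(** The induction carries two claims: one coefficient more than factors in general, and as many as
    factors once the constant factor with index [j] has been met. *)
Lemma lagrange_poly j : (j < s)%nat -> is_poly s (lagrange s c j).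
Proof.
intros Hj.
set (F := fun rho (k : nat) => if Nat.eqb k j then 1 else (rho - c k) / (c j - c k)).
assert (G : forall l, is_poly (S (length l)) (fun rho => fold_right Rmult 1 (map (F rho) l)) /\
  (In j l -> is_poly (length l) (fun rho => fold_right Rmult 1 (map (F rho) l)))).
{ induction l as [|k l [IH1 IH2]]; simpl map; simpl fold_right.
  - split; [|intros []]. exists 1, (fun _ => 0). split; [now simpl|]. intros; ring.
  - unfold F at 1 3. destruct (Nat.eqb_spec k j) as [->|Hk].
    + split; [|intros _];
      [apply is_poly_weaken|]; apply (is_poly_ext (p := fun rho => fold_right Rmult 1 (map (F rho) l)));
      auto; intros; ring.
    + assert (Hlin : forall n, is_poly n (fun rho => fold_right Rmult 1 (map (F rho) l)) ->
        is_poly (S n) (fun rho => (rho - c k) / (c j - c k) * fold_right Rmult 1 (map (F rho) l))).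
      { intros n Hn.
        apply (is_poly_ext (p := fun rho => (/ (c j - c k) * rho + - (c k / (c j - c k))) *
          fold_right Rmult 1 (map (F rho) l))).
        - intros x. unfold Rdiv. ring.
        - now apply is_poly_linear. }
      split; [now apply Hlin|]. intros [Heq|Hin]; [now elim Hk|]. apply Hlin. auto. }
destruct (G (seq 0 s)) as [_ G2]. rewrite length_seq in G2.
apply G2. apply in_seq. lia.
Qed.

Lemma lagrange_node j k : (j < s)%nat -> (k < s)%nat ->
  lagrange s c j (c k) = if Nat.eqb j k then 1 else 0.
Proof.
intros Hj Hk. unfold lagrange.
assert (G : forall l, (forall i, In i l -> (i < s)%nat) ->
  fold_right Rmult 1 (map (fun i => if Nat.eqb i j then 1 else (c k - c i) / (c j - c i)) l) =
  if Nat.eqb j k then 1 else if in_dec Nat.eq_dec k l then 0 else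
  fold_right Rmult 1 (map (fun i => if Nat.eqb i j then 1 else (c k - c i) / (c j - c i)) l)).
{ induction l as [|i l IH]; intros Hl.
  - simpl. now destruct (Nat.eqb j k).
  - simpl map. simpl fold_right.
    rewrite IH by (intros; apply Hl; now right).
    destruct (Nat.eqb_spec j k) as [->|Hjk].
    + destruct (Nat.eqb_spec i k) as [->|Hik]; [ring|]. field.
      apply collocation_neq; auto. apply Hl. now left.
    + destruct (in_dec Nat.eq_dec k (i :: l)) as [Hin|Hn], (in_dec Nat.eq_dec k l) as [Hin'|Hn'].
      * ring.
      * destruct Hin as [->|]; [|now elim Hn'].
        destruct (Nat.eqb_spec k j) as [->|]; [now elim Hjk|].
        unfold Rdiv. ring.
      * elim Hn. now right.
      * reflexivity. }
rewrite G by (intros i Hi; apply in_seq in Hi; lia).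
destruct (Nat.eqb j k); auto.
destruct (in_dec Nat.eq_dec k (seq 0 s)) as [|Hn]; auto.
elim Hn. apply in_seq. lia.
Qed.

(** The difference of the two sides has [s] coefficients and vanishes at the [s] distinct nodes. *)
Lemma lagrange_monomial k rho : (k < s)%nat ->
  sum_n (fun i => lagrange s c i rho * c i ^ k) (pred s) = rho ^ k.
Proof.
intros Hk. assert (Hs := proj1 Hc).
set (p := fun x => sum_n (fun i => lagrange s c i x * c i ^ k) (pred s) + (-1) * x ^ k).
assert (Hp : is_poly s p).
{ apply is_poly_plus.
  - assert (G : forall n, (n < s)%nat ->
      is_poly s (fun x => sum_n (fun i => lagrange s c i x * c i ^ k) n)).
    { induction n as [|n IH]; intros Hn.
      - apply (is_poly_ext (p := fun x => c 0%nat ^ k * lagrange s c 0 x)).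
        + intros x. rewrite sum_O. ring.
        + apply is_poly_scal, lagrange_poly. lia.
      - apply (is_poly_ext (p := fun x => sum_n (fun i => lagrange s c i x * c i ^ k) n +
          c (S n) ^ k * lagrange s c (S n) x)).
        + intros x. rewrite sum_Sn. unfold plus; simpl. ring.
        + apply is_poly_plus; [apply IH; lia|]. now apply is_poly_scal, lagrange_poly. }
    apply G. lia.
  - apply is_poly_scal, (is_poly_le (n := S k)); [lia|apply is_poly_pow]. }
assert (H0 : p rho = 0).
{ apply (is_poly_roots (l := map c (seq 0 s))).
  - apply NoDup_nth with (d := 0). rewrite length_map, length_seq. intros i j Hi Hj.
    rewrite !(nth_indep _ 0 (c 0%nat)) by (rewrite length_map, length_seq; auto).
    rewrite !map_nth, !seq_nth by auto. simpl. intros Hij.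
    destruct (Nat.eq_dec i j) as [|Hne]; auto.
    elim (proj2 (proj2 Hc) i j Hi Hj Hne Hij).
  - now rewrite length_map, length_seq.
  - intros r Hr. apply in_map_iff in Hr. destruct Hr as [j [<- Hj]].
    apply in_seq in Hj. unfold p.
    assert (G : forall n, (n < s)%nat ->
      sum_n (fun i => lagrange s c i (c j) * c i ^ k) n = if le_dec j n then c j ^ k else 0).
    { induction n as [|n IH]; intros Hn.
      - rewrite sum_O, lagrange_node by lia.
        match goal with |- @eq _ ?a ?b => change (@eq R a b) end.
        destruct (le_dec j 0), (Nat.eqb_spec 0 j); try lia; try subst; ring.
      - rewrite sum_Sn, IH, lagrange_node by lia. unfold plus; cbn -[Nat.eqb].
        match goal with |- @eq _ ?a ?b => change (@eq R a b) end.
        destruct (le_dec j n), (le_dec j (S n)), (Nat.eqb_spec (S n) j);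
        try lia; try subst; ring. }
    rewrite G by lia. destruct (le_dec j (pred s)); [ring|lia]. }
unfold p in H0. lra.
Qed.

Lemma lagrange_continuous j t : continuous (lagrange s c j) t.
Proof.
unfold lagrange. induction (seq 0 s) as [|k l IH]; simpl; [apply continuous_const|].
apply continuous_R_mult; auto.
destruct (Nat.eqb k j); [apply continuous_const|].
apply (@ex_derive_continuous R_AbsRing R_NormedModule). auto_derive. auto.
Qed.

Section VectorInterpolation.

Variable X : CompleteNormedModule R_AbsRing.

Definition interpolant (G : nat -> X) (rho : R) : X :=
  sum_n (fun i => scal (lagrange s c i rho) (G i)) (pred s).

Lemma sum_n_vle (a : nat -> X) b n : (forall i, (i <= n)%nat -> norm (a i) <= b) ->
  norm (sum_n a n) <= INR (S n) * b.
Proof.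
induction n as [|n IH]; intros H.
- rewrite sum_O. simpl. rewrite Rmult_1_l. now apply H.
- rewrite sum_Sn, S_INR. eapply Rle_trans; [apply norm_plus_le|].
  specialize (IH ltac:(intros; apply H; lia)). specialize (H (S n) (le_n _)). lra.
Qed.

Lemma interpolant_minus G1 G2 rho :
  minus (interpolant G1 rho) (interpolant G2 rho) =
  interpolant (fun i => minus (G1 i) (G2 i)) rho.
Proof.
unfold interpolant. induction (pred s) as [|n IH].
- rewrite !sum_O. vring X.
- rewrite !sum_Sn, <- IH. vring X.
Qed.

Lemma interpolant_plus G1 G2 rho :
  plus (interpolant G1 rho) (interpolant G2 rho) =
  interpolant (fun i => plus (G1 i) (G2 i)) rho.
Proof.
unfold interpolant. induction (pred s) as [|n IH].
- rewrite !sum_O. vring X.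
- rewrite !sum_Sn, <- IH. vring X.
Qed.

Lemma interpolant_monomial k (h : R) (v : X) rho : (k < s)%nat ->
  interpolant (fun i => scal ((c i * h) ^ k) v) rho = scal ((rho * h) ^ k) v.
Proof.
intros Hk. rewrite Rpow_mult_distr, <- (lagrange_monomial rho Hk).
unfold interpolant. induction (pred s) as [|n IH].
- rewrite !sum_O, Rpow_mult_distr. vring X.
- rewrite !sum_Sn, IH, Rpow_mult_distr. unfold plus at 2; simpl. vring X.
Qed.

Lemma interpolant_continuous G t : continuous (interpolant G) t.
Proof.
unfold interpolant. induction (pred s) as [|n IH].
- apply (continuous_ext (fun rho => scal (lagrange s c 0 rho) (G 0%nat))).
  + intros x. now rewrite sum_O.
  + apply continuous_scalX; [apply lagrange_continuous|apply continuous_const].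
- apply (continuous_ext (fun rho => plus (sum_n (fun i => scal (lagrange s c i rho) (G i)) n)
    (scal (lagrange s c (S n) rho) (G (S n))))).
  + intros x. now rewrite sum_Sn.
  + apply continuous_plusX; auto.
    apply continuous_scalX; [apply lagrange_continuous|apply continuous_const].
Qed.

Definition lebesgue_bound (Lam : R) : Prop :=
  0 < Lam /\ forall (G : nat -> X) b rho, 0 <= rho <= 1 ->
    (forall i, (i < s)%nat -> norm (G i) <= b) -> norm (interpolant G rho) <= Lam * b.

Lemma lebesgue_bound_exists : exists Lam, lebesgue_bound Lam.
Proof.
assert (Hs := proj1 Hc).
assert (H : forall n, exists L, 0 < L /\ forall j rho, (j < n)%nat -> 0 <= rho <= 1 ->
  Rabs (lagrange s c j rho) <= L).
{ induction n as [|n [L [HL IH]]].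
  - exists 1. split; [lra|]. intros; lia.
  - destruct (bounded_continuity (V := R_NormedModule) (lagrange s c n) 0 1) as [L' HL'].
    { intros x _. apply lagrange_continuous. }
    exists (Rmax L L'). split; [eapply Rlt_le_trans; [exact HL|apply Rmax_l]|].
    intros j rho Hj Hr. destruct (Nat.eq_dec j n) as [->|].
    + eapply Rle_trans; [left; exact (HL' rho Hr)|apply Rmax_r].
    + eapply Rle_trans; [apply IH; auto; lia|apply Rmax_l]. }
destruct (H s) as [L [HL HL']].
exists (INR (S (pred s)) * L). split.
{ apply Rmult_lt_0_compat; auto. apply lt_0_INR. lia. }
intros G b rho Hr Hb. rewrite Rmult_assoc. unfold interpolant. apply sum_n_vle.
intros i Hi. rewrite norm_scalR. apply Rmult_le_compat.
- apply Rabs_pos.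
- apply norm_ge0.
- apply HL'; auto. lia.
- apply Hb. lia.
Qed.

(** Constants are reproduced, so the value at the target can be subtracted from all data. This bound
    stays available without a finite supremum of the derivative of order [s]. *)
Lemma interpolation_oscillation Lam (f : R -> X) a h rho b :
  lebesgue_bound Lam -> 0 <= rho <= 1 ->
  (forall i, (i < s)%nat -> norm (minus (f (a + c i * h)) (f (a + rho * h))) <= b) ->
  norm (minus (interpolant (fun i => f (a + c i * h)) rho) (f (a + rho * h))) <= Lam * b.
Proof.
intros [_ HL] Hr Hb. assert (Hs := proj1 Hc).
assert (E1 : f (a + rho * h) = interpolant (fun i => scal ((c i * h) ^ 0) (f (a + rho * h))) rho).
{ rewrite interpolant_monomial by lia. simpl. vring X. }
rewrite E1 at 1. rewrite interpolant_minus. apply HL; auto.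
intros i Hi. simpl. replace (scal 1 (f (a + rho * h))) with (f (a + rho * h)) by vring X.
now apply Hb.
Qed.

Fixpoint vpoly (q : nat) (v : nat -> X) (x : R) : X :=
  match q with
  | O => zero
  | S k => plus (vpoly k v x) (scal (x ^ k) (v k))
  end.

Lemma vpoly_0 q v : vpoly (S q) v 0 = v 0%nat.
Proof.
induction q as [|q IH].
- simpl. vring X.
- change (vpoly (S (S q)) v 0) with (plus (vpoly (S q) v 0) (scal (0 ^ S q) (v (S q)))).
  rewrite IH, pow_i by lia. vring X.
Qed.

Lemma vpoly_interpolant q v h rho : (q <= s)%nat ->
  interpolant (fun i => vpoly q v (c i * h)) rho = vpoly q v (rho * h).
Proof.
induction q as [|q IH]; intros Hq; simpl.
- unfold interpolant. induction (pred s) as [|n IHn].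
  + rewrite sum_O. vring X.
  + rewrite sum_Sn, IHn. vring X.
- rewrite <- IH by lia. rewrite <- (interpolant_monomial h (v q) rho) by lia.
  now rewrite interpolant_plus.
Qed.

Lemma vpoly_derive q v v' a t :
  (forall k, v' (S k) = scal (/ INR (S k)) (v k)) ->
  is_derive (fun r => vpoly (S q) v' (r - a)) t (vpoly q v (t - a)).
Proof.
intros Hv. induction q as [|q IH].
- simpl. apply (is_derive_ext (fun _ => v' 0%nat)).
  + intros r. vring X.
  + apply (@is_derive_const R_AbsRing X).
- change (vpoly (S q) v (t - a)) with (plus (vpoly q v (t - a)) (scal ((t - a) ^ q) (v q))).
  apply (is_derive_ext (fun r => plus (vpoly (S q) v' (r - a)) (scal ((r - a) ^ S q) (v' (S q))))).
  { reflexivity. }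
  apply (@is_derive_plus R_AbsRing X); auto.
  replace (scal ((t - a) ^ q) (v q)) with (scal (INR (S q) * (t - a) ^ q) (v' (S q))).
  + apply (is_derive_scal_l (V := X)). assert (Hd : is_derive (fun r => r - a) t 1) by (auto_derive; auto; ring).
    evar_last; [exact (is_derive_pow (fun r => r - a) (S q) t 1 Hd)|].
    rewrite Rmult_1_r. reflexivity.
  + rewrite Hv. assert (Hq : INR (S q) <> 0) by (apply not_0_INR; lia).
    revert Hq. generalize (INR (S q)) as r. intros r Hr. vfield X. exact Hr.
Qed.

Lemma is_derive_eps_inv (f : R -> X) t l : is_derive f t l ->
  forall e, 0 < e -> exists d, 0 < d /\ forall r, Rabs (r - t) < d ->
    norm (minus (minus (f r) (f t)) (scal (r - t) l)) <= e * Rabs (r - t).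
Proof.
intros [_ H] e He.
destruct (H t (fun P HP => HP) (mkposreal e He)) as [d Hd].
exists d. split; [apply cond_pos|]. intros r Hr. exact (Hd r Hr).
Qed.

Lemma is_derive_on_eps (D : R -> Prop) (f : R -> X) t l : is_derive_on D f t l ->
  forall e, 0 < e -> exists d, 0 < d /\ forall r, D r -> Rabs (r - t) < d ->
    norm (minus (minus (f r) (f t)) (scal (r - t) l)) <= e * Rabs (r - t).
Proof.
intros H e He. unfold is_derive_on in H.
destruct (proj1 (filterlim_eps _ _) H e He) as [d Hd].
exists d. split; [apply cond_pos|]. intros r Hr Hrd.
destruct (Req_dec r t) as [->|Hne].
- rewrite Rminus_diag, Rabs_R0, Rmult_0_r.
  right. transitivity (norm (@zero X)); [f_equal; vring X|apply norm0].
- specialize (Hd r Hrd (conj Hr Hne)).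
  replace (minus (minus (f r) (f t)) (scal (r - t) l)) with
    (scal (r - t) (minus (scal (/ (r - t)) (minus (f r) (f t))) l)) by (vfield X; lra).
  rewrite norm_scalR, Rmult_comm. apply Rmult_le_compat_r; [apply Rabs_pos|].
  left; exact Hd.
Qed.

Lemma is_derive_n_on_continuous (D : R -> Prop) (f : R -> X) j F :
  is_derive_n_on D f (S j) F ->
  forall t, D t -> forall e, 0 < e -> exists d, 0 < d /\
    forall r, D r -> Rabs (r - t) < d -> norm (minus (f r) (f t)) < e.
Proof.
revert F; induction j as [|j IH]; intros F [fj [H1 H2]].
- intros t Ht e He. simpl in H1.
  destruct (is_derive_on_eps (H2 t Ht) Rlt_0_1) as [d [Hd H]].
  assert (HF := norm_ge0 (F t)).
  exists (Rmin d (e / (norm (F t) + 2))). split.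
  { apply Rmin_pos; auto. apply Rdiv_lt_0_compat; lra. }
  intros r Hr Hrd.
  assert (Hr1 : Rabs (r - t) < d) by (eapply Rlt_le_trans; [exact Hrd|apply Rmin_l]).
  assert (Hr2 : Rabs (r - t) < e / (norm (F t) + 2))
    by (eapply Rlt_le_trans; [exact Hrd|apply Rmin_r]).
  rewrite <- !H1 by auto. specialize (H r Hr Hr1).
  eapply Rle_lt_trans; [apply (norm_le_minus _ (scal (r - t) (F t)))|].
  rewrite norm_scalR. pose proof (Rabs_pos (r - t)).
  apply (Rmult_lt_compat_r (norm (F t) + 2)) in Hr2; [|lra].
  replace (e / (norm (F t) + 2) * (norm (F t) + 2)) with e in Hr2 by (field; lra). nra.
- apply (IH fj H1).
Qed.

(** One order of differentiation is removed at a time: the bound on a derivative minus a polynomial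
    is integrated by the mean value inequality. This gives up the factorial but asks only for
    derivatives relative to [D]. *)
Lemma taylor_on (D : R -> Prop) (f : R -> X) a b S : 0 <= S ->
  (forall t, a <= t <= b -> D t) ->
  forall j F q v, is_derive_n_on D f j F ->
  (forall t, a <= t <= b -> norm (minus (F t) (vpoly q v (t - a))) <= S * (t - a) ^ q) ->
  exists v', forall t, a <= t <= b ->
    norm (minus (f t) (vpoly (q + j) v' (t - a))) <= S * (t - a) ^ (q + j).
Proof.
intros HS0 HD. induction j as [|j IH]; intros F q v HF Hb.
- exists v. intros t Ht. rewrite Nat.add_0_r. simpl in HF.
  rewrite <- HF by auto. now apply Hb.
- destruct HF as [fj [HF1 HF2]].
  (* Coefficients of the antiderivative polynomial, with the value of [fj] at [a] as constant
     term. *)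
  pose (v' := fun k => match k with O => fj a | Datatypes.S k => scal (/ INR (Datatypes.S k)) (v k) end).
  assert (Hder := fun t => @vpoly_derive q v v' a t (fun k => eq_refl)).
  replace (q + Datatypes.S j)%nat with (Datatypes.S q + j)%nat by lia.
  apply (IH fj (Datatypes.S q) v' HF1). intros t Ht.
  set (r := (fun t => minus (fj t) (vpoly (Datatypes.S q) v' (t - a))) : R -> X).
  assert (Hloc : forall x, a <= x <= b -> forall e, 0 < e -> exists d, 0 < d /\
    forall y, a <= y <= b -> Rabs (y - x) < d ->
    norm (minus (minus (r y) (r x)) (scal (y - x) (minus (F x) (vpoly q v (x - a)))))
      <= e * Rabs (y - x)).
  { intros x Hx e He.
    destruct (is_derive_on_eps (HF2 x (HD x Hx)) (e := e / 2)) as [d1 [Hd1 H1]]; [lra|].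
    destruct (is_derive_eps_inv (Hder x) (e := e / 2)) as [d2 [Hd2 H2]]; [lra|].
    exists (Rmin d1 d2). split; [now apply Rmin_pos|]. intros y Hy Hyx.
    specialize (H1 y (HD y Hy) ltac:(eapply Rlt_le_trans; [exact Hyx|apply Rmin_l])).
    specialize (H2 y ltac:(eapply Rlt_le_trans; [exact Hyx|apply Rmin_r])).
    replace (minus _ _) with (minus (minus (minus (fj y) (fj x)) (scal (y - x) (F x)))
      (minus (minus (vpoly (Datatypes.S q) v' (y - a)) (vpoly (Datatypes.S q) v' (x - a)))
      (scal (y - x) (vpoly q v (x - a))))) by (unfold r; vring X).
    eapply Rle_trans; [apply norm_minus_le|]. eapply Rle_trans; [apply Rplus_le_compat; [exact H1|exact H2]|lra]. }
  assert (Hmv : norm (minus (r t) (r a)) <= S * (t - a) ^ q * (t - a)).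
  { apply mean_value_right; [lra| |].
    - intros x Hx e He.
      destruct (Hloc x ltac:(lra) 1 Rlt_0_1) as [d [Hd H]].
      set (n := norm (minus (F x) (vpoly q v (x - a)))) in *.
      assert (Hn : 0 <= n) by apply norm_ge0.
      exists (Rmin d (e / (n + 2))). split.
      { apply Rmin_pos; auto. apply Rdiv_lt_0_compat; lra. }
      intros y Hy Hyx.
      assert (Hy1 : x - y < d) by (eapply Rlt_le_trans; [exact Hyx|apply Rmin_l]).
      assert (Hy2 : x - y < e / (n + 2)) by (eapply Rlt_le_trans; [exact Hyx|apply Rmin_r]).
      assert (Hab : Rabs (y - x) = x - y) by (rewrite Rabs_left1; lra).
      specialize (H y ltac:(lra) ltac:(lra)). rewrite Hab in H.
      rewrite norm_minus_sym.
      eapply Rle_lt_trans; [apply (norm_le_minus _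
        (scal (y - x) (minus (F x) (vpoly q v (x - a)))))|].
      rewrite norm_scalR, Hab. fold n.
      apply (Rmult_lt_compat_r (n + 2)) in Hy2; [|lra].
      replace (e / (n + 2) * (n + 2)) with e in Hy2 by (field; lra). nra.
    - intros x Hx e He.
      destruct (Hloc x ltac:(lra) e He) as [d [Hd H]].
      exists d. split; auto. intros y Hy Hyx.
      assert (Hab : Rabs (y - x) = y - x) by (rewrite Rabs_pos_eq; lra).
      specialize (H y ltac:(lra) ltac:(lra)). rewrite Hab in H.
      eapply Rle_trans; [apply (norm_le_minus _
        (scal (y - x) (minus (F x) (vpoly q v (x - a)))))|].
      rewrite norm_scalR, Hab.
      assert (norm (minus (F x) (vpoly q v (x - a))) <= S * (t - a) ^ q).
      { eapply Rle_trans; [apply Hb; lra|]. apply Rmult_le_compat_l; auto.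
        apply pow_incr. lra. }
      nra. }
  replace (minus (fj t) (vpoly (Datatypes.S q) v' (t - a))) with (minus (r t) (r a)).
  + eapply Rle_trans; [exact Hmv|]. simpl. right. ring.
  + unfold r. rewrite (Rminus_diag a), vpoly_0. unfold v' at 2. vring X.
Qed.

(** Taylor expansion started from the zero polynomial ends with degree below [s], which
    interpolation reproduces. The remainder enters through the data with factor [Lam] and at the
    target itself with factor 1. *)
Lemma interpolation_error Lam (D : R -> Prop) (f : R -> X) (fs : R -> X) a h S rho :
  lebesgue_bound Lam -> 0 <= h -> 0 <= rho <= 1 ->
  (forall t, a <= t <= a + h -> D t) -> is_derive_n_on D f s fs ->
  (forall t, a <= t <= a + h -> norm (fs t) <= S) ->
  norm (minus (interpolant (fun i => f (a + c i * h)) rho) (f (a + rho * h))) <=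
  (Lam + 1) * S * h ^ s.
Proof.
intros [HL0 HL] Hh Hr HD Hf HS.
assert (HS0 : 0 <= S).
{ specialize (HS a ltac:(lra)). pose proof (norm_ge0 (fs a)). lra. }
destruct (@taylor_on D f a (a + h) S HS0 HD s fs 0 (fun _ => zero) Hf) as [v Hv].
{ intros t Ht. simpl. rewrite Rmult_1_r.
  apply Rle_trans with (norm (fs t)); [right; f_equal; vring X|auto]. }
simpl in Hv.
assert (Hrem : forall x, 0 <= x <= 1 ->
  norm (minus (f (a + x * h)) (vpoly s v (x * h))) <= S * h ^ s).
{ intros x Hx. specialize (Hv (a + x * h) ltac:(nra)).
  replace (a + x * h - a) with (x * h) in Hv by ring.
  eapply Rle_trans; [exact Hv|]. apply Rmult_le_compat_l; auto.
  apply pow_incr. nra. }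
replace (minus (interpolant (fun i => f (a + c i * h)) rho) (f (a + rho * h))) with
  (minus (interpolant (fun i => minus (f (a + c i * h)) (vpoly s v (c i * h))) rho)
    (minus (f (a + rho * h)) (vpoly s v (rho * h)))).
- eapply Rle_trans; [apply norm_minus_le|].
  replace ((Lam + 1) * S * h ^ s) with (Lam * (S * h ^ s) + S * h ^ s) by ring.
  apply Rplus_le_compat; [|now apply Hrem].
  apply HL; auto. intros i Hi. apply Hrem. now apply Hc.
- rewrite <- interpolant_minus, vpoly_interpolant by lia. vring X.
Qed.

End VectorInterpolation.

End Lagrange.

(** * Error propagation along the mesh *)

Lemma finite_max (n : nat) (a : nat -> R) : (1 <= n)%nat ->
  exists i, (i < n)%nat /\ forall j, (j < n)%nat -> a j <= a i.
Proof.
induction n as [|n IH]; [lia|]. intros _. destruct n as [|n].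
- exists 0%nat. split; [lia|]. intros j Hj. replace j with 0%nat by lia. lra.
- destruct (IH ltac:(lia)) as [i [Hi H]].
  destruct (Rle_or_lt (a (S n)) (a i)).
  + exists i. split; [lia|]. intros j Hj. destruct (Nat.eq_dec j (S n)) as [->|]; auto.
    apply H. lia.
  + exists (S n). split; [lia|]. intros j Hj.
    destruct (Nat.eq_dec j (S n)) as [->|]; [lra|].
    specialize (H j ltac:(lia)). lra.
Qed.

(** A contraction of ratio 1/2 for the maximum norm on [s] components. All statements are restricted
    to indices below [s], since the unknown is a function on [nat]; the iteration starts at the
    centre of the ball. *)
Lemma finite_fixed_point (X : CompleteNormedModule R_AbsRing) (s : nat)
    (F : (nat -> X) -> nat -> X) (r : R) :
  0 <= r ->
  (forall z, (forall i, (i < s)%nat -> norm (z i) <= r) ->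
     forall i, (i < s)%nat -> norm (F z i) <= r) ->
  (forall z z' b, (forall i, (i < s)%nat -> norm (z i) <= r) ->
     (forall i, (i < s)%nat -> norm (z' i) <= r) ->
     (forall i, (i < s)%nat -> norm (minus (z i) (z' i)) <= b) ->
     forall i, (i < s)%nat -> norm (minus (F z i) (F z' i)) <= b / 2) ->
  exists z, (forall i, (i < s)%nat -> norm (z i) <= r) /\
    forall i, (i < s)%nat -> F z i = z i.
Proof.
intros Hr Hball Hcontr.
pose (v := fix v n := match n with O => fun _ : nat => @zero X | S k => F (v k) end).
assert (Hv : forall n i, (i < s)%nat -> norm (v n i) <= r).
{ induction n as [|n IH]; intros i Hi; simpl; [rewrite norm0; auto|]. now apply Hball. }
assert (Hd : forall n i, (i < s)%nat -> norm (minus (v (S n) i) (v n i)) <= 2 * r * (/ 2) ^ n).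
{ induction n as [|n IH]; intros i Hi.
  - eapply Rle_trans; [apply norm_minus_le|].
    pose proof (Hv 1%nat i Hi). pose proof (Hv 0%nat i Hi). simpl in *. lra.
  - replace (2 * r * (/ 2) ^ S n) with (2 * r * (/ 2) ^ n / 2) by (simpl; field).
    apply (Hcontr (v (S n)) (v n)); auto. }
assert (Hlim : forall i, exists l, (i < s)%nat -> forall e, 0 < e -> exists n0, forall n,
  (n0 <= n)%nat -> norm (minus (v n i) l) < e).
{ intros i. destruct (lt_dec i s) as [Hi|Hi].
  - destruct (geometric_seq_lim (v := fun n => v n i) (b := 2 * r) (q := / 2)) as [l [Hl _]].
    + lra.
    + intros n. now apply Hd.
    + exists l. auto.
  - exists zero. intros; lia. }
pose (z := fun i => proj1_sig (constructive_indefinite_description _ (Hlim i))).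
assert (Hz : forall i, (i < s)%nat -> forall e, 0 < e -> exists n0, forall n,
  (n0 <= n)%nat -> norm (minus (v n i) (z i)) < e).
{ intros i. unfold z. now destruct (constructive_indefinite_description _ _). }
clearbody z.
assert (Hzr : forall i, (i < s)%nat -> norm (z i) <= r).
{ intros i Hi. apply Rle_trans with (norm (minus (z i) zero)).
  - right. f_equal. vring X.
  - apply (norm_lim_le (F := eventually) (Hz i Hi)). exists 0%nat. intros n _.
    apply Rle_trans with (norm (v n i)); [right; f_equal; vring X|auto]. }
exists z. split; auto. intros i Hi. apply norm_small_eq. intros e He.
assert (Hu : exists n0, forall n, (n0 <= n)%nat -> forall j, (j < s)%nat ->
  norm (minus (v n j) (z j)) <= e / 2).
{ clear i Hi. assert (G : forall k, (k <= s)%nat -> exists n0, forall n, (n0 <= n)%nat ->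
    forall j, (j < k)%nat -> norm (minus (v n j) (z j)) <= e / 2).
  { induction k as [|k IH]; intros Hk.
    - exists 0%nat. intros; lia.
    - destruct (IH ltac:(lia)) as [n1 H1].
      destruct (Hz k ltac:(lia) (e / 2) ltac:(lra)) as [n2 H2].
      exists (max n1 n2). intros n Hn j Hj.
      destruct (Nat.eq_dec j k) as [->|].
      + left. apply H2. lia.
      + apply H1; lia. }
  now apply G. }
destruct Hu as [n0 Hn0].
eapply Rle_trans; [apply (norm_minus_tri _ (v (S n0) i))|].
specialize (Hn0 (S n0) ltac:(lia) i Hi) as H1.
assert (H2 : norm (minus (F z i) (v (S n0) i)) <= e / 2 / 2).
{ simpl. apply Hcontr; auto. intros j Hj. rewrite norm_minus_sym. now apply Hn0. }
lra.
Qed.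

(** Composition with it extends a function from an interval to the line, so that results on globally
    continuous functions apply. *)
Definition clamp (a b t : R) : R := Rmax a (Rmin t b).

Lemma clamp_id a b t : a <= t <= b -> clamp a b t = t.
Proof. intros H. unfold clamp. rewrite Rmin_left, Rmax_right; lra. Qed.

Lemma clamp_bounds a b t : a <= b -> a <= clamp a b t <= b.
Proof.
intros H. unfold clamp. split; [apply Rmax_l|]. apply Rmax_lub; auto. apply Rmin_r.
Qed.

Lemma clamp_lipschitz a b t r : a <= b -> Rabs (clamp a b t - clamp a b r) <= Rabs (t - r).
Proof.
intros H. unfold clamp, Rmax, Rmin.
destruct (Rle_dec t b), (Rle_dec r b);
repeat destruct (Rle_dec _ _); split_Rabs; lra.
Qed.

Lemma continuous_clamp (X : CompleteNormedModule R_AbsRing) (D : R -> X) a b t : a <= b ->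
  (forall r, a <= r <= b -> forall e, 0 < e -> exists d, 0 < d /\
     forall q, a <= q <= b -> Rabs (q - r) < d -> norm (minus (D q) (D r)) < e) ->
  continuous (fun r => D (clamp a b r)) t.
Proof.
intros Hab HD. apply continuous_eps. intros e He.
destruct (HD (clamp a b t) (clamp_bounds t Hab) e He) as [d [Hd H]].
exists d. split; auto. intros r Hr. apply H; [now apply clamp_bounds|].
eapply Rle_lt_trans; [now apply clamp_lipschitz|auto].
Qed.

Section OneStep.

Variable X : CompleteNormedModule R_AbsRing.
Variables (E : R -> X -> X) (V : X -> X) (alpha MV M C : R).
Hypothesis Halpha : 0 <= alpha < 1.
Hypothesis HS : smoothing_scale E V alpha MV M C.
Variables (s : nat) (c : nat -> R).
Hypothesis Hc : collocation_parameters s c.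

Let HE := ss_semigroup HS.
Let kp := kernel_primitive alpha.

Lemma Epos_plus t (x y : X) : Epos E t (plus x y) = plus (Epos E t x) (Epos E t y).
Proof. unfold Epos. apply (E_plus HE). apply Rmax_l. Qed.

Lemma Epos_minus t (x y : X) : Epos E t (minus x y) = minus (Epos E t x) (Epos E t y).
Proof. unfold Epos. apply (E_minus HE). apply Rmax_l. Qed.

Lemma convolution_vle_on (D : R -> X) (b r l : R) :
  (forall q, continuous D q) -> 0 <= r -> 0 <= l ->
  (forall q, 0 <= q <= l -> norm (D q) <= b) ->
  vle V (RInt (fun q => Epos E (q + r) (D q)) 0 l) (C * b * (kp (l + r) - kp r)).
Proof.
intros HD Hr Hl Hb.
rewrite (RInt_ext (V := X) _ (fun q => Epos E (q + r) (D (clamp 0 l q)))).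
- apply (convolution_vle Halpha HS (D := fun q => D (clamp 0 l q))); auto.
  + intros q. apply continuous_clamp; auto. intros p _ e He.
    destruct (proj1 (continuous_eps D p) (HD p) e He) as [d [Hd H]].
    exists d. split; auto.
  + intros q. apply Hb. now apply clamp_bounds.
- rewrite Rmin_left, Rmax_right by auto. intros q Hq. now rewrite clamp_id by lra.
Qed.

Lemma convolution_shift (D : R -> X) (r l : R) : 0 <= r -> 0 <= l ->
  (forall q, continuous D q) ->
  E r (RInt (fun q => Epos E q (D q)) 0 l) = RInt (fun q => Epos E (q + r) (D q)) 0 l.
Proof.
intros Hr Hl HD. destruct (E_bl HE Hr) as [Mr HMr].
rewrite (bl_RInt HMr) by (apply ex_RInt_cont; intros q; apply (Epos_joint HE); auto).
apply (RInt_ext (V := X)). rewrite Rmin_left by auto. intros q Hq.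
rewrite !(@Epos_eq X), <- (E_add HE) by lra. f_equal. ring.
Qed.

Lemma continuous_affine (F : R -> X) (p q t : R) :
  (forall r, continuous F r) -> continuous (fun r => F (p - r * q)) t.
Proof.
intros HF. apply (continuous_comp (fun r : R => p - r * q) F); auto.
apply (@ex_derive_continuous R_AbsRing R_NormedModule). auto_derive. auto.
Qed.

Lemma erkc_update_ext h theta w G1 G2 : (forall i, (i < s)%nat -> G1 i = G2 i) ->
  erkc_update E s c h theta w G1 = erkc_update E s c h theta w G2.
Proof.
intros H. unfold erkc_update. do 2 f_equal. apply sum_n_ext_loc. intros i Hi.
assert (Hs := proj1 Hc). rewrite H; auto. lia.
Qed.

(** The substitution q = (theta - rho) h turns each exponential coefficient into a convolution, and
    linearity collects the terms into one interpolant. *)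
Lemma erkc_update_conv h theta w G : 0 < h -> 0 <= theta ->
  erkc_update E s c h theta w G =
  plus (E (theta * h) w)
    (RInt (fun q => Epos E q (interpolant s c G (theta - q * / h))) 0 (theta * h)).
Proof.
intros Hh Ht. unfold erkc_update. f_equal. unfold interpolant.
assert (Hterm : forall i, scal h (b_coef E s c h i theta (G i)) =
  RInt (fun q => Epos E q (scal (lagrange s c i (theta - q * / h)) (G i))) 0 (theta * h)).
{ intros i.
  set (F := fun q => Epos E q (scal (lagrange s c i (theta - q * / h)) (G i))).
  assert (HF : forall q, continuous F q).
  { intros q. apply (Epos_joint HE (D := fun q => scal (lagrange s c i (theta - q * / h)) (G i))).
    apply (@continuous_affine (fun p => scal (lagrange s c i p) (G i))).
    intros r. apply continuous_scalX; [apply lagrange_continuous|].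
    apply continuous_const. }
  assert (H : is_RInt (fun y => scal (- h) (F (- h * y + theta * h))) 0 theta
    (opp (RInt F 0 (theta * h)))).
  { apply (is_RInt_comp_lin (V := X)).
    replace (- h * 0 + theta * h) with (theta * h) by ring.
    replace (- h * theta + theta * h) with 0 by ring.
    apply (is_RInt_swap (V := X)). apply (RInt_correct (V := X)). now apply ex_RInt_cont. }
  apply (is_RInt_scal (V := X) _ _ _ (- / h)) in H.
  unfold b_coef.
  transitivity (scal h (scal (- / h) (opp (RInt F 0 (theta * h))))).
  2:{ vfield X. lra. }
  f_equal. apply (is_RInt_unique (V := X)). eapply is_RInt_ext; [|exact H].
  rewrite Rmin_left, Rmax_right by lra. intros x Hx. cbv beta. unfold F.
  rewrite (@Epos_eq X) by nra. rewrite (E_scal HE) by nra.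
  replace (theta - (- h * x + theta * h) * / h) with x by (field; lra).
  replace (- h * x + theta * h) with ((theta - x) * h) by ring.
  vfield X. lra. }
assert (Hs : forall n, scal h (sum_n (fun i => b_coef E s c h i theta (G i)) n) =
  RInt (fun q => Epos E q (sum_n (fun i => scal (lagrange s c i (theta - q * / h)) (G i)) n))
    0 (theta * h)).
{ induction n as [|n IH].
  - rewrite sum_O, Hterm. apply (RInt_ext (V := X)). intros q _. now rewrite sum_O.
  - rewrite sum_Sn.
    replace (scal h (plus (sum_n (fun i => b_coef E s c h i theta (G i)) n)
      (b_coef E s c h (S n) theta (G (S n))))) with
      (plus (scal h (sum_n (fun i => b_coef E s c h i theta (G i)) n))
      (scal h (b_coef E s c h (S n) theta (G (S n))))) by vring X.
    rewrite IH, Hterm.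
    rewrite <- (RInt_plus (V := X)).
    + apply (RInt_ext (V := X)). intros q _. rewrite sum_Sn. now rewrite Epos_plus.
    + apply ex_RInt_cont. intros q.
      apply (Epos_joint HE (D := fun q => sum_n (fun i => scal (lagrange s c i (theta - q * / h)) (G i)) n)).
      apply (@continuous_affine (fun p => sum_n (fun i => scal (lagrange s c i p) (G i)) n)).
      intros r. clear. induction n as [|n IH].
      * apply (continuous_ext (fun p => scal (lagrange s c 0 p) (G 0%nat))).
        { intros p. now rewrite sum_O. }
        apply continuous_scalX; [apply lagrange_continuous|apply continuous_const].
      * apply (continuous_ext (fun p => plus (sum_n (fun i => scal (lagrange s c i p) (G i)) n)
          (scal (lagrange s c (S n) p) (G (S n))))).
        { intros p. now rewrite sum_Sn. }
        apply continuous_plusX; auto.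
        apply continuous_scalX; [apply lagrange_continuous|apply continuous_const].
    + apply ex_RInt_cont. intros q.
      apply (Epos_joint HE (D := fun q => scal (lagrange s c (S n) (theta - q * / h)) (G (S n)))).
      apply (@continuous_affine (fun p => scal (lagrange s c (S n) p) (G (S n)))).
      intros r. apply continuous_scalX; [apply lagrange_continuous|apply continuous_const]. }
apply Hs.
Qed.

Lemma update_interpolant_continuous (G : nat -> X) theta h t :
  continuous (fun q => interpolant s c G (theta - q * / h)) t.
Proof.
apply (@continuous_affine (interpolant s c G)). intros r. now apply interpolant_continuous.
Qed.

Lemma rho_range h theta q : 0 < h -> 0 <= theta <= 1 -> 0 <= q <= theta * h ->
  0 <= theta - q * / h <= 1.
Proof.
intros Hh Ht Hq. assert (0 < / h) by now apply Rinv_0_lt_compat.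
assert (q * / h <= theta).
{ apply (Rmult_le_reg_r h); auto. rewrite Rmult_assoc, Rinv_l by lra. lra. }
assert (0 <= q * / h) by nra. lra.
Qed.

Lemma update_diff_vle h theta w G1 G2 b : 0 < h -> 0 <= theta <= 1 ->
  (forall rho, 0 <= rho <= 1 ->
     norm (minus (interpolant s c G1 rho) (interpolant s c G2 rho)) <= b) ->
  vle V (minus (erkc_update E s c h theta w G1) (erkc_update E s c h theta w G2))
    (C * b * kp (theta * h)).
Proof.
intros Hh Ht Hb.
set (D := fun q => minus (interpolant s c G1 (theta - q * / h))
  (interpolant s c G2 (theta - q * / h))).
assert (HD : forall q, continuous D q).
{ intros q. apply continuous_minusX; apply update_interpolant_continuous. }
assert (Hth : 0 <= theta * h) by (apply Rmult_le_pos; lra).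
assert (H := @convolution_vle_on D b 0 (theta * h) HD (Rle_refl 0) Hth).
rewrite Rplus_0_r in H. unfold kp in H at 2. rewrite kernel_primitive_0, Rminus_0_r in H.
rewrite !erkc_update_conv by lra.
replace (minus _ _) with (RInt (fun q => Epos E (q + 0) (D q)) 0 (theta * h)).
- apply H. intros q Hq. apply Hb. now apply rho_range.
- rewrite (RInt_ext (V := X) _ (fun q => minus
    (Epos E q (interpolant s c G1 (theta - q * / h)))
    (Epos E q (interpolant s c G2 (theta - q * / h))))).
  + rewrite (RInt_minus (V := X)).
    * vring X.
    * apply ex_RInt_cont. intros q.
      apply (Epos_joint HE (D := fun q => interpolant s c G1 (theta - q * / h))).
      apply update_interpolant_continuous.
    * apply ex_RInt_cont. intros q.
      apply (Epos_joint HE (D := fun q => interpolant s c G2 (theta - q * / h))).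
      apply update_interpolant_continuous.
  + intros q _. rewrite Rplus_0_r. apply Epos_minus.
Qed.

Section ExactSolution.

Variables (T : R) (u f : R -> X).
Hypothesis Hf : forall r, continuous (fun r => f (clamp 0 T r)) r.
Hypothesis Hu : forall r t, 0 <= r -> r <= t -> t <= T ->
  u t = plus (E (t - r) (u r)) (RInt (fun q => E (t - q) (f q)) r t).

Lemma exact_step a l : 0 <= a -> 0 <= l -> a + l <= T ->
  u (a + l) = plus (E l (u a)) (RInt (fun q => Epos E q (f (clamp 0 T (a + l - q)))) 0 l).
Proof.
intros Ha Hl Hal. rewrite (Hu (r := a)) by lra.
replace (a + l - a) with l by ring. f_equal.
set (F := fun q => Epos E q (f (clamp 0 T (a + l - q * 1)))).
assert (HF : forall q, continuous F q).
{ intros q. apply (Epos_joint HE (D := fun q => f (clamp 0 T (a + l - q * 1)))).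
  now apply (@continuous_affine (fun r => f (clamp 0 T r))). }
assert (H : is_RInt (fun y => scal (- 1) (F (- 1 * y + (a + l)))) a (a + l) (opp (RInt F 0 l))).
{ apply (is_RInt_comp_lin (V := X)).
  replace (-1 * a + (a + l)) with l by ring.
  replace (-1 * (a + l) + (a + l)) with 0 by ring.
  apply (is_RInt_swap (V := X)). apply (RInt_correct (V := X)). now apply ex_RInt_cont. }
apply (is_RInt_scal (V := X) _ _ _ (- 1)) in H.
transitivity (scal (- 1) (opp (RInt F 0 l))).
- apply (is_RInt_unique (V := X)). eapply is_RInt_ext; [|exact H].
  rewrite Rmin_left, Rmax_right by lra. intros x Hx. cbv beta. unfold F.
  rewrite (@Epos_eq X) by lra.
  replace (a + l - (-1 * x + (a + l)) * 1) with x by ring.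
  rewrite clamp_id by lra. replace (-1 * x + (a + l)) with (a + l - x) by ring. vring X.
- transitivity (RInt F 0 l); [vring X|]. apply (RInt_ext (V := X)). intros q _.
  unfold F. now rewrite Rmult_1_r.
Qed.

(** The numerical and the exact step obey a variation of constants formula on the same interval, so
    their difference, apart from the propagated initial error, is a convolution of the defect. The
    further propagation by [E r] is what lets the kernel contributions of successive steps
    telescope. *)
Lemma step_vle (h a theta r b : R) (w : X) (G : nat -> X) :
  0 < h -> 0 <= a -> a + h <= T -> 0 <= theta <= 1 -> 0 <= r ->
  (forall rho, 0 <= rho <= 1 ->
     norm (minus (interpolant s c G rho) (f (a + rho * h))) <= b) ->
  vle V (minus (E r (minus (erkc_update E s c h theta w G) (u (a + theta * h))))
      (E (r + theta * h) (minus w (u a))))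
    (C * b * (kp (theta * h + r) - kp r)).
Proof.
intros Hh Ha HaT Ht Hr Hb.
assert (Hth : 0 <= theta * h <= h) by nra.
set (D := fun q => minus (interpolant s c G (theta - q * / h))
  (f (clamp 0 T (a + theta * h - q * 1)))).
assert (Hc1 := @update_interpolant_continuous G theta h).
assert (Hc2 : forall q, continuous (fun q => f (clamp 0 T (a + theta * h - q * 1))) q).
{ intros q. now apply (@continuous_affine (fun r => f (clamp 0 T r))). }
assert (HD : forall q, continuous D q) by (intros q; apply continuous_minusX; auto).
assert (H := @convolution_vle_on D b r (theta * h) HD Hr (proj1 Hth)).
rewrite <- convolution_shift in H by (auto; lra).
replace (minus (E r (minus (erkc_update E s c h theta w G) (u (a + theta * h))))
  (E (r + theta * h) (minus w (u a)))) with
  (E r (RInt (fun q => Epos E q (D q)) 0 (theta * h))).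
- apply H. intros q Hq. unfold D. rewrite Rmult_1_r.
  rewrite clamp_id by lra.
  replace (a + theta * h - q) with (a + (theta - q * / h) * h) by (field; lra).
  apply Hb. now apply rho_range.
- rewrite erkc_update_conv, (exact_step (a := a) (l := theta * h)) by lra.
  rewrite (E_add HE), <- (E_minus HE) by lra. f_equal.
  rewrite (E_minus HE) by lra. unfold D.
  rewrite (RInt_ext (V := X) _ (fun q => minus
    (Epos E q (interpolant s c G (theta - q * / h)))
    (Epos E q (f (clamp 0 T (a + theta * h - q * 1)))))).
  + rewrite (RInt_minus (V := X)).
    * rewrite (RInt_ext (V := X) (fun q => Epos E q (f (clamp 0 T (a + theta * h - q * 1))))
        (fun q => Epos E q (f (clamp 0 T (a + theta * h - q))))).
      -- vring X.
      -- intros q _. now rewrite Rmult_1_r.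
    * apply ex_RInt_cont. intros q.
      now apply (Epos_joint HE (D := fun q => interpolant s c G (theta - q * / h))).
    * apply ex_RInt_cont. intros q.
      now apply (Epos_joint HE (D := fun q => f (clamp 0 T (a + theta * h - q * 1)))).
  + intros q _. apply Epos_minus.
Qed.

(* Gronwall with a weakly singular kernel: in the weighted norm
   [sup e^{-lam t} |e(t)|_V] the kernel [r^{-alpha}] has small mass, once the part
   [r <= eta] and the part [r >= eta], which is damped by [e^{-lam eta}], are
   separated.  [damped_kernel] is a primitive of a majorant of the kernel. *)
Variables (lam eta : R).
Hypothesis Hlam : 0 <= lam.
Hypothesis Heta : 0 < eta.

Definition damped_kernel (a : R) : R :=
  exp (- lam * eta) * kp a + 3 * Rmin (kp a) (kp (2 * eta)).

Definition damped_mass : R := exp (- lam * eta) * kp T + 3 * kp (2 * eta).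

Lemma kp_mono a b : a <= b -> kp a <= kp b.
Proof. now apply kernel_primitive_mono. Qed.

(** For r >= eta the weight is at most e^{-lam eta}, which is the first term of the majorant. For r
    < eta both arguments are below 2 eta, where the minimum is the primitive itself; this is why the
    cut is at 2 eta. *)
Lemma damped_kernel_step r h : 0 <= r -> 0 <= h <= eta ->
  exp (- lam * r) * (kp (h + r) - kp r) <= damped_kernel (h + r) - damped_kernel r.
Proof.
intros Hr Hh. unfold damped_kernel.
assert (H1 : kp r <= kp (h + r)) by (apply kp_mono; lra).
pose proof (exp_pos (- lam * eta)) as He.
destruct (Rle_or_lt eta r) as [Hle|Hlt].
- assert (H2 : exp (- lam * r) <= exp (- lam * eta)) by (apply exp_le_mono; nra).
  assert (H3 : Rmin (kp r) (kp (2 * eta)) <= Rmin (kp (h + r)) (kp (2 * eta))).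
  { apply Rle_min_compat_r; auto. }
  nra.
- assert (H2 : exp (- lam * r) <= 1) by (rewrite <- exp_0; apply exp_le_mono; nra).
  rewrite !Rmin_left by (apply kp_mono; lra). nra.
Qed.

(** The factor 3 pays for a partial step: there the weight is taken at the right end of the
    interval, and e^{lam h} <= e <= 3. *)
Lemma damped_kernel_near a : 0 <= a <= eta -> 3 * kp a <= damped_kernel a.
Proof.
intros Ha. unfold damped_kernel. rewrite Rmin_left by (apply kp_mono; lra).
pose proof (exp_pos (- lam * eta)). assert (0 <= kp a) by now apply kernel_primitive_ge0.
nra.
Qed.

Lemma damped_kernel_le a : a <= T -> damped_kernel a <= damped_mass.
Proof.
intros Ha. unfold damped_kernel, damped_mass.
pose proof (exp_pos (- lam * eta)). assert (kp a <= kp T) by now apply kp_mono.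
pose proof (Rmin_r (kp a) (kp (2 * eta))). nra.
Qed.

Section Mesh.

Variables (t : nat -> R) (n : nat) (W : nat -> X) (G : nat -> nat -> X) (kappa : R).
Hypothesis Ht0 : t 0%nat = 0.
Hypothesis Htn : forall k, (k <= n)%nat -> 0 < step t k <= eta /\ t (S k) <= T /\ 0 <= t k.
Hypothesis HW0 : W 0%nat = u 0.
Hypothesis HW : forall k, (k < n)%nat -> W (S k) = erkc_update E s c (step t k) 1 (W k) (G k).
Hypothesis Hkappa : 0 <= kappa.
Hypothesis HG : forall k, (k <= n)%nat -> forall rho, 0 <= rho <= 1 ->
  norm (minus (interpolant s c (G k) rho) (f (t k + rho * step t k))) <=
  kappa * exp (lam * t (S k)).

Lemma node_error_vle k : (k <= n)%nat -> forall r, 0 <= r ->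
  vle V (E r (minus (W k) (u (t k))))
    (C * kappa * exp (lam * (t k + r)) * (damped_kernel (t k + r) - damped_kernel r)).
Proof.
induction k as [|k IH]; intros Hk r Hr.
- rewrite Ht0, HW0, Rplus_0_l, Rminus_diag, Rmult_0_r.
  replace (minus (u 0) (u 0)) with (@zero X) by vring X.
  destruct (E_bl HE Hr) as [Mr HMr]. rewrite (bl_zero HMr).
  apply (vle_zero HS).
- destruct (Htn (k := k) ltac:(lia)) as (Hh & HT & Htk).
  set (h := step t k) in *.
  assert (Hth : t (S k) = t k + h) by (unfold h, step; ring).
  assert (H1 := IH ltac:(lia) (r + h) ltac:(lra)).
  assert (H2 := @step_vle h (t k) 1 r (kappa * exp (lam * t (S k))) (W k) (G k)
    ltac:(lra) Htk ltac:(lra) ltac:(lra) Hr (HG (k := k) ltac:(lia))).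
  rewrite Rmult_1_l, <- Hth in H2.
  rewrite HW by lia. fold h.
  replace (E r (minus (erkc_update E s c h 1 (W k) (G k)) (u (t (S k))))) with
    (plus (E (r + h) (minus (W k) (u (t k))))
      (minus (E r (minus (erkc_update E s c h 1 (W k) (G k)) (u (t (S k)))))
        (E (r + h) (minus (W k) (u (t k)))))) by vring X.
  eapply vle_weaken; [apply (vle_plus HS H1 H2)|].
  replace (t k + (r + h)) with (t (S k) + r) by (rewrite Hth; ring).
  set (ex := exp (lam * (t (S k) + r))).
  assert (Hex : exp (lam * t (S k)) = ex * exp (- lam * r)).
  { unfold ex. rewrite <- exp_plus. f_equal. ring. }
  rewrite Hex.
  assert (H3 := @damped_kernel_step r h Hr ltac:(lra)).
  assert (Hex0 : 0 < ex) by apply exp_pos.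
  assert (HC := ss_C HS).
  rewrite (Rplus_comm r h).
  replace (C * (kappa * (ex * exp (- lam * r))) * (kp (h + r) - kp r)) with
    (C * kappa * ex * (exp (- lam * r) * (kp (h + r) - kp r))) by ring.
  rewrite <- Rmult_plus_distr_l. apply Rmult_le_compat_l.
  + apply Rmult_le_pos; [|lra]. apply Rmult_le_pos; lra.
  + lra.
Qed.

Lemma dense_error_vle theta : 0 <= theta <= 1 -> lam * step t n <= 1 ->
  vle V (minus (erkc_update E s c (step t n) theta (W n) (G n)) (u (t n + theta * step t n)))
    (C * kappa * damped_mass * exp (lam * (t n + theta * step t n))).
Proof.
intros Hth Hlh. destruct (Htn (k := n) (le_n _)) as (Hh & HT & Htk).
set (h := step t n) in *.
assert (Hth' : 0 <= theta * h <= h) by nra.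
assert (HtS : t (S n) = t n + h) by (unfold h, step; ring).
assert (H1 := @node_error_vle n (le_n _) (theta * h) (proj1 Hth')).
assert (H2 := @step_vle h (t n) theta 0 (kappa * exp (lam * t (S n))) (W n) (G n)
  ltac:(lra) Htk ltac:(lra) Hth (Rle_refl 0) (HG (k := n) (le_n _))).
rewrite (E_zero HE), Rplus_0_l in H2.
replace (minus (erkc_update E s c h theta (W n) (G n)) (u (t n + theta * h))) with
  (plus (E (theta * h) (minus (W n) (u (t n))))
   (minus (minus (erkc_update E s c h theta (W n) (G n)) (u (t n + theta * h)))
    (E (theta * h) (minus (W n) (u (t n)))))) by vring X.
eapply vle_weaken; [apply (vle_plus HS H1 H2)|].
unfold kp at 2. rewrite kernel_primitive_0, Rminus_0_r, Rplus_0_r.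
set (ex := exp (lam * (t n + theta * h))).
assert (Hex : exp (lam * t (S n)) <= ex * 3).
{ rewrite HtS. replace (lam * (t n + h)) with
    (lam * (t n + theta * h) + lam * (h - theta * h)) by ring.
  rewrite exp_plus. apply Rmult_le_compat_l; [left; apply exp_pos|].
  eapply Rle_trans; [|apply exp_le_3]. apply exp_le_mono. nra. }
assert (Hex0 : 0 < ex) by apply exp_pos.
assert (HC := ss_C HS).
assert (H3 := @damped_kernel_near (theta * h) ltac:(lra)).
assert (H4 := @damped_kernel_le (t n + theta * h) ltac:(lra)).
assert (Hk0 : 0 <= kp (theta * h)) by now apply kernel_primitive_ge0.
assert (HCk : 0 <= C * kappa) by (apply Rmult_le_pos; lra).
assert (H5 : exp (lam * t (S n)) * kp (theta * h) <= ex * damped_kernel (theta * h)).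
{ apply Rle_trans with (ex * 3 * kp (theta * h)).
  - apply Rmult_le_compat_r; auto.
  - rewrite Rmult_assoc. apply Rmult_le_compat_l; lra. }
replace (C * (kappa * exp (lam * t (S n))) * kp (theta * h)) with
  (C * kappa * (exp (lam * t (S n)) * kp (theta * h))) by ring.
replace (C * kappa * ex * (damped_kernel (t n + theta * h) - damped_kernel (theta * h))) with
  (C * kappa * (ex * (damped_kernel (t n + theta * h) - damped_kernel (theta * h)))) by ring.
rewrite <- Rmult_plus_distr_l, !Rmult_assoc, <- (Rmult_assoc C kappa).
rewrite <- (Rmult_assoc C kappa (damped_mass * ex)).
apply Rmult_le_compat_l; auto.
apply Rle_trans with (ex * damped_kernel (t n + theta * h)); [lra|].
rewrite (Rmult_comm damped_mass). apply Rmult_le_compat_l; lra.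
Qed.

End Mesh.

End ExactSolution.

End OneStep.

(** * Existence, uniqueness and convergence *)

Section SchemeAnalysis.

Variable X : CompleteNormedModule R_AbsRing.
Variables (E : R -> X -> X) (V : X -> X) (alpha MV M C : R).
Hypothesis Halpha : 0 <= alpha < 1.
Hypothesis HS : smoothing_scale E V alpha MV M C.
Hypothesis HinV : forall v, inV E alpha v <-> exists w, V w = v.
Hypothesis HnormV : forall w, normV E alpha (V w) = norm w.

Variables (g : R -> X -> X -> X) (tau : R -> R) (tau0 : R) (phi : R -> X).
Variables (T : R) (u : R -> X) (Rs L : R).
Hypothesis HT : 0 < T.
Hypothesis Htau0 : 0 < tau0.
Hypothesis Htau : forall r, 0 <= r -> tau0 <= tau r.
Hypothesis Hphi : forall r, r <= 0 -> inV E alpha (phi r).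
Hypothesis Hu : exact_solution E alpha g tau phi T u.
Hypothesis HRs : 0 < Rs.
Hypothesis Hg : lipschitz_in_strip E alpha g tau T u Rs L.

Variables (s : nat) (c : nat -> R).
Hypothesis Hc : collocation_parameters s c.

Let f := rhs_along g tau u.
Hypothesis Hf : forall r, continuous (fun r => f (clamp 0 T r)) r.

Variable Lam : R.
Hypothesis HLam : lebesgue_bound s c X Lam.

Variables (delta lam eta hm : R).
Hypothesis Hdelta : 0 <= delta.
Hypothesis Hlam : 0 <= lam.
Hypothesis Heta : 0 < eta.

Let kp := kernel_primitive alpha.
Let q := damped_mass alpha T lam eta.
Let P := Lam * Rabs L.
(** The a priori bound for the weighted error. It reproduces itself: C q P <= 1/4 gives C q (2 P Q +
    delta) <= Q / 2 + Q / 2. *)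
Let Q := 2 * C * q * delta.

(** This condition closes the Gronwall argument. [HQ] and [Hk2] each grant half of the strip radius,
    one to the propagated node error and the other to the defect within a step; [Hk1] makes the
    stage map a contraction. *)
Hypothesis Hq : C * q * P <= / 4.
Hypothesis HQ : M * (Q * exp (lam * T)) <= Rs / 2.
Hypothesis Hk1 : C * P * kp hm <= / 4.
Hypothesis Hk2 : C * (P * (2 * Rs) + delta) * kp hm <= Rs / 2.
Hypothesis Hhm_tau : hm <= tau0.
Hypothesis Hhm_eta : hm <= eta.
Hypothesis Hhm_lam : lam * hm <= 1.

Variables (N : nat) (t : nat -> R).
Hypothesis Ht0 : t 0%nat = 0.
Hypothesis HtN : t N = T.
Hypothesis Hstep : forall k, (k < N)%nat -> 0 < step t k <= hm.
Hypothesis Hdefect : forall k, (k < N)%nat -> forall rho, 0 <= rho <= 1 ->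
  norm (minus (interpolant s c (fun i => f (t k + c i * step t k)) rho)
    (f (t k + rho * step t k))) <= delta.

Let HE := ss_semigroup HS.
Let HC := ss_C HS.
Let HM := ss_M HS.

Lemma vle_normV v b : vle V v b -> inV E alpha v /\ normV E alpha v <= b.
Proof.
intros [w [<- H]]. rewrite HnormV. split; auto. apply HinV. now exists w.
Qed.

Lemma inV_vle v : inV E alpha v -> vle V v (normV E alpha v).
Proof. intros H. apply HinV in H. destruct H as [w <-]. exists w. rewrite HnormV. split; auto; lra. Qed.

Lemma inV_of_vle v w b : vle V (minus v w) b -> inV E alpha w -> inV E alpha v.
Proof.
intros H1 H2. apply inV_vle in H2.
apply (vle_normV (v := v) (b := b + normV E alpha w)).
replace v with (plus (minus v w) w) by vring X. now apply (vle_plus HS).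
Qed.

Lemma vle_eq_zero v : vle V v 0 -> v = zero.
Proof.
intros [w [<- H]]. replace w with (@zero X).
- apply (bl_zero (ss_linear HS)).
- symmetry. apply norm_eq0. pose proof (norm_ge0 w). lra.
Qed.

Lemma u_inV r : r <= T -> inV E alpha (u r).
Proof.
intros Hr. destruct Hu as (H1 & H2 & _). destruct (Rle_or_lt 0 r); [apply H1; lra|].
rewrite H2 by lra. apply Hphi; lra.
Qed.

Lemma mesh_le k l : (k <= l <= N)%nat -> t k <= t l.
Proof.
intros [Hkl HlN]. induction Hkl as [|l Hkl IH]; [lra|].
specialize (IH ltac:(lia)). pose proof (Hstep (k := l) ltac:(lia)). unfold step in *. lra.
Qed.

Lemma mesh_range k : (k <= N)%nat -> 0 <= t k <= T.
Proof. intros Hk. rewrite <- Ht0 at 1. rewrite <- HtN. split; apply mesh_le; lia. Qed.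

Lemma stage_time_range k i : (k < N)%nat -> (i < s)%nat ->
  t k <= stage_time c t k i <= t (S k) /\ 0 <= stage_time c t k i <= T.
Proof.
intros Hk Hi. pose proof (Hstep Hk). pose proof (proj1 (proj2 Hc) i Hi).
pose proof (@mesh_range k ltac:(lia)). pose proof (@mesh_range (S k) ltac:(lia)).
assert (H3 : t k <= stage_time c t k i <= t (S k)).
{ unfold stage_time. replace (t (S k)) with (t k + step t k) by (unfold step; ring).
  split; nra. }
lra.
Qed.

Lemma delay_le k i : (k < N)%nat -> (i < s)%nat ->
  stage_time c t k i - tau (stage_time c t k i) <= t k.
Proof.
intros Hk Hi. destruct (stage_time_range Hk Hi) as [H1 H2].
pose proof (Htau (r := stage_time c t k i) (proj1 H2)).
pose proof (Hstep Hk). unfold step in *. lra.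
Qed.

Lemma P_ge0 : 0 <= P.
Proof. apply Rmult_le_pos; [left; apply HLam|apply Rabs_pos]. Qed.

Lemma q_ge0 : 0 <= q.
Proof.
apply Rplus_le_le_0_compat; apply Rmult_le_pos; try lra;
try (now apply kernel_primitive_ge0). left; apply exp_pos.
Qed.

Lemma Q_ge0 : 0 <= Q.
Proof. pose proof q_ge0. unfold Q. repeat apply Rmult_le_pos; lra. Qed.

Lemma Q_weight_le r : r <= T -> Q * exp (lam * r) <= Q * exp (lam * T).
Proof.
intros Hr. apply Rmult_le_compat_l; [apply Q_ge0|]. apply exp_le_mono. nra.
Qed.

Lemma Q_weight_Rs r : r <= T -> Q * exp (lam * r) <= Rs.
Proof.
intros Hr. pose proof (Q_weight_le Hr). pose proof Q_ge0.
pose proof (exp_pos (lam * T)).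
assert (0 <= Q * exp (lam * T)) by (apply Rmult_le_pos; lra). nra.
Qed.

Lemma g_lipschitz r v1 v2 w1 w2 y y' : 0 <= r <= T ->
  vle V (minus v1 (u r)) Rs -> vle V (minus v2 (u r)) Rs ->
  vle V (minus w1 (u (r - tau r))) Rs -> vle V (minus w2 (u (r - tau r))) Rs ->
  vle V (minus v1 v2) y -> vle V (minus w1 w2) y' ->
  norm (minus (g r v1 w1) (g r v2 w2)) <= Rabs L * (y + y').
Proof.
intros Hr H1 H2 H3 H4 H5 H6.
assert (Hur : inV E alpha (u r)) by (apply u_inV; lra).
assert (Hurt : inV E alpha (u (r - tau r))).
{ apply u_inV. pose proof (Htau (proj1 Hr)). lra. }
eapply Rle_trans.
{ apply Hg; auto.
  - exact (inV_of_vle H1 Hur).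
  - exact (inV_of_vle H2 Hur).
  - exact (inV_of_vle H3 Hurt).
  - exact (inV_of_vle H4 Hurt).
  - exact (proj2 (vle_normV H1)).
  - exact (proj2 (vle_normV H2)).
  - exact (proj2 (vle_normV H3)).
  - exact (proj2 (vle_normV H4)). }
apply vle_normV in H5. apply vle_normV in H6.
assert (Hpos : forall v, inV E alpha v -> 0 <= normV E alpha v).
{ intros v Hv. apply inV_vle in Hv. now apply (vle_ge0 Hv). }
pose proof (Hpos _ (proj1 H5)). pose proof (Hpos _ (proj1 H6)).
apply Rle_trans with (Rabs L * (normV E alpha (minus v1 v2) + normV E alpha (minus w1 w2))).
- apply Rmult_le_compat_r; [lra|apply Rle_abs].
- apply Rmult_le_compat_l; [apply Rabs_pos|lra].
Qed.

Lemma vle_refl v : vle V (minus v v) 0.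
Proof. replace (minus v v) with (@zero X) by vring X. apply (vle_zero HS). Qed.

(** Interpolating the exact data costs [delta]; replacing exact by computed arguments costs the
    Lebesgue constant times the Lipschitz constant, which is [P]. *)
Lemma defect_le k (Z Y : nat -> X) y y' : (k < N)%nat -> y <= Rs -> y' <= Rs ->
  (forall i, (i < s)%nat -> vle V (minus (Z i) (u (stage_time c t k i))) y) ->
  (forall i, (i < s)%nat -> vle V (minus (Y i)
     (u (stage_time c t k i - tau (stage_time c t k i)))) y') ->
  forall rho, 0 <= rho <= 1 ->
  norm (minus (interpolant s c (fun i => g (stage_time c t k i) (Z i) (Y i)) rho)
    (f (t k + rho * step t k))) <= P * (y + y') + delta.
Proof.
intros Hk Hy Hy' HZ HY rho Hrho.
eapply Rle_trans; [apply (norm_minus_tri _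
  (interpolant s c (fun i => f (t k + c i * step t k)) rho))|].
apply Rplus_le_compat; [|now apply Hdefect].
rewrite interpolant_minus. unfold P. rewrite Rmult_assoc. apply HLam; auto.
intros i Hi. unfold f, rhs_along. fold (stage_time c t k i).
apply g_lipschitz.
- now apply stage_time_range.
- eapply vle_weaken; [now apply HZ|auto].
- eapply vle_weaken; [apply vle_refl|lra].
- eapply vle_weaken; [now apply HY|auto].
- eapply vle_weaken; [apply vle_refl|lra].
- now apply HZ.
- now apply HY.
Qed.

(** The scheme on the first [n] intervals, so that existence and the error bound can be proved
    together by induction on the steps. *)
Definition partial_solution (n : nat) (W : numerical_solution X) : Prop :=
  erkc_solution E alpha g tau phi s c n t W.

Lemma dense_node n W k : partial_solution n W -> (k <= n)%nat -> dense W (t k) = node W k.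
Proof.
intros (_ & H1 & H2 & _ & H4 & H5) Hk. destruct k as [|k].
- rewrite Ht0, H1. apply H4. lra.
- rewrite H2 by lia. rewrite <- H5 by (try lia; lra). f_equal. unfold step. ring.
Qed.

Lemma update_zero h w G : 0 < h -> erkc_update E s c h 0 w G = w.
Proof.
intros Hh. rewrite (erkc_update_conv HS) by lra.
rewrite Rmult_0_l, (RInt_point (V := X)), (E_zero HE). vring X.
Qed.

(** Stages lie on the dense output. For c_i = 0 this passes through the node, because the dense
    formula is stated for theta > 0. *)
Lemma stage_dense n W k i : (n <= N)%nat -> partial_solution n W -> (k < n)%nat -> (i < s)%nat ->
  stage W k i = dense W (stage_time c t k i).
Proof.
intros HnN HW Hk Hi. assert (HW' := HW). destruct HW' as (_ & _ & _ & H3 & _ & H5).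
rewrite H3 by auto. unfold stage_time.
destruct (proj1 (proj2 Hc) i Hi) as [[Hci|Hci] Hci'].
- rewrite H5 by (auto; lra). reflexivity.
- rewrite <- Hci, Rmult_0_l, Rplus_0_r. rewrite (dense_node HW) by lia.
  apply update_zero. apply Hstep. lia.
Qed.

Definition tracks (n : nat) (W : numerical_solution X) : Prop :=
  forall r, 0 <= r <= t n -> vle V (minus (dense W r) (u r)) (Q * exp (lam * r)).

Lemma delayed_vle (n : nat) W k i : (k <= n)%nat -> (n <= N)%nat -> (k < N)%nat -> (i < s)%nat ->
  (forall r, r <= 0 -> dense W r = phi r) -> tracks n W ->
  let r := stage_time c t k i - tau (stage_time c t k i) in
  vle V (minus (dense W r) (u r)) (Q * exp (lam * t k)).
Proof.
intros Hkn HnN HkN Hi H0 HW r.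
assert (Hr : r <= t k) by now apply delay_le.
pose proof Q_ge0. pose proof (exp_pos (lam * t k)).
destruct (Rle_or_lt r 0) as [Hle|Hlt].
- rewrite H0 by auto. destruct Hu as (_ & Hu0 & _). rewrite Hu0 by auto.
  eapply vle_weaken; [apply vle_refl|]. apply Rmult_le_pos; lra.
- eapply vle_weaken.
  + apply HW. pose proof (@mesh_le k n ltac:(lia)). lra.
  + apply Rmult_le_compat_l; auto. apply exp_le_mono. nra.
Qed.

Lemma stages_within_vle n W k i : stages_within E alpha s c n t u Rs W ->
  (n <= N)%nat -> (k < n)%nat -> (i < s)%nat ->
  vle V (minus (stage W k i) (u (stage_time c t k i)))
    (normV E alpha (minus (stage W k i) (u (stage_time c t k i)))).
Proof.
intros HW HnN Hk Hi. apply inV_vle. destruct (HW k i Hk Hi) as [H _].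
assert (Hur : inV E alpha (u (stage_time c t k i))).
{ apply u_inV. apply (@stage_time_range k i); auto. lia. }
apply inV_vle in H. apply inV_vle in Hur.
apply (vle_normV (vle_minus HS H Hur)).
Qed.

Lemma exact_formula r r' : 0 <= r -> r <= r' -> r' <= T ->
  u r' = plus (E (r' - r) (u r)) (RInt (fun p => E (r' - p) (f p)) r r').
Proof. intros H1 H2 H3. now apply Hu. Qed.

(** On the new interval the stages are only known to lie in the strip. The Gronwall estimate is
    therefore applied with their unknown weighted error and solved for it; with the improved bound
    it is applied again to cover the whole interval. *)
Lemma tracks_step n W : (S n <= N)%nat -> partial_solution (S n) W ->
  stages_within E alpha s c (S n) t u Rs W -> tracks n W -> tracks (S n) W.
Proof.
intros HnN HW Hst Htr.
assert (HW' := HW). destruct HW' as (HinW & H1 & H2 & H3 & H4 & H5).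
assert (Hs := proj1 Hc).
pose (y := fun i => normV E alpha (minus (stage W n i) (u (stage_time c t n i)))).
destruct (finite_max y Hs) as [im [Him Hmax]].
pose proof P_ge0 as HP0. pose proof q_ge0 as Hq0. pose proof Q_ge0 as HQ0.
set (ew := exp (lam * t (S n))). assert (Hew : 0 < ew) by apply exp_pos.
(* A common weighted bound for the earlier intervals, where [Q] holds, and for the new stages. *)
set (Ym := Rmax Q (y im / ew)).
assert (HYQ : Q <= Ym) by apply Rmax_l.
assert (HYy : y im <= Ym * ew).
{ apply (Rmult_le_reg_r (/ ew)); [now apply Rinv_0_lt_compat|].
  rewrite Rmult_assoc, Rinv_r, Rmult_1_r by lra. apply Rmax_r. }
assert (Hwmono : forall a b, a <= b -> exp (lam * a) <= exp (lam * b)).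
{ intros a b Hab. apply exp_le_mono. nra. }
assert (Hw1 : forall k, (k <= N)%nat -> 1 <= exp (lam * t k)).
{ intros k Hk. rewrite <- exp_0. apply exp_le_mono.
  pose proof (mesh_range Hk). nra. }
assert (Hbase : forall kappa, P * (Ym + Q) + delta <= kappa -> forall theta, 0 <= theta <= 1 ->
  vle V (minus (erkc_update E s c (step t n) theta (node W n) (stage_value g tau c t W n))
    (u (t n + theta * step t n))) (C * kappa * q * exp (lam * (t n + theta * step t n)))).
{ intros kappa Hkappa theta Htheta.
  pose proof (Rmult_le_pos P (Ym + Q) HP0 ltac:(lra)) as HPY.
  apply (dense_error_vle Halpha HS Hf exact_formula Hlam Heta (W := node W)
    (G := stage_value g tau c t W)); auto.
  - intros k Hk. pose proof (Hstep (k := k) ltac:(lia)).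
    pose proof (@mesh_range k ltac:(lia)). pose proof (@mesh_range (S k) ltac:(lia)). lra.
  - rewrite H1. destruct Hu as (_ & Hu0 & _). symmetry. apply Hu0. lra.
  - lra.
  - intros k Hk rho Hrho. set (ek := exp (lam * t (S k))).
    assert (Hek : 1 <= ek) by (apply Hw1; lia).
    destruct (Nat.eq_dec k n) as [->|Hkn].
    + apply Rle_trans with (P * (y im + Q * exp (lam * t n)) + delta).
      * apply (defect_le (k := n) (Z := stage W n)
          (Y := fun i => dense W (stage_time c t n i - tau (stage_time c t n i)))); auto.
        -- apply (Hst n im); lia.
        -- apply Q_weight_Rs. apply mesh_range. lia.
        -- intros i Hi. eapply vle_weaken.
           ++ apply (@stages_within_vle (S n) W n i); auto.
           ++ apply (Hmax i Hi).
        -- intros i Hi. apply (@delayed_vle n W n i); auto; lia.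
      * fold ek in Hek. fold ew in ek.
        assert (exp (lam * t n) <= ek).
        { apply Hwmono. apply mesh_le. lia. }
        assert (P * (y im + Q * exp (lam * t n)) <= P * ((Ym + Q) * ek)).
        { apply Rmult_le_compat_l; auto. change ew with ek in HYy. nra. }
        assert (delta <= delta * ek) by nra.
        apply Rle_trans with ((P * (Ym + Q) + delta) * ek); [lra|].
        apply Rmult_le_compat_r; lra.
    + apply Rle_trans with (P * (Q * ek + Q * exp (lam * t k)) + delta).
      * apply (defect_le (k := k) (Z := stage W k)
          (Y := fun i => dense W (stage_time c t k i - tau (stage_time c t k i)))); auto.
        -- lia.
        -- apply Q_weight_Rs. apply mesh_range. lia.
        -- apply Q_weight_Rs. apply mesh_range. lia.
        -- intros i Hi. rewrite (stage_dense (n := S n)); auto; try lia.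
           destruct (@stage_time_range k i ltac:(lia) Hi) as [Hr1 Hr2].
           eapply vle_weaken; [apply Htr|].
           ++ pose proof (@mesh_le (S k) n ltac:(lia)). lra.
           ++ apply Rmult_le_compat_l; auto. apply Hwmono. lra.
        -- intros i Hi. apply (@delayed_vle n W k i); auto; lia.
      * assert (exp (lam * t k) <= ek).
        { apply Hwmono. apply mesh_le. lia. }
        assert (P * (Q * ek + Q * exp (lam * t k)) <= P * ((Ym + Q) * ek)).
        { apply Rmult_le_compat_l; auto. nra. }
        assert (delta <= delta * ek) by nra.
        apply Rle_trans with ((P * (Ym + Q) + delta) * ek); [lra|].
        apply Rmult_le_compat_r; lra.
  - pose proof (Hstep (k := n) ltac:(lia)). nra. }
assert (HYm : Ym <= Q).
{ assert (Hyim : y im <= C * (P * (Ym + Q) + delta) * q * ew).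
  { assert (Hv := Hbase _ (Rle_refl _) (c im) (proj1 (proj2 Hc) im Him)).
    rewrite <- H3 in Hv by lia.
    apply vle_normV in Hv. destruct Hv as [_ Hv].
    eapply Rle_trans; [exact Hv|]. apply Rmult_le_compat_l.
    - pose proof (Rmult_le_pos P (Ym + Q) HP0 ltac:(lra)) as HPY.
      repeat apply Rmult_le_pos; lra.
    - apply Hwmono. apply (@stage_time_range n im); auto. }
  (* If the new stages exceeded [Q], then [Ym] would be their weighted error, and three quarters of
     it would be at most three quarters of [Q]. *)
  assert (Hr : y im / ew <= Q / 4 + Ym / 4 + Q / 2).
  { apply (Rmult_le_reg_r ew); auto. unfold Rdiv at 1. rewrite Rmult_assoc, Rinv_l, Rmult_1_r by lra.
    eapply Rle_trans; [exact Hyim|]. apply Rmult_le_compat_r; [lra|].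
    replace (C * (P * (Ym + Q) + delta) * q) with (C * q * P * (Ym + Q) + C * q * delta) by ring.
    assert (C * q * P * (Ym + Q) <= / 4 * (Ym + Q)) by (apply Rmult_le_compat_r; lra).
    assert (C * q * delta = Q / 2) by (unfold Q; field). lra. }
  destruct (Rle_or_lt (y im / ew) Q) as [Hle|Hlt]; [now apply Rmax_lub|].
  unfold Ym in Hr at 1. rewrite Rmax_right in Hr by lra. lra. }
assert (Hfin : C * (P * (Q + Q) + delta) * q <= Q).
{ replace (C * (P * (Q + Q) + delta) * q) with (C * q * P * (Q + Q) + C * q * delta) by ring.
  assert (C * q * P * (Q + Q) <= / 4 * (Q + Q)) by (apply Rmult_le_compat_r; lra).
  assert (C * q * delta = Q / 2) by (unfold Q; field). lra. }
intros r Hr. destruct (Rle_or_lt r (t n)) as [Hle|Hlt]; [apply Htr; lra|].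
assert (Hh := Hstep (k := n) ltac:(lia)).
set (theta := (r - t n) / step t n).
assert (Htheta : 0 < theta <= 1).
{ unfold theta. split; [apply Rdiv_lt_0_compat; lra|].
  apply (Rmult_le_reg_r (step t n)); [lra|].
  replace ((r - t n) / step t n * step t n) with (r - t n) by (field; lra).
  unfold step. lra. }
assert (Hrt : r = t n + theta * step t n) by (unfold theta; field; lra).
rewrite Hrt, H5 by (auto; lia).
eapply vle_weaken.
- apply (Hbase (P * (Q + Q) + delta)); [|lra].
  apply Rplus_le_compat_r, Rmult_le_compat_l; lra.
- apply Rmult_le_compat_r; [left; apply exp_pos|exact Hfin].
Qed.

Lemma partial_solution_0 : exists W, partial_solution 0 W /\
  stages_within E alpha s c 0 t u Rs W /\ tracks 0 W.
Proof.
exists (NumericalSolution (fun _ => phi 0) (fun _ _ => zero)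
  (fun r => if Rle_dec r 0 then phi r else zero)).
destruct Hu as (_ & Hu0 & _).
split; [|split].
- split; [intros; lia|]. split; [reflexivity|]. split; [intros; lia|].
  split; [intros; lia|]. split; [|intros; lia].
  intros r Hr. simpl. destruct (Rle_dec r 0); [reflexivity|lra].
- intros n i Hn. lia.
- intros r Hr. rewrite Ht0 in Hr. replace r with 0 by lra. simpl.
  destruct (Rle_dec 0 0); [|lra]. rewrite Hu0 by lra.
  eapply vle_weaken; [apply vle_refl|].
  apply Rmult_le_pos; [apply Q_ge0|left; apply exp_pos].
Qed.

(** The unknowns are the vectors z_i with V z_i = Z_i - u, so that the strip becomes a ball of X and
    the fixed point lemma applies. *)
Lemma stages_exist n W : (S n <= N)%nat -> partial_solution n W -> tracks n W ->
  exists Z : nat -> X,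
    (forall i, (i < s)%nat -> vle V (minus (Z i) (u (stage_time c t n i))) Rs) /\
    (forall i, (i < s)%nat -> Z i = erkc_update E s c (step t n) (c i) (node W n)
      (fun j => g (stage_time c t n j) (Z j)
         (dense W (stage_time c t n j - tau (stage_time c t n j))))).
Proof.
intros HnN HW Htr.
assert (HW' := HW). destruct HW' as (HinW & H1 & H2 & H3 & H4 & H5).
pose proof P_ge0 as HP0. pose proof Q_ge0 as HQ0.
assert (Hh := Hstep (k := n) ltac:(lia)).
assert (Htn := @mesh_range n ltac:(lia)). assert (HtSn := @mesh_range (S n) ltac:(lia)).
set (h := step t n) in *.
assert (Hth : t n + h = t (S n)) by (unfold h, step; ring).
pose (st := fun z : nat -> X => fun i => plus (u (stage_time c t n i)) (V (z i))).
pose (D := fun j => dense W (stage_time c t n j - tau (stage_time c t n j))).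
pose (G := fun z j => g (stage_time c t n j) (st z j) (D j)).
(* A preimage under [V] is guaranteed only when [z] lies in the ball; elsewhere the value of
   [epsilon] is arbitrary and never inspected. *)
pose (Phi := fun z i => epsilon (inhabits (@zero X)) (fun w => V w =
  minus (erkc_update E s c h (c i) (node W n) (G z)) (u (stage_time c t n i)))).
assert (Hinj : forall x y, V x = V y -> x = y).
{ intros x y Hxy. apply minus_zero_eq, (ss_injective HS).
  rewrite (bl_minus _ _ (ss_linear HS)), Hxy. vring X. }
assert (Hst : forall z i, minus (st z i) (u (stage_time c t n i)) = V (z i)).
{ intros z i. unfold st. vring X. }
assert (HD : forall i, (i < s)%nat -> vle V (minus (D i)
  (u (stage_time c t n i - tau (stage_time c t n i)))) (Q * exp (lam * t n))).
{ intros i Hi. apply (@delayed_vle n W n i); auto; lia. }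
assert (HQRs : Q * exp (lam * t n) <= Rs) by (apply Q_weight_Rs; lra).
assert (Hkh : forall i, (i < s)%nat -> kp (c i * h) <= kp hm).
{ intros i Hi. apply kernel_primitive_mono; auto.
  pose proof (proj1 (proj2 Hc) i Hi). nra. }
assert (Hkh0 : forall r, 0 <= kp r) by (intros; now apply kernel_primitive_ge0).
assert (Hself : forall z, (forall i, (i < s)%nat -> norm (z i) <= Rs) ->
  forall i, (i < s)%nat -> V (Phi z i) =
    minus (erkc_update E s c h (c i) (node W n) (G z)) (u (stage_time c t n i)) /\
    norm (Phi z i) <= Rs).
{ intros z Hz i Hi.
  assert (Hb : forall rho, 0 <= rho <= 1 ->
    norm (minus (interpolant s c (G z) rho) (f (t n + rho * h))) <= P * (2 * Rs) + delta).
  { intros rho Hrho.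
    replace (2 * Rs) with (Rs + Rs) by ring.
    apply (defect_le (k := n) (Z := st z) (Y := D)); auto; try lia; try lra.
    - intros j Hj. rewrite Hst. exists (z j). auto.
    - intros j Hj. eapply vle_weaken; [now apply HD|auto]. }
  assert (Hci := proj1 (proj2 Hc) i Hi).
  assert (Hcih : 0 <= c i * h) by nra.
  assert (HnT : t n + h <= T) by lra.
  assert (Hv := step_vle Halpha HS Hf exact_formula (node W n) (proj1 Hh)
    (proj1 Htn) HnT Hci (Rle_refl 0) Hb).
  rewrite (E_zero HE), Rplus_0_l, Rplus_0_r in Hv.
  rewrite kernel_primitive_0, Rminus_0_r in Hv.
  assert (He : vle V (minus (node W n) (u (t n))) (Q * exp (lam * t n))).
  { rewrite <- (dense_node HW) by lia. apply Htr. lra. }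
  apply (vle_E HS Hcih) in He.
  assert (Hvv := vle_plus HS He Hv).
  replace (plus _ _) with (minus (erkc_update E s c h (c i) (node W n) (G z))
    (u (t n + c i * h))) in Hvv by vring X.
  destruct Hvv as [w [Hw1 Hw2]].
  assert (Heps : V (Phi z i) =
    minus (erkc_update E s c h (c i) (node W n) (G z)) (u (stage_time c t n i))).
  { unfold Phi. apply epsilon_spec. exists w. exact Hw1. }
  split; auto.
  replace (Phi z i) with w.
  - eapply Rle_trans; [exact Hw2|].
    assert (M * (Q * exp (lam * t n)) <= Rs / 2).
    { eapply Rle_trans; [|exact HQ]. apply Rmult_le_compat_l; [lra|].
      apply Q_weight_le. lra. }
    assert (C * (P * (2 * Rs) + delta) * kernel_primitive alpha (c i * h) <= Rs / 2).
    { eapply Rle_trans; [|exact Hk2]. apply Rmult_le_compat_l; [|now apply Hkh].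
      apply Rmult_le_pos; [lra|]. pose proof (Rmult_le_pos P (2 * Rs) HP0 ltac:(lra)). lra. }
    lra.
  - apply Hinj. rewrite Heps. exact Hw1. }
destruct (finite_fixed_point (s := s) (F := Phi) (r := Rs)) as [z [Hz1 Hz2]].
- lra.
- intros z Hz i Hi. now apply Hself.
- intros z z' b Hz Hz' Hb i Hi.
  assert (Hb0 : 0 <= b).
  { pose proof (Hb i Hi). pose proof (norm_ge0 (minus (z i) (z' i))). lra. }
  destruct (Hself z Hz i Hi) as [G1 _]. destruct (Hself z' Hz' i Hi) as [G2 _].
  assert (Hci := proj1 (proj2 Hc) i Hi).
  assert (Hdiff : vle V (minus (erkc_update E s c h (c i) (node W n) (G z))
    (erkc_update E s c h (c i) (node W n) (G z'))) (C * (P * b) * kp (c i * h))).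
  { apply (update_diff_vle Halpha HS); auto; try lra.
    intros rho Hrho. rewrite interpolant_minus. unfold P. rewrite Rmult_assoc.
    apply HLam; auto. intros j Hj. unfold G.
    rewrite <- (Rplus_0_r b). apply g_lipschitz.
    - apply stage_time_range; auto; lia.
    - rewrite Hst. exists (z j). auto.
    - rewrite Hst. exists (z' j). auto.
    - eapply vle_weaken; [now apply HD|auto].
    - eapply vle_weaken; [now apply HD|auto].
    - exists (minus (z j) (z' j)). split; [|now apply Hb].
      rewrite (bl_minus _ _ (ss_linear HS)). unfold st. vring X.
    - apply vle_refl. }
  destruct Hdiff as [w [Hw1 Hw2]].
  replace (minus (Phi z i) (Phi z' i)) with w.
  + eapply Rle_trans; [exact Hw2|].
    assert (Hk := Hkh i Hi). specialize (Hkh0 (c i * h)).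
    apply Rle_trans with (C * P * kp hm * b).
    * replace (C * (P * b) * kp (c i * h)) with (C * P * b * kp (c i * h)) by ring.
      replace (C * P * kp hm * b) with (C * P * b * kp hm) by ring.
      apply Rmult_le_compat_l; auto.
      apply Rmult_le_pos; [apply Rmult_le_pos; [lra|exact HP0]|exact Hb0].
    * apply Rle_trans with (/ 4 * b); [now apply Rmult_le_compat_r|lra].
  + apply Hinj. rewrite (bl_minus _ _ (ss_linear HS)), G1, G2, Hw1. vring X.
- exists (st z). split.
  + intros i Hi. rewrite Hst. exists (z i). auto.
  + intros i Hi. destruct (Hself z Hz1 i Hi) as [G1 _]. rewrite (Hz2 i Hi) in G1.
    unfold st at 1. rewrite G1. transitivity (erkc_update E s c h (c i) (node W n) (G z)); [vring X|reflexivity].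
Qed.

Lemma partial_solution_step n W : (S n <= N)%nat -> partial_solution n W ->
  stages_within E alpha s c n t u Rs W -> tracks n W ->
  exists W', partial_solution (S n) W' /\ stages_within E alpha s c (S n) t u Rs W' /\
    tracks (S n) W'.
Proof.
intros HnN HW Hst Htr.
assert (HW' := HW). destruct HW' as (HinW & H1 & H2 & H3 & H4 & H5).
destruct (stages_exist HnN HW Htr) as [Z [HZ1 HZ2]].
assert (Hh := Hstep (k := n) ltac:(lia)).
set (h := step t n) in *.
set (G := fun j => g (stage_time c t n j) (Z j)
  (dense W (stage_time c t n j - tau (stage_time c t n j)))).
pose (W' := NumericalSolution
  (fun k => if le_dec k n then node W k else erkc_update E s c h 1 (node W n) G)
  (fun k i => if lt_dec k n then stage W k i else Z i)
  (fun r => if Rle_dec r (t n) then dense W r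
            else erkc_update E s c h ((r - t n) / h) (node W n) G)).
assert (Hdense : forall r, r <= t n -> dense W' r = dense W r).
{ intros r Hr. simpl. destruct (Rle_dec r (t n)); auto; lra. }
assert (Hnode : forall k, (k <= n)%nat -> node W' k = node W k).
{ intros k Hk. simpl. destruct (le_dec k n); auto; lia. }
(* Steps are at most [tau0], so delayed times do not exceed [t n] and the extension changes no
   delayed value. *)
assert (Hdel : forall k i, (k <= n)%nat -> (i < s)%nat ->
  dense W' (stage_time c t k i - tau (stage_time c t k i)) =
  dense W (stage_time c t k i - tau (stage_time c t k i))).
{ intros k i Hk Hi. apply Hdense. pose proof (@delay_le k i ltac:(lia) Hi).
  pose proof (@mesh_le k n ltac:(lia)). lra. }
assert (HG1 : forall k i, (k < n)%nat -> (i < s)%nat ->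
  stage_value g tau c t W' k i = stage_value g tau c t W k i).
{ intros k i Hk Hi. unfold stage_value. rewrite Hdel by (auto; lia).
  simpl. destruct (lt_dec k n); auto; lia. }
assert (HG2 : forall i, (i < s)%nat -> stage_value g tau c t W' n i = G i).
{ intros i Hi. unfold stage_value. rewrite Hdel by (auto; lia).
  simpl. destruct (lt_dec n n); auto; lia. }
assert (Htn0 : 0 <= t n) by (apply mesh_range; lia).
assert (HsZ : forall i, (i < s)%nat -> stage W' n i = Z i).
{ intros i Hi. simpl. destruct (lt_dec n n); auto; lia. }
assert (HP : partial_solution (S n) W').
{ split; [|split; [|split; [|split; [|split]]]].
  - intros k i Hk Hi.
    assert (Hur : forall r, r <= T -> inV E alpha (u r)) by apply u_inV.
    destruct (@stage_time_range k i ltac:(lia) Hi) as [Hr1 Hr2].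
    rewrite Hdel by (auto; lia). split.
    + simpl. destruct (lt_dec k n); [now apply HinW|].
      replace k with n in * by lia. eapply inV_of_vle; [now apply HZ1|]. apply Hur. lra.
    + eapply inV_of_vle; [apply (@delayed_vle n W k i); auto; lia|].
      apply Hur. pose proof (Htau (proj1 Hr2)). lra.
  - rewrite Hnode by lia. exact H1.
  - intros k Hk. destruct (Nat.eq_dec k n) as [->|Hkn].
    + rewrite (Hnode n) by lia.
      rewrite (erkc_update_ext E Hc (step t n) 1 (node W n) HG2).
      simpl. destruct (le_dec (S n) n); [lia|reflexivity].
    + rewrite !Hnode by lia.
      rewrite (erkc_update_ext E Hc (step t k) 1 (node W k) (fun i => HG1 k i ltac:(lia))).
      apply H2. lia.
  - intros k i Hk Hi. destruct (Nat.eq_dec k n) as [->|Hkn].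
    + rewrite HsZ, (Hnode n) by (auto; lia).
      rewrite (erkc_update_ext E Hc (step t n) (c i) (node W n) HG2). now apply HZ2.
    + rewrite Hnode by lia.
      rewrite (erkc_update_ext E Hc (step t k) (c i) (node W k) (fun i => HG1 k i ltac:(lia))).
      simpl. destruct (lt_dec k n); [|lia]. apply H3; auto.
  - intros r Hr. rewrite Hdense by lra. now apply H4.
  - intros k theta Hk Htheta. destruct (Nat.eq_dec k n) as [->|Hkn].
    + rewrite (Hnode n) by lia.
      rewrite (erkc_update_ext E Hc (step t n) theta (node W n) HG2).
      fold h. simpl. destruct (Rle_dec (t n + theta * h) (t n)); [nra|].
      f_equal. field. lra.
    + assert (Hsk := Hstep (k := k) ltac:(lia)).
      rewrite Hdense.
      * rewrite Hnode by lia.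
        rewrite (erkc_update_ext E Hc (step t k) theta (node W k) (fun i => HG1 k i ltac:(lia))).
        apply H5; auto; lia.
      * pose proof (@mesh_le (S k) n ltac:(lia)) as Hm.
        replace (t (S k)) with (t k + step t k) in Hm by (unfold step; ring). nra. }
assert (HSt : stages_within E alpha s c (S n) t u Rs W').
{ intros k i Hk Hi. destruct (Nat.eq_dec k n) as [->|Hkn].
  - rewrite HsZ by auto. split.
    + eapply inV_of_vle; [now apply HZ1|]. apply u_inV.
      apply (@stage_time_range n i); auto.
    + apply (vle_normV (HZ1 i Hi)).
  - simpl. destruct (lt_dec k n); [|lia]. now apply Hst. }
exists W'. split; auto. split; auto. apply tracks_step; auto.
intros r Hr. rewrite Hdense by lra. now apply Htr.
Qed.

Lemma partial_solution_exists n : (n <= N)%nat -> exists W, partial_solution n W /\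
  stages_within E alpha s c n t u Rs W /\ tracks n W.
Proof.
induction n as [|n IH]; intros Hn; [apply partial_solution_0|].
destruct (IH ltac:(lia)) as (W & H1 & H2 & H3).
now apply (partial_solution_step (W := W)).
Qed.

(** The solutions agree up to [t n] by induction, so their delayed values on the next interval
    coincide, and the error bound for [W] alone places these in the strip. The stage difference is
    then at most a quarter of itself. *)
Lemma solution_unique W W' : partial_solution N W -> partial_solution N W' ->
  stages_within E alpha s c N t u Rs W -> stages_within E alpha s c N t u Rs W' ->
  tracks N W -> same_solution s N T W W'.
Proof.
intros HW HW' Hst Hst' Htr.
assert (HWc := HW). destruct HWc as (HinW & H1 & H2 & H3 & H4 & H5).
assert (HWc' := HW'). destruct HWc' as (HinW' & H1' & H2' & H3' & H4' & H5').
pose proof P_ge0 as HP0.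
assert (G : forall n, (n <= N)%nat ->
  (forall k, (k <= n)%nat -> node W k = node W' k) /\
  (forall k i, (k < n)%nat -> (i < s)%nat -> stage W k i = stage W' k i) /\
  (forall r, r <= t n -> dense W r = dense W' r)).
{ induction n as [|n IH]; intros Hn.
  - split; [|split].
    + intros k Hk. replace k with 0%nat by lia. now rewrite H1, H1'.
    + intros; lia.
    + intros r Hr. rewrite Ht0 in Hr. now rewrite H4, H4'.
  - destruct (IH ltac:(lia)) as (IH1 & IH2 & IH3).
    assert (Hh := Hstep (k := n) ltac:(lia)).
    set (h := step t n) in *.
    assert (Htn := @mesh_range n ltac:(lia)).
    assert (Hdel : forall i, (i < s)%nat ->
      dense W (stage_time c t n i - tau (stage_time c t n i)) =
      dense W' (stage_time c t n i - tau (stage_time c t n i))).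
    { intros i Hi. apply IH3. apply delay_le; auto. }
    pose (y := fun i => normV E alpha (minus (stage W n i) (stage W' n i))).
    assert (HyV : forall i, (i < s)%nat -> vle V (minus (stage W n i) (stage W' n i)) (y i)).
    { intros i Hi. apply inV_vle.
      assert (A1 := inV_vle (proj1 (HinW n i ltac:(lia) Hi))).
      assert (A2 := inV_vle (proj1 (HinW' n i ltac:(lia) Hi))).
      apply (vle_normV (vle_minus HS A1 A2)). }
    destruct (finite_max y (proj1 Hc)) as [im [Him Hmax]].
    assert (Hstv : forall i, (i < s)%nat ->
      vle V (minus (stage W n i) (u (stage_time c t n i))) Rs).
    { intros i Hi. eapply vle_weaken; [apply (stages_within_vle Hst); auto|].
      now apply Hst. }
    assert (Hstv' : forall i, (i < s)%nat ->
      vle V (minus (stage W' n i) (u (stage_time c t n i))) Rs).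
    { intros i Hi. eapply vle_weaken; [apply (stages_within_vle Hst'); auto|].
      now apply Hst'. }
    assert (HDv : forall i, (i < s)%nat ->
      vle V (minus (dense W (stage_time c t n i - tau (stage_time c t n i)))
       (u (stage_time c t n i - tau (stage_time c t n i)))) Rs).
    { intros i Hi. eapply vle_weaken.
      - apply (@delayed_vle N W n i); auto; lia.
      - apply Q_weight_Rs. lra. }
    assert (Hcontr : forall i, (i < s)%nat ->
      vle V (minus (stage W n i) (stage W' n i)) (y im / 4)).
    { intros i Hi. assert (Hci := proj1 (proj2 Hc) i Hi).
      assert (Hy0 : 0 <= y im) by apply (vle_ge0 (HyV im Him)).
      rewrite H3, H3', IH1 by (auto; lia). fold h.
      eapply vle_weaken.
      - apply (update_diff_vle Halpha HS (node W' n) (b := P * y im)); auto; [lra|].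
        intros rho Hrho. rewrite interpolant_minus. unfold P. rewrite Rmult_assoc.
        apply HLam; auto. intros j Hj. unfold stage_value. cbv zeta. rewrite <- Hdel by auto.
        rewrite <- (Rplus_0_r (y im)). apply g_lipschitz; auto.
        + apply stage_time_range; auto.
        + eapply vle_weaken; [now apply HyV|]. now apply Hmax.
        + apply vle_refl.
      - apply Rle_trans with (C * P * kp hm * y im).
        + replace (C * (P * y im) * kernel_primitive alpha (c i * h)) with
            (C * P * y im * kp (c i * h)) by (unfold kp; ring).
          replace (C * P * kp hm * y im) with (C * P * y im * kp hm) by ring.
          apply Rmult_le_compat_l.
          * apply Rmult_le_pos; [apply Rmult_le_pos; [lra|exact HP0]|exact Hy0].
          * apply kernel_primitive_mono; auto. nra.
        + apply (Rmult_le_compat_r (y im)) in Hk1; auto. lra. }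
    assert (Hy0 : y im <= 0).
    { pose proof (proj2 (vle_normV (Hcontr im Him))) as Hle. fold (y im) in Hle. lra. }
    assert (Hstage : forall i, (i < s)%nat -> stage W n i = stage W' n i).
    { intros i Hi. apply minus_zero_eq, vle_eq_zero.
      eapply vle_weaken; [now apply Hcontr|]. lra. }
    assert (HGv : forall i, (i < s)%nat ->
      stage_value g tau c t W n i = stage_value g tau c t W' n i).
    { intros i Hi. unfold stage_value. now rewrite Hstage, Hdel by auto. }
    split; [|split].
    + intros k Hk. destruct (Nat.eq_dec k (S n)) as [->|]; [|apply IH1; lia].
      rewrite H2, H2', IH1 by lia. now apply erkc_update_ext.
    + intros k i Hk Hi. destruct (Nat.eq_dec k n) as [->|]; [now apply Hstage|].
      apply IH2; auto; lia.
    + intros r Hr. destruct (Rle_or_lt r (t n)) as [Hle|Hlt]; [now apply IH3|].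
      set (theta := (r - t n) / h).
      assert (Htheta : 0 < theta <= 1).
      { unfold theta. split; [apply Rdiv_lt_0_compat; lra|].
        apply (Rmult_le_reg_r h); [lra|].
        replace ((r - t n) / h * h) with (r - t n) by (field; lra).
        unfold h, step. lra. }
      assert (Hrt : r = t n + theta * step t n) by (unfold theta, h in *; field; lra).
      rewrite Hrt, H5, H5', IH1 by (auto; lia). now apply erkc_update_ext. }
destruct (G N (le_n _)) as (G1 & G2 & G3).
split; [auto|]. split; [auto|]. intros r Hr. apply G3. now rewrite HtN.
Qed.

Lemma scheme_convergence : exists W : numerical_solution X,
  erkc_solution E alpha g tau phi s c N t W /\
  stages_within E alpha s c N t u Rs W /\
  (forall W' : numerical_solution X,
     erkc_solution E alpha g tau phi s c N t W' ->
     stages_within E alpha s c N t u Rs W' ->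
     same_solution s N T W W') /\
  (forall r, 0 <= r <= T -> inV E alpha (dense W r) /\
     normV E alpha (minus (dense W r) (u r)) <= 2 * C * q * exp (lam * T) * delta).
Proof.
destruct (@partial_solution_exists N (le_n _)) as (W & H1 & H2 & H3).
exists W. split; [exact H1|]. split; [exact H2|]. split.
- intros W' H1' H2'. now apply solution_unique.
- intros r Hr. assert (Hv : vle V (minus (dense W r) (u r)) (Q * exp (lam * r))).
  { apply H3. now rewrite HtN. }
  split.
  + apply (inV_of_vle Hv). apply u_inV. lra.
  + eapply Rle_trans; [apply (vle_normV Hv)|].
    eapply Rle_trans; [apply Q_weight_le; lra|]. unfold Q. right. ring.
Qed.

End SchemeAnalysis.

(** * Breakpoints and step size restrictions *)

Definition continuous_between (X : CompleteNormedModule R_AbsRing) (a b : R) (f : R -> X)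
    : Prop :=
  forall t, a <= t <= b -> forall e, 0 < e -> exists d, 0 < d /\
    forall r, a <= r <= b -> Rabs (r - t) < d -> norm (minus (f r) (f t)) < e.

Lemma continuous_between_glue (X : CompleteNormedModule R_AbsRing) a b c (f : R -> X) :
  a <= b <= c -> continuous_between a b f -> continuous_between b c f ->
  continuous_between a c f.
Proof.
intros Habc H1 H2 t Ht e He.
destruct (Rtotal_order t b) as [Hlt|[->|Hgt]].
- destruct (H1 t ltac:(lra) e He) as [d [Hd H]].
  exists (Rmin d (b - t)). split; [apply Rmin_pos; lra|]. intros r Hr Hrt.
  assert (Rabs (r - t) < d) by (eapply Rlt_le_trans; [exact Hrt|apply Rmin_l]).
  assert (Rabs (r - t) < b - t) by (eapply Rlt_le_trans; [exact Hrt|apply Rmin_r]).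
  apply H; auto. split_Rabs; lra.
- destruct (H1 b ltac:(lra) e He) as [d1 [Hd1 H3]].
  destruct (H2 b ltac:(lra) e He) as [d2 [Hd2 H4]].
  exists (Rmin d1 d2). split; [now apply Rmin_pos|]. intros r Hr Hrt.
  assert (Rabs (r - b) < d1) by (eapply Rlt_le_trans; [exact Hrt|apply Rmin_l]).
  assert (Rabs (r - b) < d2) by (eapply Rlt_le_trans; [exact Hrt|apply Rmin_r]).
  destruct (Rle_or_lt r b); [apply H3|apply H4]; auto; lra.
- destruct (H2 t ltac:(lra) e He) as [d [Hd H]].
  exists (Rmin d (t - b)). split; [apply Rmin_pos; lra|]. intros r Hr Hrt.
  assert (Rabs (r - t) < d) by (eapply Rlt_le_trans; [exact Hrt|apply Rmin_l]).
  assert (Rabs (r - t) < t - b) by (eapply Rlt_le_trans; [exact Hrt|apply Rmin_r]).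
  apply H; auto. split_Rabs; lra.
Qed.

Lemma continuous_between_uniform (X : CompleteNormedModule R_AbsRing) a b (f : R -> X) :
  a <= b -> continuous_between a b f -> forall e, 0 < e -> exists d, 0 < d /\
    forall x y, a <= x <= b -> a <= y <= b -> Rabs (y - x) < d ->
      norm (minus (f y) (f x)) < e.
Proof.
intros Hab Hf e He.
assert (Hfac := @norm_factor_gt_0 R_AbsRing X).
assert (He' : 0 < e / norm_factor (V := X)) by (apply Rdiv_lt_0_compat; auto).
destruct (unifcont_1d (fun r => f (clamp a b r)) a b) with (eps := mkposreal _ He')
  as [d Hd].
- intros x _. now apply continuous_clamp.
- exists d. split; [apply cond_pos|]. intros x y Hx Hy Hxy.
  specialize (Hd x y Hx Hy Hxy). apply NNPP in Hd.
  rewrite !clamp_id in Hd by auto. apply ball_norm_lt in Hd. simpl in Hd.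
  replace e with (norm_factor (V := X) * (e / norm_factor (V := X))) by (field; lra).
  exact Hd.
Qed.

Section Breakpoints.

Variables (T : R) (tau : R -> R) (tau0 : R) (m : nat) (xi : nat -> R).
Hypothesis Htau : admissible_delay tau tau0.
Hypothesis Hxi : discontinuity_points tau T m xi.

Lemma breakpoint_lt k : (k < m)%nat -> xi k < xi (S k).
Proof.
intros Hk. destruct Hxi as (_ & H & _). destruct (H k Hk) as [H1 H2].
destruct Htau as (_ & H3 & H4 & _). specialize (H4 _ H1). lra.
Qed.

Lemma breakpoint_le k l : (k <= l <= m)%nat -> xi k <= xi l.
Proof.
intros [Hkl Hl]. induction Hkl as [|l Hkl IH]; [lra|].
specialize (IH ltac:(lia)). pose proof (@breakpoint_lt l ltac:(lia)). lra.
Qed.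

(** [f] is a single function on [0, T], so neighbouring closed segments share its value at a
    breakpoint and the one-sided continuities fit together. *)
Lemma continuous_on_segments (X : CompleteNormedModule R_AbsRing) (f : R -> X) :
  (forall mu, (1 <= mu <= m + 1)%nat ->
     forall t, segment T m xi mu t -> forall e, 0 < e -> exists d, 0 < d /\
       forall r, segment T m xi mu r -> Rabs (r - t) < d -> norm (minus (f r) (f t)) < e) ->
  continuous_between 0 T f.
Proof.
intros Hseg. destruct Hxi as (H0 & _ & HT & _).
assert (G : forall k, (k <= m)%nat -> continuous_between 0 (xi k) f).
{ induction k as [|k IH]; intros Hk.
  - rewrite H0. intros t Ht e He. exists 1. split; [lra|]. intros r Hr _.
    replace r with t by lra. replace (minus (f t) (f t)) with (@zero X) by vring X.
    now rewrite norm0.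
  - apply (continuous_between_glue (b := xi k)).
    + rewrite <- H0. split; apply breakpoint_le; lia.
    + apply IH. lia.
    + intros t Ht e He. destruct (Hseg (S k) ltac:(lia) t) with (e := e) as [d [Hd H]]; auto.
      * unfold segment. simpl pred. destruct (Nat.leb_spec (S k) m); [lra|lia].
      * exists d. split; auto. intros r Hr. apply H.
        unfold segment. simpl pred. destruct (Nat.leb_spec (S k) m); [lra|lia]. }
apply (continuous_between_glue (b := xi m)).
- rewrite <- H0 at 1. split; [apply breakpoint_le; lia|lra].
- now apply G.
- intros t Ht e He. destruct (Hseg (S m) ltac:(lia) t) with (e := e) as [d [Hd H]]; auto.
  + unfold segment. simpl pred. destruct (Nat.leb_spec (S m) m); [lia|lra].
  + exists d. split; auto. intros r Hr. apply H.
    unfold segment. simpl pred. destruct (Nat.leb_spec (S m) m); [lia|lra].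
Qed.

Variables (N : nat) (t : nat -> R).
Hypothesis Hmesh : admissible_mesh T m xi N t.

Lemma admissible_mesh_le k l : (k <= l <= N)%nat -> t k <= t l.
Proof.
intros [Hkl Hl]. induction Hkl as [|l Hkl IH]; [lra|].
specialize (IH ltac:(lia)). destruct Hmesh as (_ & _ & H & _).
specialize (H l ltac:(lia)). lra.
Qed.

(** Breakpoints are nodes, so no mesh interval has one in its interior. The index [j] is the last
    one with xi j <= t k, and segments are numbered from 1, hence [S j]. *)
Lemma mesh_interval_in_segment k : (k < N)%nat ->
  exists mu, (1 <= mu <= m + 1)%nat /\
    forall r, t k <= r <= t (S k) -> segment T m xi mu r.
Proof.
intros Hk. destruct Hmesh as (Ht0 & HtN & Hinc & Hpts). destruct Hxi as (H0 & _ & HT & _).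
assert (Htk : 0 <= t k) by (rewrite <- Ht0; apply admissible_mesh_le; lia).
assert (G : forall n, (n <= m)%nat -> exists j, (j <= n)%nat /\ xi j <= t k /\
  (j = n \/ t k < xi (S j))).
{ induction n as [|n IH]; intros Hn.
  - exists 0%nat. rewrite H0. repeat split; auto.
  - destruct (IH ltac:(lia)) as (j & Hj1 & Hj2 & [->|Hj3]).
    + destruct (Rle_or_lt (xi (S n)) (t k)).
      * exists (S n). auto.
      * exists n. repeat split; auto.
    + exists j. repeat split; auto. }
destruct (G m (le_n _)) as (j & Hj1 & Hj2 & Hj3).
exists (S j). split; [lia|]. intros r Hr. unfold segment. simpl pred.
destruct (Nat.leb_spec (S j) m) as [Hjm|Hjm].
- destruct Hj3 as [->|Hj3]; [lia|].
  destruct (Hpts (S j) Hjm) as [l [Hl Htl]].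
  assert (Hkl : (S k <= l)%nat).
  { destruct (le_lt_dec (S k) l); auto.
    pose proof (@admissible_mesh_le l k ltac:(lia)). lra. }
  pose proof (@admissible_mesh_le (S k) l ltac:(lia)). lra.
- pose proof (@admissible_mesh_le (S k) N ltac:(lia)). lra.
Qed.

End Breakpoints.

Lemma step_le_mesh_size (t : nat -> R) N k : (k < N)%nat -> step t k <= mesh_size t N.
Proof.
induction N as [|N IH]; intros Hk; [lia|]. simpl.
destruct (Nat.eq_dec k N) as [->|]; [apply Rmax_r|].
eapply Rle_trans; [apply IH; lia|apply Rmax_l].
Qed.

Lemma Rbar_mult_pos_infty a : 0 < a -> Rbar_mult (Finite a) p_infty = p_infty.
Proof.
intros Ha. unfold Rbar_mult, Rbar_mult'.
destruct (Rle_dec 0 a) as [H|H]; [|lra].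
destruct (Rle_lt_or_eq_dec 0 a H); auto. lra.
Qed.

(** First [eta] is so small that the near part is at most 1/8, then [lam] so large that damping
    brings the far part to at most 1/8, by e^{-z} <= 1 / z with z = lam eta. The third of [d]
    ensures 2 eta < d. *)
Lemma gronwall_parameters (alpha T K : R) : 0 <= alpha < 1 -> 0 <= K ->
  exists lam eta, 0 < lam /\ 0 < eta /\ K * damped_mass alpha T lam eta <= / 4.
Proof.
intros Ha HK.
assert (HkT : 0 <= kernel_primitive alpha T) by now apply kernel_primitive_ge0.
destruct (@kernel_primitive_small alpha Ha (/ (24 * (K + 1)))) as [d [Hd H]].
{ apply Rinv_0_lt_compat. lra. }
exists (8 * (K * kernel_primitive alpha T + 1) / (d / 3)), (d / 3).
assert (HK1 : 0 < K * kernel_primitive alpha T + 1) by nra.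
split; [apply Rdiv_lt_0_compat; lra|]. split; [lra|].
unfold damped_mass.
set (z := 8 * (K * kernel_primitive alpha T + 1)).
replace (- (z / (d / 3)) * (d / 3)) with (- z) by (field; lra).
assert (Hz : exp (- z) <= / z) by (apply exp_neg_le; unfold z; lra).
specialize (H (2 * (d / 3)) ltac:(lra)).
assert (H1 : K * kernel_primitive alpha T * exp (- z) <= / 8).
{ apply Rle_trans with (K * kernel_primitive alpha T * / z).
  - apply Rmult_le_compat_l; [nra|auto].
  - apply (Rmult_le_reg_r z); [unfold z; lra|].
    rewrite Rmult_assoc, Rinv_l by (unfold z; lra). unfold z. lra. }
assert (H2 : K * (3 * kernel_primitive alpha (2 * (d / 3))) <= / 8).
{ apply (Rmult_lt_compat_r (24 * (K + 1))) in H; [|lra].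
  rewrite Rinv_l in H by lra.
  assert (0 <= kernel_primitive alpha (2 * (d / 3))) by now apply kernel_primitive_ge0.
  nra. }
lra.
Qed.

Ltac mult_pos :=
  repeat (match goal with
          | |- 0 < _ * _ => apply Rmult_lt_0_compat
          | |- 0 <= _ * _ => apply Rmult_le_pos
          end); lra.

Theorem theorem4p2 (X : CompleteNormedModule R_AbsRing) (T : R) (HT : 0 < T)
  (A : operator X) (E : R -> X -> X)
  (Asect : sectorial A) (Adense : densely_defined A)
  (Aspec : forall lam : C, spectrum A lam -> 0 < Re lam)
  (EA : semigroup_generated_by_opp A E)
  (alpha : R) (Halpha : 0 <= alpha < 1)
  (tau : R -> R) (tau0 : R) (Htau : admissible_delay tau tau0)
  (phi : R -> X) (Hphi : forall t, t <= 0 -> inV E alpha (phi t))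
  (g : R -> X -> X -> X) (u : R -> X)
  (Hu : exact_solution E alpha g tau phi T u)
  (Rs L : R) (HRs : 0 < Rs) (Hg : lipschitz_in_strip E alpha g tau T u Rs L)
  (m : nat) (xi : nat -> R) (Hxi : discontinuity_points tau T m xi)
  (s : nat) (c : nat -> R) (Hc : collocation_parameters s c)
  (varrho : R) (Hvarrho : 1 < varrho)
  (fs : nat -> R -> X)
  (Hfs : forall mu, (1 <= mu <= m + 1)%nat ->
     is_derive_n_on (segment T m xi mu) (rhs_along g tau u) s (fs mu))
  (Hbd : ess_bounded T m xi fs) :
  exists h0 R0 Cst : R, 0 < h0 /\ 0 < R0 /\ 0 < Cst /\
    forall (N : nat) (t : nat -> R),
      admissible_mesh T m xi N t ->
      (forall j, (S j < N)%nat -> step t j <= varrho * step t (S j)) ->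
      mesh_size t N <= h0 ->
      exists W : numerical_solution X,
        erkc_solution E alpha g tau phi s c N t W /\
        stages_within E alpha s c N t u R0 W /\
        (forall W' : numerical_solution X,
           erkc_solution E alpha g tau phi s c N t W' ->
           stages_within E alpha s c N t u R0 W' ->
           same_solution s N T W W') /\
        (forall r, 0 <= r <= T ->
           inV E alpha (dense W r) /\
           Rbar_le (normV E alpha (minus (dense W r) (u r)))
             (Rbar_mult (Cst * mesh_size t N ^ s) (sup_norm T m xi fs))).
Proof.
destruct (sectorial_analytic Asect Adense Aspec EA) as (B & MB & M & C0 & HA).
destruct (frac_power_scale HA Halpha) as (V & MV & C & HS & HinV & HnormV).
assert (HM := ss_M HS). assert (HC := ss_C HS).
assert (Hs := proj1 Hc).
destruct Htau as (Htau1 & Htau0 & Htau2 & Htau3) eqn:Htau_eq.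
set (f := rhs_along g tau u) in *.
assert (Hfc : continuous_between 0 T f).
{ apply (continuous_on_segments Htau Hxi). intros mu Hmu.
  (* One derivative is available because s >= 1, and this already gives continuity. *)
  assert (Hd := Hfs mu Hmu). replace s with (S (pred s)) in Hd by lia.
  exact (is_derive_n_on_continuous Hd). }
assert (Hf : forall r, continuous (fun r => f (clamp 0 T r)) r).
{ intros r. apply continuous_clamp; auto. lra. }
destruct (lebesgue_bound_exists Hc X) as [Lam HLam].
assert (HLam0 := proj1 HLam).
set (P := Lam * Rabs L).
assert (HP0 : 0 <= P) by (apply Rmult_le_pos; [lra|apply Rabs_pos]).
destruct (@gronwall_parameters alpha T (C * P) Halpha) as (lam & eta & Hlam & Heta & HCP).
{ apply Rmult_le_pos; lra. }
set (q := damped_mass alpha T lam eta) in *.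
assert (Hkp0 : forall r, 0 <= kernel_primitive alpha r)
  by (intros; now apply kernel_primitive_ge0).
assert (Hq0 : 0 <= q).
{ unfold q, damped_mass. pose proof (exp_pos (- lam * eta)).
  pose proof (Hkp0 T). pose proof (Hkp0 (2 * eta)). nra. }
set (eT := exp (lam * T)). assert (HeT : 0 < eT) by apply exp_pos.
(* Chosen so that a defect [delta0] propagates to at most half of the strip radius over [0, T];
   [q + 1] instead of [q] makes it positive from [0 <= q] alone. *)
set (den := 4 * M * C * (q + 1) * eT).
assert (Hden : 0 < den) by (unfold den; mult_pos).
set (delta0 := Rs / den).
assert (Hdelta0 : 0 < delta0) by (apply Rdiv_lt_0_compat; auto).
assert (HQ0 : M * (2 * C * q * delta0 * eT) <= Rs / 2).
{ apply Rle_trans with (den * delta0 / 2).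
  - unfold den. assert (0 <= M * C * delta0 * eT) by (mult_pos). nra.
  - unfold delta0. right. field. lra. }
destruct (@kernel_primitive_small alpha Halpha
  (Rmin (/ (4 * (C * P + 1))) (Rs / (2 * (C * (P * (2 * Rs) + delta0) + 1))))) as [dk [Hdk Hkern]].
{ assert (0 <= C * P) by (apply Rmult_le_pos; lra).
  assert (0 <= C * (P * (2 * Rs) + delta0)).
  { apply Rmult_le_pos; [lra|]. pose proof (Rmult_le_pos P (2 * Rs) HP0 ltac:(lra)). lra. }
  apply Rmin_pos; [apply Rinv_0_lt_compat; lra|apply Rdiv_lt_0_compat; lra]. }
destruct (continuous_between_uniform (Rlt_le _ _ HT) Hfc (e := delta0 / (Lam + 1)))
  as [du [Hdu Hunif]].
{ apply Rdiv_lt_0_compat; lra. }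
(* In turn: delayed arguments precede the current interval, a step fits into the near part of the
   kernel, the weight varies by at most a factor e over a step, the stage map is a contraction of
   the strip, and the oscillation of [f] keeps the defect below [delta0]. *)
set (h0 := Rmin (Rmin tau0 eta) (Rmin (/ lam) (Rmin (dk / 2) (du / 2)))).
assert (Hh0 : 0 < h0).
{ assert (0 < / lam) by now apply Rinv_0_lt_compat.
  repeat apply Rmin_pos; lra. }
assert (Hh_tau : h0 <= tau0) by (eapply Rle_trans; [apply Rmin_l|apply Rmin_l]).
assert (Hh_eta : h0 <= eta) by (eapply Rle_trans; [apply Rmin_l|apply Rmin_r]).
assert (Hh_lam : h0 <= / lam) by (eapply Rle_trans; [apply Rmin_r|apply Rmin_l]).
assert (Hh_dk : h0 <= dk / 2).
{ eapply Rle_trans; [apply Rmin_r|]. eapply Rle_trans; [apply Rmin_r|apply Rmin_l]. }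
assert (Hh_du : h0 <= du / 2).
{ eapply Rle_trans; [apply Rmin_r|]. eapply Rle_trans; [apply Rmin_r|apply Rmin_r]. }
clearbody h0.
(* The added 1 makes the constant positive, so that its product with an infinite supremum is again
   infinite. *)
set (Cst := 2 * C * q * eT * (Lam + 1) + 1).
assert (HCst : 0 < Cst).
{ unfold Cst. assert (0 <= 2 * C * q * eT * (Lam + 1)) by (mult_pos). lra. }
(* The radius of the strip itself serves as the radius of uniqueness. *)
exists h0, Rs, Cst. split; [auto|]. split; [auto|]. split; [auto|].
intros N t Hmesh _ Hms.
assert (Hmesh' := Hmesh). destruct Hmesh' as (Ht0 & HtN & Hinc & _).
assert (HN : (0 < N)%nat).
{ destruct N; [|lia]. rewrite Ht0 in HtN. lra. }
set (ms := mesh_size t N) in *.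
assert (Hstep : forall k, (k < N)%nat -> 0 < step t k <= h0).
{ intros k Hk. split; [unfold step; specialize (Hinc k Hk); lra|].
  exact (Rle_trans _ _ _ (step_le_mesh_size t Hk) Hms). }
assert (Hms0 : 0 < ms).
{ exact (Rlt_le_trans _ _ _ (proj1 (Hstep 0%nat HN)) (step_le_mesh_size t HN)). }
assert (Hrange : forall k, (k < N)%nat -> 0 <= t k /\ t k + step t k <= T).
{ intros k Hk. rewrite <- Ht0 at 1. rewrite <- HtN.
  replace (t k + step t k) with (t (S k)) by (unfold step; ring).
  split; apply (admissible_mesh_le Hmesh); lia. }
assert (Hdef0 : forall k, (k < N)%nat -> forall rho, 0 <= rho <= 1 ->
  norm (minus (interpolant s c (fun i => f (t k + c i * step t k)) rho)
    (f (t k + rho * step t k))) <= delta0).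
{ intros k Hk rho Hrho. destruct (Hstep k Hk) as [Hs1 Hs2]. destruct (Hrange k Hk) as [Hr1 Hr2].
  apply Rle_trans with (Lam * (delta0 / (Lam + 1))).
  - apply interpolation_oscillation; auto. intros i Hi. left.
    assert (Hci := proj1 (proj2 Hc) i Hi).
    apply Hunif; try (split; nra).
    replace (t k + c i * step t k - (t k + rho * step t k)) with ((c i - rho) * step t k) by ring.
    rewrite Rabs_mult, (Rabs_pos_eq (step t k)) by lra.
    assert (Rabs (c i - rho) <= 1) by (split_Rabs; lra).
    pose proof (Rabs_pos (c i - rho)). nra.
  - apply Rle_trans with ((Lam + 1) * (delta0 / (Lam + 1))); [|right; field; lra].
    apply Rmult_le_compat_r; [|lra]. apply Rdiv_le_0_compat; lra. }
(* The restrictions on the step size were fixed with [delta0] and serve every smaller defect; the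
   defect stays open so that it can carry the order. *)
assert (Hmain : forall delta, 0 <= delta <= delta0 ->
  (forall k, (k < N)%nat -> forall rho, 0 <= rho <= 1 ->
    norm (minus (interpolant s c (fun i => f (t k + c i * step t k)) rho)
      (f (t k + rho * step t k))) <= delta) ->
  exists W : numerical_solution X,
    erkc_solution E alpha g tau phi s c N t W /\
    stages_within E alpha s c N t u Rs W /\
    (forall W' : numerical_solution X,
       erkc_solution E alpha g tau phi s c N t W' ->
       stages_within E alpha s c N t u Rs W' ->
       same_solution s N T W W') /\
    (forall r, 0 <= r <= T -> inV E alpha (dense W r) /\
       normV E alpha (minus (dense W r) (u r)) <= 2 * C * q * eT * delta)).
{ intros delta Hdelta Hdef.
  assert (Hkh := Hkern h0 ltac:(lra)).
  assert (Hkh1 : kernel_primitive alpha h0 < / (4 * (C * P + 1)))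
    by (eapply Rlt_le_trans; [exact Hkh|apply Rmin_l]).
  assert (Hkh2 : kernel_primitive alpha h0 < Rs / (2 * (C * (P * (2 * Rs) + delta0) + 1)))
    by (eapply Rlt_le_trans; [exact Hkh|apply Rmin_r]).
  pose proof (Hkp0 h0) as Hk0.
  assert (HCP0 : 0 <= C * P) by (apply Rmult_le_pos; lra).
  pose proof (Rmult_le_pos P (2 * Rs) HP0 ltac:(lra)) as HPR.
  apply (scheme_convergence Halpha HS HinV HnormV
    Htau0 Htau2 Hphi Hu HRs Hg Hc Hf HLam (delta := delta) (lam := lam) (eta := eta) (hm := h0));
    auto; try lra.
  - fold P q. lra.
  - fold q eT. eapply Rle_trans; [|exact HQ0].
    apply Rmult_le_compat_l; [lra|]. apply Rmult_le_compat_r; [lra|].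
    apply Rmult_le_compat_l; [|lra]. mult_pos.
  - fold P. apply (Rmult_lt_compat_r (4 * (C * P + 1))) in Hkh1; [|lra].
    rewrite Rinv_l in Hkh1 by lra. nra.
  - fold P.
    assert (H0 : 0 <= C * (P * (2 * Rs) + delta) <= C * (P * (2 * Rs) + delta0)).
    { split; [apply Rmult_le_pos; lra|]. apply Rmult_le_compat_l; lra. }
    set (b0 := C * (P * (2 * Rs) + delta0)) in *.
    apply (Rmult_lt_compat_r (2 * (b0 + 1))) in Hkh2; [|lra].
    replace (Rs / (2 * (b0 + 1)) * (2 * (b0 + 1))) with Rs in Hkh2 by (field; lra). nra.
  - apply (Rmult_le_compat_l lam) in Hh_lam; [|lra]. rewrite Rinv_r in Hh_lam by lra. exact Hh_lam. }
assert (Hmss : 0 < ms ^ s) by now apply pow_lt.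
assert (HlubP := Lub_Rbar_correct (fun y => exists mu t, (1 <= mu <= m + 1)%nat /\
  segment T m xi mu t /\ y = norm (fs mu t))).
fold (sup_norm T m xi fs) in HlubP. destruct HlubP as [Hub _].
(* The supremum is an extended real. A finite value carries the order; an infinite one makes the
   error bound trivial but leaves existence and uniqueness to be shown. *)
destruct (sup_norm T m xi fs) as [S| |].
- assert (HfsS : forall mu r, (1 <= mu <= m + 1)%nat -> segment T m xi mu r ->
    norm (fs mu r) <= S).
  { intros mu r Hmu Hr. apply (Hub (norm (fs mu r))). now exists mu, r. }
  assert (HS0 : 0 <= S).
  { destruct (mesh_interval_in_segment Hxi Hmesh HN) as [mu [Hmu Hseg]].
    specialize (Hseg (t 0%nat) ltac:(pose proof (Hinc 0%nat HN); lra)).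
    eapply Rle_trans; [|apply (HfsS mu (t 0%nat)); auto]. apply norm_ge0. }
  set (d := (Lam + 1) * S * ms ^ s).
  assert (Hd0 : 0 <= d) by (unfold d; mult_pos).
  (* Both bounds hold for the same defect: [delta0] keeps the solution in the strip, [d] gives the
     power of the mesh size. *)
  destruct (Hmain (Rmin delta0 d)) as (W & H1 & H2 & H3 & H4).
  + split; [apply Rmin_glb; lra|apply Rmin_l].
  + intros k Hk rho Hrho. apply Rmin_glb; [now apply Hdef0|].
    destruct (mesh_interval_in_segment Hxi Hmesh Hk) as [mu [Hmu Hseg]].
    destruct (Hstep k Hk) as [Hs1 Hs2].
    apply Rle_trans with ((Lam + 1) * S * step t k ^ s).
    * apply (interpolation_error Hc (D := segment T m xi mu) (fs := fs mu)); auto; try lra.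
      -- intros r Hr. apply Hseg. unfold step in Hr. lra.
      -- intros r Hr. apply HfsS; auto. apply Hseg. unfold step in Hr. lra.
    * unfold d. apply Rmult_le_compat_l; [apply Rmult_le_pos; lra|].
      apply pow_incr. split; [lra|]. now apply step_le_mesh_size.
  + exists W. split; [auto|]. split; [auto|]. split; [auto|].
    intros r Hr. destruct (H4 r Hr) as [H5 H6]. split; auto.
    simpl. eapply Rle_trans; [exact H6|].
    apply Rle_trans with (2 * C * q * eT * d).
    * apply Rmult_le_compat_l; [mult_pos|apply Rmin_r].
    * unfold d, Cst. assert (0 <= ms ^ s * S) by (apply Rmult_le_pos; lra). nra.
- destruct (Hmain delta0 ltac:(lra) Hdef0) as (W & H1 & H2 & H3 & H4).
  exists W. split; [auto|]. split; [auto|]. split; [auto|].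
  intros r Hr. destruct (H4 r Hr) as [H5 H6]. split; auto.
  rewrite Rbar_mult_pos_infty by (apply Rmult_lt_0_compat; auto). exact I.
(* Segments contain points, so the supremum is at least a norm and cannot be minus infinity. *)
- exfalso. destruct (mesh_interval_in_segment Hxi Hmesh HN) as [mu [Hmu Hseg]].
  specialize (Hseg (t 0%nat) ltac:(pose proof (Hinc 0%nat HN); lra)).
  apply (Hub (norm (fs mu (t 0%nat)))). now exists mu, (t 0%nat).
Qed.
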